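(* Consider the following two small groups $G\subseteq\mathrm{GL}(4,\mathbb{C})$ and the quotient $X_0:=\mathbb{C}^4/G$. The class group $\mathrm{Cl}(X_0)$ and the Cox ring $\mathcal{R}(X_0)=\mathbb{C}[T_1,\ldots,T_r]/I$, graded by $\mathrm{Cl}(X_0)$ such that $\deg(T_j)$ is the $j$-th column of the degree matrix $Q_0$, are as follows. (S3) $G\cong S_3$ generated by $\begin{pmatrix}0&-1&0&0\\1&-1&0&0\\0&0&0&-1\\0&0&1&-1\end{pmatrix}$, $\begin{pmatrix}-1&1&0&0\\0&1&0&0\\0&0&-1&1\\0&0&0&1\end{pmatrix}$: $\mathrm{Cl}(X_0)=\mathbb{Z}/2\mathbb{Z}$, $r=12$, $Q_0=[\bar1\ \bar1\ \bar1\ \bar1\ \bar1\ \bar0\ \bar0\ \bar0\ \bar0\ \bar0\ \bar0\ \bar0]$, and $I$ is generated by $3T_9T_{10}-T_7T_{11}+T_6T_{12}$, $3T_5T_{10}-2T_4T_{11}+T_3T_{12}$, $3T_6T_8+T_9T_{11}-T_7T_{12}$, $3T_4T_8-T_2T_{11}-2T_5T_{12}$, $3T_3T_8-3T_2T_{10}-T_5T_{11}-T_4T_{12}$, $T_5T_7-2T_4T_9+T_1T_{12}$, $T_4T_7-2T_3T_9+T_1T_{11}$, $T_2T_7-3T_1T_8+2T_5T_9$, $T_5T_6-T_3T_9+T_1T_{11}$, $2T_4T_6-T_3T_7+3T_1T_{10}$, $T_2T_6+T_4T_9-T_1T_{12}$, $T_1T_5+6T_9T_{11}-3T_7T_{12}$,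 $T_4^2-T_3T_5-3T_{11}^2+9T_{10}T_{12}$, $T_2T_4+T_5^2+9T_8T_{11}-3T_{12}^2$, $T_1T_4+3T_7T_{11}-6T_6T_{12}$, $T_2T_3+T_4T_5+27T_8T_{10}-3T_{11}T_{12}$, $T_1T_3+9T_7T_{10}-6T_6T_{11}$, $T_1T_2+9T_7T_8-6T_9T_{12}$, $T_1^2+3T_7^2-12T_6T_9$, $4T_9^3-T_2^2-27T_8^2$, $2T_7T_9^2+T_2T_5-9T_8T_{12}$, $4T_6T_9^2-T_5^2-3T_{12}^2$, $2T_1T_9^2-9T_5T_8-3T_2T_{12}$, $T_7^2T_9-4T_6T_9^2-9T_8T_{11}+3T_{12}^2$, $2T_6T_7T_9-T_4T_5-3T_{11}T_{12}$, $T_1T_7T_9-3T_2T_{11}-3T_5T_{12}$, $4T_6^2T_9-T_3T_5-6T_{11}^2+9T_{10}T_{12}$, $2T_1T_6T_9+3T_5T_{11}-3T_4T_{12}$, $T_7^3-4T_6T_7T_9-27T_8T_{10}+3T_{11}T_{12}$, $T_6T_7^2-4T_6^2T_9+3T_{11}^2-9T_{10}T_{12}$, $T_1T_7^2-4T_1T_6T_9-9T_3T_8-3T_5T_{11}+6T_4T_{12}$, $2T_6^2T_7-T_3T_4-9T_{10}T_{11}$, $T_1T_6T_7+3T_4T_{11}-3T_3T_{12}$, $4T_6^3-T_3^2-27T_{10}^2$, $2T_1T_6^2+9T_4T_{10}-3T_3T_{11}$. (D8) $G\cong D_8$ (dihedral of order 8) generated by $\begin{pmatrix}0&-1&0&0\\1&0&0&0\\0&0&0&-1\\0&0&1&0\end{pmatrix}$,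 $\begin{pmatrix}1&0&0&0\\0&-1&0&0\\0&0&1&0\\0&0&0&-1\end{pmatrix}$: $\mathrm{Cl}(X_0)=\mathbb{Z}/2\mathbb{Z}\times\mathbb{Z}/2\mathbb{Z}$, $r=10$, $Q_0=\begin{bmatrix}\bar1&\bar1&\bar1&\bar1&\bar1&\bar1&\bar0&\bar0&\bar0&\bar0\\\bar1&\bar1&\bar1&\bar0&\bar0&\bar0&\bar1&\bar0&\bar0&\bar0\end{bmatrix}$, and $I$ is generated by $T_5T_8+T_4T_9-2T_6T_{10}$, $T_3T_8+T_1T_9-T_2T_{10}$, $T_7^2-T_8T_9+T_{10}^2$, $T_6T_7+2T_1T_9-T_2T_{10}$, $T_5T_7+T_2T_9-2T_3T_{10}$, $T_4T_7-T_2T_8+2T_1T_{10}$, $2T_3T_7-T_6T_9+T_5T_{10}$, $T_2T_7-T_4T_9+T_6T_{10}$, $2T_1T_7+T_6T_8-T_4T_{10}$, $T_4T_5-T_6^2+T_8T_9-T_{10}^2$, $T_2T_5-2T_3T_6+T_7T_9$, $2T_1T_5-T_2T_6+T_7T_{10}$, $T_3T_4-T_1T_5-T_7T_{10}$, $T_2T_4-2T_1T_6-T_7T_8$, $4T_3^2+T_5^2-T_9^2$, $2T_2T_3+T_5T_6-T_9T_{10}$, $4T_1T_3+T_6^2-T_{10}^2$, $T_2^2+T_6^2-T_8T_9$, $2T_1T_2+T_4T_6-T_8T_{10}$, $4T_1^2+T_4^2-T_8^2$.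
   Context: A matrix group is small if it contains no pseudo-reflections (finite-order elements whose fixed space is a hyperplane). Cox ring: for a normal variety $X$ with $\Gamma(X,\mathcal{O}^* )=\mathbb{C}^*$ and finitely generated class group, $\mathcal{R}(X)=\bigoplus_{[D]\in\mathrm{Cl}(X)}\Gamma(X,\mathcal{O}(D))$. In the presence of torsion this is made precise as follows: choose a finitely generated group $K$ of Weil divisors mapping onto $\mathrm{Cl}(X)$ with kernel $K^0$ and a homomorphism $\chi\colon K^0\to\mathbb{C}(X)^*$ with $\mathrm{div}(\chi(E))=E$; then $\mathcal{R}(X)$ is the ring of global sections of $\bigoplus_{D\in K}\mathcal{O}(D)$ modulo the ideal sheaf generated by all $1-\chi(E)$, $E\in K^0$ ($\chi(E)$ in degree $-E$). The identification with the listed rings is as graded algebras. *)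

(* Defs.v *)
From HB Require Import structures.
From mathcomp Require Import all_boot all_order all_algebra.
From mathcomp Require Import all_fingroup all_solvable.
From mathcomp Require Import boolp classical_sets functions reals complex.
From mathcomp Require Import freeg mpoly.

Set Implicit Arguments.
Unset Strict Implicit.
Unset Printing Implicit Defensive.

Import Order.TTheory GRing.Theory Num.Theory.
Local Open Scope ring_scope.

Definition grpAlg (F : fieldType) (M : zmodType) : Type := {freeg M / F}.

Section GroupAlgebra.
Variables (F : fieldType) (M : zmodType).
HB.instance Definition _ := GRing.Lmodule.on (grpAlg F M).
Implicit Types x y z : grpAlg F M.

Definition gmon (c : F) (D : M) : grpAlg F M := << c *g D >>.

(* Bilinear extension of  X^D * X^E = X^(D + E). *)
Definition gmul x y : grpAlg F M :=
  fglift (fun D => fglift (fun E => gmon 1 (D + E)) y : grpAlg F M) x.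

Lemma gmon_ind (P : grpAlg F M -> Prop) :
  P 0 -> (forall x y, P x -> P y -> P (x + y)) ->
  (forall c D, P (gmon c D)) -> forall x, P x.
Proof.
move=> P0 PD PU x; rewrite -[x](@freeg_sumE F M).
by elim/big_rec: _ => // D y _ Py; exact: PD (PU _ _) Py.
Qed.

Lemma gmonD c c' D : gmon (c + c') D = gmon c D + gmon c' D.
Proof. by rewrite /gmon -freegUD. Qed.

Lemma scale_gmon c c' D : c *: gmon c' D = gmon (c * c') D.
Proof.
by apply/eqP/freeg_eqP => E; rewrite coeffZ !coeffU mulrA.
Qed.

Lemma fgliftB (f : M -> grpAlg F M) : {morph @fglift F _ M f : x y / x - y}.
Proof. by move=> x y; exact: (@lift_is_additive F M (grpAlg F M) f x y). Qed.

Lemma fglift0 (f : M -> grpAlg F M) : fglift f 0 = 0.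
Proof. by rewrite -[X in fglift _ X](subrr 0) fgliftB subrr. Qed.

Lemma fgliftD (f : M -> grpAlg F M) : {morph @fglift F _ M f : x y / x + y}.
Proof.
move=> x y; rewrite -{1}[y]opprK fgliftB; congr (_ + _).
by rewrite -[- y]add0r fgliftB fglift0 sub0r opprK.
Qed.

Lemma gmulDl x y z : gmul (x + y) z = gmul x z + gmul y z.
Proof. exact: fgliftD. Qed.

Lemma gmul0l x : gmul 0 x = 0. Proof. exact: fglift0. Qed.

Lemma gmul_monl c D y :
  gmul (gmon c D) y = c *: fglift (fun E => gmon 1 (D + E)) y.
Proof. exact: liftU. Qed.

Lemma gmulMM c D c' E : gmul (gmon c D) (gmon c' E) = gmon (c * c') (D + E).
Proof. by rewrite gmul_monl liftU !scale_gmon mulr1. Qed.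

Lemma gmulDr x y z : gmul x (y + z) = gmul x y + gmul x z.
Proof.
elim/gmon_ind: x => [|x x' IH IH'|c D]; first by rewrite !gmul0l addr0.
- by rewrite !gmulDl IH IH' addrACA.
- by rewrite !gmul_monl fgliftD scalerDr.
Qed.

Lemma gmul0r x : gmul x 0 = 0.
Proof.
by apply/(@addrI _ (gmul x 0)); rewrite -gmulDr !addr0.
Qed.

Lemma gmulC : commutative gmul.
Proof.
move=> x y; elim/gmon_ind: x => [|x x' IH IH'|c D].
- by rewrite gmul0l gmul0r.
- by rewrite gmulDl gmulDr IH IH'.
elim/gmon_ind: y => [|y y' IH IH'|c' E].
- by rewrite gmul0l gmul0r.
- by rewrite gmulDl gmulDr IH IH'.
- by rewrite !gmulMM mulrC addrC.
Qed.

Lemma gmulA : associative gmul.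
Proof.
move=> x y z; elim/gmon_ind: x => [|x x' IH IH'|c D].
- by rewrite !gmul0l.
- by rewrite !gmulDl IH IH'.
elim/gmon_ind: y => [|y y' IH IH'|c' E].
- by rewrite gmul0r !gmul0l gmul0r.
- by rewrite gmulDl !gmulDr gmulDl IH IH'.
elim/gmon_ind: z => [|z z' IH IH'|c'' G].
- by rewrite !gmul0r.
- by rewrite !gmulDr IH IH'.
- by rewrite !gmulMM mulrA addrA.
Qed.

Lemma gmul1l : left_id (gmon 1 0) gmul.
Proof.
move=> x; elim/gmon_ind: x => [|x x' IH IH'|c D]; first by rewrite gmul0r.
- by rewrite gmulDr IH IH'.
- by rewrite gmulMM mul1r add0r.
Qed.

Lemma gone_neq0 : gmon 1 0 != 0.
Proof. by rewrite freegU_eq0 oner_eq0. Qed.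

HB.instance Definition _ := GRing.Zmodule_isComNzRing.Build (grpAlg F M)
  gmulA gmulC gmul1l gmulDl gone_neq0.

Lemma gmonM c c' D E : gmon c D * gmon c' E = gmon (c * c') (D + E).
Proof. exact: gmulMM. Qed.

Lemma gmon10 : gmon 1 0 = 1. Proof. by []. Qed.

Lemma coeff_gmulP (P : M -> Prop) x y :
  (forall D E, D \in dom x -> E \in dom y -> P (D + E)) ->
  forall D, D \in dom (x * y) -> P D.
Proof.
move=> PDE D; rewrite -[x in x * y](@freeg_sumE F M) mulr_suml.
move=> /dom_sum_subset/flattenP[s /mapP[E + ->]].
rewrite filter_predT => Ex; rewrite -[y in _ * y](@freeg_sumE F M) mulr_sumr.
move=> /dom_sum_subset/flattenP[s' /mapP[G + ->]].
rewrite filter_predT => Gy.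
rewrite -![<< _ *g _ >>]/(gmon _ _) gmonM mem_dom coeffU.
case EG: (_ == D); last by rewrite mulr0 eqxx.
by move/eqP: EG => <- _; exact: PDE.
Qed.
End GroupAlgebra.

(* Finite sums of products a * g with a in S and g in gens. *)
Definition ideal_gen (R : comNzRingType) (S gens : R -> Prop) (x : R) : Prop :=
  exists n (a g : 'I_n -> R),
    [/\ forall i, S (a i), forall i, gens (g i) & x = \sum_(i < n) a i * g i].

Lemma ideal_genD (R : comNzRingType) (S gens : R -> Prop) x y :
  ideal_gen S gens x -> ideal_gen S gens y -> ideal_gen S gens (x + y).
Proof.
move=> [n [a [g [Sa Gg ->]]]] [m [b [h [Sb Gh ->]]]].
exists (n + m)%N, (fun i => match fintype.split i with inl j => a j | inr j => b j end),
  (fun i => match fintype.split i with inl j => g j | inr j => h j end).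
split=> [i|i|]; try by case: fintype.split.
rewrite big_split_ord; congr (_ + _); apply: eq_bigr => i _.
- by rewrite -[lshift m i]/(unsplit (inl i)) unsplitK.
- by rewrite -[rshift n i]/(unsplit (inr i)) unsplitK.
Qed.

Lemma ideal_genM (R : comNzRingType) (S S' gens : R -> Prop) x y :
  (forall a, S a -> S' (x * a)) -> ideal_gen S gens y ->
  ideal_gen S' gens (x * y).
Proof.
move=> SS' [n [a [g [Sa Gg ->]]]].
exists n, (fun i => x * a i), g; split=> [i||] //; first exact: SS'.
by rewrite mulr_sumr; apply: eq_bigr => i _; rewrite mulrA.
Qed.

Lemma ideal_gen0 (R : comNzRingType) (S gens : R -> Prop) : ideal_gen S gens 0.
Proof.
have f0 : 'I_0 -> R by case.
by exists 0%N, f0, f0; split=> [[]|[]|] //; rewrite big_ord0.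
Qed.

Section Divisors.
Variable A : idomainType.
Local Notation F := {fraction A}.
Local Notation "a %:F" := (tofrac a).

(* The points of Spec A, encoded as boolean predicates on A. *)
Record spec := Spec {
  prime_of :> A -> bool;
  _ : `[< idealr_closed prime_of /\ prime_idealr_closed prime_of >] }.
HB.instance Definition _ := [isSub for prime_of].
HB.instance Definition _ := [Choice of spec by <:].

Lemma specP (p : spec) : idealr_closed p /\ prime_idealr_closed p.
Proof. by case: p => ? /= /asboolP. Qed.

Lemma spec1 (p : spec) : ~~ p 1.
Proof. by have [[_ ? _] _] := specP p. Qed.

Lemma specM (p : spec) a b : ~~ p a -> ~~ p b -> ~~ p (a * b).
Proof.
have [_ pP] := specP p; move=> pa pb; apply/negP => /(pP a b)/orP[] pab.
- by rewrite [p a]pab in pa.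
- by rewrite [p b]pab in pb.
Qed.

Lemma specMN (p : spec) a b : ~~ p (a * b) -> ~~ p a /\ ~~ p b.
Proof.
have [[p0 _ pI] _] := specP p; move=> pab; split; apply: contra pab => h.
- by rewrite mulrC -[b * a]addr0; exact: pI.
- by rewrite -[a * b]addr0; exact: pI.
Qed.

Lemma spec_neq0 (p : spec) s : ~~ p s -> s%:F != 0.
Proof.
move=> ps; rewrite tofrac_eq0; apply: contra ps => /eqP->.
by have [[]] := specP p.
Qed.

Lemma generic_subproof :
  `[< idealr_closed (fun a : A => a == 0) /\
      prime_idealr_closed (fun a : A => a == 0) >].
Proof.
apply/asboolP; split; first split.
- exact: eqxx.
- exact: oner_neq0.
- by move=> a u v /eqP-> /eqP->; rewrite mulr0 addr0; exact: eqxx.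
- by move=> u v; rewrite !unfold_in mulf_eq0.
Qed.
Definition generic_point : spec := Spec generic_subproof.
HB.instance Definition _ := isPointed.Build spec generic_point.

Definition height1 (p : spec) : Prop :=
  (exists2 a, p a & a != 0) /\
  forall q : spec, (forall a, q a -> p a) -> (exists2 a, q a & a != 0) ->
    forall a, p a -> q a.

Record primeDiv := PrimeDiv {
  generic_of :> spec;
  _ : `[< height1 generic_of >] }.
HB.instance Definition _ := [isSub for generic_of].
HB.instance Definition _ := [Choice of primeDiv by <:].

Definition weilDiv : zmodType := {freeg primeDiv / int}.

(* The local ring at p and its maximal ideal, inside the function field. *)
Definition locring (p : spec) (f : F) : Prop :=
  exists a s : A, ~~ p s /\ f = a%:F / s%:F.

Definition locmax (p : spec) (f : F) : Prop :=
  exists a s : A, [/\ p a, ~~ p s & f = a%:F / s%:F].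

Definition locunit (p : spec) (f : F) : Prop :=
  [/\ f != 0, locring p f & locring p f^-1].

Definition uniformizer (p : spec) (t : F) : Prop :=
  t != 0 /\ forall f, locmax p f <-> locring p (f / t).

(* When the local ring at P is a discrete valuation ring, as it is at the     *)
(* codimension one points of a normal variety, [ord_ge P f n] says            *)
(* v_P(f) >= n (with v_P(0) = +oo) and [ord_eq P f n] says v_P(f) = n.        *)
Definition ord_ge (P : primeDiv) (f : F) (n : int) : Prop :=
  forall t, uniformizer P t -> locring P (f / t ^ n).

Definition ord_eq (P : primeDiv) (f : F) (n : int) : Prop :=
  forall t, uniformizer P t -> locunit P (f / t ^ n).

Definition is_div (f : F) (D : weilDiv) : Prop :=
  f != 0 /\ forall P : primeDiv, ord_eq P f (coeff P D).

Definition principal : {pred weilDiv} := fun D => `[< exists f, is_div f D >].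

Lemma locring_tofrac p a : locring p a%:F.
Proof. by exists a, 1; rewrite spec1 rmorph1 divr1. Qed.

Lemma locring1 p : locring p 1.
Proof. by rewrite -(rmorph1 (@tofrac A)); exact: locring_tofrac. Qed.

Lemma locring0 p : locring p 0.
Proof. by rewrite -(rmorph0 (@tofrac A)); exact: locring_tofrac. Qed.

Lemma locringM p f g : locring p f -> locring p g -> locring p (f * g).
Proof.
move=> [a [s [ps ->]]] [b [t [pt ->]]]; exists (a * b), (s * t).
by split; [exact: specM | rewrite !rmorphM /= mulf_div].
Qed.

Lemma locringB p f g : locring p f -> locring p g -> locring p (f - g).
Proof.
move=> [a [s [ps ->]]] [b [t [pt ->]]]; exists (a * t - b * s), (s * t).
split; first exact: specM.
rewrite rmorphB !rmorphM /= -!mulNr addf_div ?(spec_neq0 ps) ?(spec_neq0 pt) //.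
Qed.

Lemma locunitM p f g : locunit p f -> locunit p g -> locunit p (f * g).
Proof.
move=> [f0 fp fVp] [g0 gp gVp].
by split; [rewrite mulf_neq0 | exact: locringM | rewrite invfM; exact: locringM].
Qed.

Lemma locunitV p f : locunit p f -> locunit p f^-1.
Proof. by move=> [f0 fp fVp]; split; rewrite ?invr_eq0 ?invrK. Qed.

Lemma is_div1 : is_div 1 0.
Proof.
split=> [|P t _]; first exact: oner_neq0.
rewrite coeff0 expr0z divr1; split; first exact: oner_neq0.
- exact: locring1.
- by rewrite invr1; exact: locring1.
Qed.

Lemma is_divB f g D E : is_div f D -> is_div g E -> is_div (f / g) (D - E).
Proof.
move=> [f0 fD] [g0 gE]; split=> [|P t tP]; first by rewrite mulf_neq0 ?invr_eq0.
have := locunitM (fD P t tP) (locunitV (gE P t tP)).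
congr locunit; rewrite coeffB expfzDr ?tP.1 // -invr_expz !invfM !invrK.
by rewrite [RHS]mulrACA.
Qed.

Lemma principal_zmod_closed : zmod_closed principal.
Proof.
split; first by apply/asboolP; exists 1; exact: is_div1.
move=> D E /asboolP[f fD] /asboolP[g gE]; apply/asboolP.
by exists (f / g); exact: is_divB.
Qed.
HB.instance Definition _ :=
  GRing.isZmodClosed.Build weilDiv principal principal_zmod_closed.

Definition classGroup : zmodType := Quotient.quot principal.
Definition divClass (D : weilDiv) : classGroup := (\pi_(Quotient.quot principal) D)%qT.

(* The choices in the construction of the Cox ring: generators of a group K   *)
(* of Weil divisors mapping onto the class group, and a homomorphism chi,     *)
(* whose values are only relevant on the kernel K0 of K -> Cl(X).             *)
Record coxData := CoxData {
  cox_rank : nat;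
  cox_gens : cox_rank.-tuple weilDiv;
  cox_chi : weilDiv -> F;
  cox_onto : forall c : classGroup,
    exists2 D, inIntSpan cox_gens D & divClass D = c;
  cox_chi_div : forall E, inIntSpan cox_gens E -> E \in principal ->
    is_div (cox_chi E) E;
  cox_chiM : forall E E', inIntSpan cox_gens E -> E \in principal ->
    inIntSpan cox_gens E' -> E' \in principal ->
    cox_chi (E + E') = cox_chi E * cox_chi E' }.
End Divisors.

Section CoxRing.
Variables (A : idomainType) (K : coxData A).
Local Notation F := {fraction A}.
Local Notation "a %:F" := (tofrac a).
Local Notation spec := (spec A).
Local Notation Div := (weilDiv A).
Local Notation GA := (grpAlg F Div).

Definition coxK (D : Div) : Prop := inIntSpan (cox_gens K) D.
Definition coxK0 (D : Div) : Prop := coxK D /\ D \in @principal A.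

(* Sections of O(D) over the principal open set D(h) = {p | h \notin p}.      *)
Definition sheafO (D : Div) (h : A) (f : F) : Prop :=
  forall P : primeDiv A, ~~ P h -> ord_ge P f (- coeff P D).

(* Sections over D(h) of the sheaf S of K-graded algebras, the direct sum of  *)
(* the O(D) with D in K; f in O(D) is written f X^D.                          *)
Definition sheafS (h : A) (x : GA) : Prop :=
  forall D, D \in dom x -> coxK D /\ sheafO D h (coeff D x).

Definition chi_rel (x : GA) : Prop :=
  exists2 E, coxK0 E & x = 1 - gmon (cox_chi K E) (- E).

(* Stalks of S and of the ideal sheaf generated by the 1 - chi(E).            *)
Definition stalkS (p : spec) (x : GA) : Prop :=
  exists2 h, ~~ p h & sheafS h x.

Definition stalkI (p : spec) (x : GA) : Prop :=
  exists2 h, ~~ p h & ideal_gen (sheafS h) chi_rel x.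

(* [s] gives for every point a representative of a germ of S / I; these germs *)
(* have to be induced, locally, by sections of S lying in the given degrees.  *)
Definition is_quot_section (deg : Div -> Prop) (s : spec -> GA) : Prop :=
  forall p : spec, exists h x, [/\ ~~ p h, sheafS h x,
    forall D, D \in dom x -> deg D &
    forall q : spec, ~~ q h -> stalkI q (s q - x)].

Definition cox_section : {pred spec -> GA} :=
  fun s => `[< is_quot_section (fun=> True) s >].

Lemma coxKB D E : coxK D -> coxK E -> coxK (D - E).
Proof.
move=> [a ->] [b ->]; exists [ffun i => a i - b i].
rewrite -sumrB; apply: eq_bigr => i _; rewrite ffunE.
by rewrite mulrzBr.
Qed.

Lemma coxK_0 : coxK 0.
Proof.
exists [ffun=> 0]; rewrite big1 // => i _; by rewrite ffunE mulr0z.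
Qed.

Lemma coxKN E : coxK E -> coxK (- E).
Proof. by rewrite -sub0r; apply: coxKB; exact: coxK_0. Qed.

Lemma coxKD D E : coxK D -> coxK E -> coxK (D + E).
Proof. by move=> kD kE; rewrite -[E]opprK; apply: coxKB => //; exact: coxKN. Qed.

Lemma sheafO0 D h : sheafO D h 0.
Proof. by move=> P Ph t tP; rewrite mul0r; exact: locring0. Qed.

Lemma sheafOB D h f g : sheafO D h f -> sheafO D h g -> sheafO D h (f - g).
Proof.
move=> fD gD P Ph t tP; rewrite mulrBl.
by apply: locringB; [exact: fD | exact: gD].
Qed.

Lemma sheafOM D E h f g :
  sheafO D h f -> sheafO E h g -> sheafO (D + E) h (f * g).
Proof.
move=> fD gE P Ph t tP; rewrite coeffD opprD expfzDr ?tP.1 // invfM mulrACA.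
by apply: locringM; [exact: fD | exact: gE].
Qed.

Lemma sheafO_res D h h' f : sheafO D h f -> sheafO D (h * h') f.
Proof. by move=> fD P /specMN[Ph _]; exact: fD. Qed.

(* Outside the support the coefficient is 0, which is a section. *)
Lemma sheafSP h x : sheafS h x <->
  (forall D, D \in dom x -> coxK D) /\ (forall D, sheafO D h (coeff D x)).
Proof.
split=> [xS|[xK xO] D Dx]; last by split; [exact: xK | exact: xO].
split=> [D /xS[]//|D]; have [/xS[]//|Dx] := boolP (D \in dom x).
by rewrite coeff_outdom //; exact: sheafO0.
Qed.

Lemma sheafSB h x y : sheafS h x -> sheafS h y -> sheafS h (x - y).
Proof.
move=> /sheafSP[xK xO] /sheafSP[yK yO]; apply/sheafSP; split=> D.
- by move=> /domB; rewrite mem_cat => /orP[/xK|/yK].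
- by rewrite coeffB; exact: sheafOB.
Qed.

Lemma sheafS_gmon h c D : coxK D -> sheafO D h c -> sheafS h (gmon c D).
Proof.
move=> KD OD; apply/sheafSP; split=> E; last first.
  rewrite coeffU; case: eqP => [<-|_]; first by rewrite mulr1.
  by rewrite mulr0; exact: sheafO0.
rewrite mem_dom coeffU; case: (D =P E) => [<- //|_].
by rewrite mulr0 eqxx.
Qed.

Lemma sheafS_const h a : sheafS h (gmon a%:F 0).
Proof.
apply: sheafS_gmon; first exact: coxK_0.
by move=> P _ t _; rewrite coeff0 oppr0 expr0z divr1; exact: locring_tofrac.
Qed.

Lemma sheafS1 h : sheafS h 1.
Proof. by rewrite -gmon10 -(rmorph1 (@tofrac A)); exact: sheafS_const. Qed.

Lemma sheafS0 h : sheafS h 0.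
Proof. by rewrite -(subrr (1 : GA)); apply: sheafSB; exact: sheafS1. Qed.

Lemma sheafSD h x y : sheafS h x -> sheafS h y -> sheafS h (x + y).
Proof.
move=> xS yS; rewrite -[y]opprK; apply: sheafSB => //; rewrite -sub0r.
by apply: sheafSB => //; exact: sheafS0.
Qed.

Lemma sheafSM h x y : sheafS h x -> sheafS h y -> sheafS h (x * y).
Proof.
move=> xS yS; rewrite -[x](@freeg_sumE F Div) mulr_suml big_seq.
elim/big_rec: _ => [|D z /xS[KD OD] IH]; first exact: sheafS0.
apply: sheafSD => {z IH} //.
rewrite -[y](@freeg_sumE F Div) mulr_sumr big_seq.
elim/big_rec: _ => [|E z /yS[KE OE] IH]; first exact: sheafS0.
apply: sheafSD => {z IH} //; rewrite gmonM.
by apply: sheafS_gmon; [exact: coxKD | exact: sheafOM].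
Qed.

Lemma sheafS_res h h' x : sheafS h x -> sheafS (h * h') x.
Proof. by move=> xS D /xS[KD OD]; split=> //; exact: sheafO_res. Qed.

Lemma stalkI0 p : stalkI p 0.
Proof. by exists 1; [exact: spec1 | exact: ideal_gen0]. Qed.

Lemma stalkID p x y : stalkI p x -> stalkI p y -> stalkI p (x + y).
Proof.
move=> [h ph xI] [h' ph' yI]; exists (h * h'); first exact: specM.
apply: ideal_genD; rewrite -[X in ideal_gen _ _ X]mul1r.
- by apply: ideal_genM xI => a aS; rewrite mul1r; exact: sheafS_res.
- by apply: ideal_genM yI => a aS; rewrite mul1r mulrC; exact: sheafS_res.
Qed.

Lemma stalkIM p x y : stalkS p x -> stalkI p y -> stalkI p (x * y).
Proof.
move=> [h ph xS] [h' ph' yI]; exists (h * h'); first exact: specM.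
apply: ideal_genM yI => a aS; apply: sheafSM; first exact: sheafS_res.
by rewrite mulrC; exact: sheafS_res.
Qed.

Lemma stalkS1 p : stalkS p 1.
Proof. by exists 1; [exact: spec1 | exact: sheafS1]. Qed.

Lemma stalkS0 p : stalkS p 0.
Proof. by exists 1; [exact: spec1 | exact: sheafS0]. Qed.

Lemma stalkSB p x y : stalkS p x -> stalkS p y -> stalkS p (x - y).
Proof.
move=> [h ph xS] [h' ph' yS]; exists (h * h'); first exact: specM.
by apply: sheafSB; [|rewrite mulrC]; exact: sheafS_res.
Qed.

Lemma stalkS_N1 p : stalkS p (- 1).
Proof.
by rewrite -sub0r; apply: stalkSB; [exact: stalkS0 | exact: stalkS1].
Qed.

Lemma stalkIN p x : stalkI p x -> stalkI p (- x).
Proof. by rewrite -mulN1r; apply: stalkIM; exact: stalkS_N1. Qed.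

Lemma stalkIS p x : stalkI p x -> stalkS p x.
Proof.
move=> [h ph [n [a [g [Sa Gg ->]]]]]; exists h => //.
elim/big_rec: _ => [|i z _ IH]; first exact: sheafS0.
apply: sheafSD => {z IH} //; apply: sheafSM => //.
have [E [KE E0] ->] := Gg i; apply: sheafSB; first exact: sheafS1.
apply: sheafS_gmon; first exact: coxKN.
move=> P _ t tP; rewrite coeffN opprK.
by have [_ /(_ P t tP)[]] := cox_chi_div KE E0.
Qed.

Lemma cox_section_stalkS s p : s \in cox_section -> stalkS p (s p).
Proof.
move=> /asboolP/(_ p)[h [x [ph xS _ /(_ p ph) sx]]].
rewrite -[s p](subrK x) -[x in _ + x]opprK.
apply: stalkSB; first exact: stalkIS.
by rewrite -sub0r; apply: stalkSB; [exact: stalkS0 | exists h].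
Qed.

Lemma cox_section_subring_closed : subring_closed cox_section.
Proof.
split.
- apply/asboolP => p; exists 1, 1; split=> //; first exact: spec1.
    exact: sheafS1.
  by move=> q _; rewrite subrr; exact: stalkI0.
- move=> s s' /asboolP sP /asboolP s'P; apply/asboolP => p.
  have [h [x [ph xS _ sx]]] := sP p; have [h' [x' [ph' xS' _ sx']]] := s'P p.
  exists (h * h'), (x - x'); split=> //; first exact: specM.
    by apply: sheafSB; [|rewrite mulrC]; exact: sheafS_res.
  move=> q /specMN[qh qh']; rewrite [X in stalkI q X](_ : _ = (s q - x) + - (s' q - x')).
    by apply: stalkID; [exact: sx | apply: stalkIN; exact: sx'].
  rewrite -[(s - s') q]/(s q - s' q) !opprB addrACA [RHS]addrACA.
  by rewrite [- x - _]addrC.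
- move=> s s' sP s'P; apply/asboolP => p.
  have [h [x [ph xS _ sx]]] := (asboolP _ sP) p.
  have [h' [x' [ph' xS' _ sx']]] := (asboolP _ s'P) p.
  exists (h * h'), (x * x'); split=> //; first exact: specM.
    by apply: sheafSM; [|rewrite mulrC]; exact: sheafS_res.
  move=> q /specMN[qh qh'].
  rewrite [X in stalkI q X](_ : _ = s q * (s' q - x') + x' * (s q - x)).
    apply: stalkID; apply: stalkIM; [exact: cox_section_stalkS|exact: sx'| |exact: sx].
    by exists h'.
  by rewrite !mulrBr [x' * s q]mulrC [x' * x]mulrC addrA subrK.
Qed.
HB.instance Definition _ :=
  GRing.isSubringClosed.Build (spec -> GA) cox_section cox_section_subring_closed.

Record coxSection := CoxSection {
  section_germs :> spec -> GA;
  _ : cox_section section_germs }.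
HB.instance Definition _ := [isSub for section_germs].
HB.instance Definition _ := [Choice of coxSection by <:].
HB.instance Definition _ := [SubChoice_isSubComNzRing of coxSection by <:].

(* Two families of representatives define the same section of S / I when they *)
(* differ by an element of [cox_null].                                        *)
Definition cox_null : {pred coxSection} :=
  fun s => `[< forall p, stalkI p (s p) >].
Lemma chi_neq0 E : coxK0 E -> cox_chi K E != 0.
Proof. by move=> [KE E0]; have [] := cox_chi_div KE E0. Qed.

(* The ideal generated by the 1 - chi(E) is proper: it is killed by the       *)
(* F-linear form f X^D |-> f chi(D) for D in K0, and f X^D |-> 0 otherwise.   *)
Lemma ideal_chi_proper (S : GA -> Prop) : ~ ideal_gen S chi_rel 1.
Proof.
move=> [n [a [g [_ Gg E1]]]].
pose l (D : Div) : F^o := if `[< coxK0 D >] then cox_chi K D else 0.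
have lB : {morph @fglift F _ Div l : x y / x - y}.
  by move=> x y; exact: (@lift_is_additive F Div F^o l x y).
have l0 : fglift l 0 = 0 by rewrite -[X in fglift _ X](subrr 0) lB subrr.
have lN : {morph @fglift F _ Div l : x / - x}.
  by move=> x; rewrite -[- x]sub0r lB l0 sub0r.
have lD : {morph @fglift F _ Div l : x y / x + y}.
  by move=> x y; rewrite -{1}[y]opprK lB lN opprK.
have lU c D : fglift l (gmon c D) = c * l D by exact: liftU.
have K0_0 : coxK0 0 by split; [exact: coxK_0 | exact: rpred0].
have chi0 : cox_chi K 0 = 1.
  have [k0 p0] := K0_0; apply: (mulfI (chi_neq0 K0_0)).
  by rewrite mulr1 -(cox_chiM k0 p0 k0 p0) addr0.
have lrel x E : coxK0 E -> fglift l (x * (1 - gmon (cox_chi K E) (- E))) = 0.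
  move=> KE; elim/gmon_ind: x => [|x y IH IH'|c D].
  - by rewrite mul0r l0.
  - by rewrite mulrDl lD IH IH' addr0.
  rewrite mulrBr mulr1 gmonM lB !lU /l; case: asboolP => KD.
    have [[KD1 KD2] [KE1 KE2]] := (KD, KE).
    have KDE : coxK0 (D - E) by split; [exact: coxKB | exact: rpredB].
    have [KF1 KF2] := KDE; rewrite (asboolT KDE) -mulrA.
    by rewrite [cox_chi K E * _]mulrC -cox_chiM // subrK subrr.
  case: asboolP => [[KD1 KD2]|_]; last by rewrite !mulr0 subrr.
  have [KE1 KE2] := KE; case: KD; rewrite -(subrK E D).
  by split; [exact: coxKD | exact: rpredD].
have : fglift l (1 : GA) = 1 :> F.
  by rewrite -gmon10 lU /l (asboolT K0_0) chi0 mulr1.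
rewrite E1 => /eqP; rewrite (_ : fglift l _ = 0) 1?eq_sym ?oner_eq0 //.
elim/big_rec: _ => [|i x _ IH]; first exact: l0.
by rewrite lD IH addr0; have [E KE ->] := Gg i; exact: lrel.
Qed.

Lemma cox_null_idealr_closed : idealr_closed cox_null.
Proof.
split.
- by apply/asboolP => p; exact: stalkI0.
- apply/asboolP => /(_ (generic_point A))[h _]; apply: ideal_chi_proper.
- move=> a u v /asboolP uI /asboolP vI; apply/asboolP => p.
  have -> : section_germs (a * u + v) p = a p * u p + v p.
    by rewrite -[section_germs _]/(val _) rmorphD rmorphM.
  apply: stalkID (vI p); apply: stalkIM (uI p).
  by apply: cox_section_stalkS; case: a.
Qed.
HB.instance Definition _ := isIdealr.Build coxSection cox_null cox_null_idealr_closed.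

Definition coxRing : comNzRingType := {ideal_quot cox_null}.

Lemma const_section_subproof (a : A) : cox_section (fun=> gmon a%:F 0).
Proof.
apply/asboolP => p; exists 1, (gmon a%:F 0); split=> //; first exact: spec1.
  exact: sheafS_const.
by move=> q _; rewrite subrr; exact: stalkI0.
Qed.

(* The structure map from the coordinate ring to the Cox ring. *)
Definition cox_const (a : A) : coxRing :=
  (\pi_({ideal_quot cox_null}) (CoxSection (const_section_subproof a)))%qT.

(* The homogeneous component of degree c in Cl(X).                            *)
Definition cox_comp (c : classGroup A) (y : coxRing) : Prop :=
  exists2 s : coxSection, is_quot_section (fun D => divClass D = c) s &
    y = (\pi_({ideal_quot cox_null}) s)%qT.
End CoxRing.

(* Homogeneous polynomials of weight w when the j-th variable has weight Q j. *)
Definition whomog (C : fieldType) (W : zmodType) r (Q : 'I_r -> W) (w : W)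
    (p : {mpoly C[r]}) : Prop :=
  forall m, m \in msupp p -> \sum_(j < r) Q j *+ m j = w.

(* [iota] is the structure map C -> A of the coordinate ring A of X.  The     *)
(* class group of X is identified with W, and for all choices in its          *)
(* construction the Cox ring of X is C[T_1, ..., T_r] / I as a graded         *)
(* C-algebra, for deg T_j = Q j and the ideal I generated by [rels].          *)
Definition cox_presentation (C : fieldType) (A : idomainType) (iota : C -> A)
    (W : zmodType) (r : nat) (Q : 'I_r -> W) (rels : seq {mpoly C[r]}) : Prop :=
  exists phi : {additive classGroup A -> W}, [/\ bijective phi,
    inhabited (coxData A) &
    forall K : coxData A, exists psi : {rmorphism {mpoly C[r]} -> coxRing K},
      [/\ forall c, psi c%:MP = cox_const K (iota c),
          forall y, exists p, psi p = y,
          forall p, psi p = 0 <-> ideal_gen (fun=> True) (fun g => g \in rels) p &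
          forall c y, cox_comp c y <-> exists2 p, whomog Q (phi c) p & psi p = y]].

Section MatrixGroups.
Variables (C : fieldType) (n : nat).

(* The subgroup of GL(n, C) generated by invertible matrices. *)
Inductive gengroup (gens : seq 'M[C]_n) : 'M[C]_n -> Prop :=
| gengroup_gen g of g \in gens : gengroup gens g
| gengroup1 : gengroup gens 1%:M
| gengroupM g h of gengroup gens g & gengroup gens h : gengroup gens (g *m h)
| gengroupV g of gengroup gens g : gengroup gens (invmx g).

Definition mx_group_iso (gT : finGroupType) (G : 'M[C]_n -> Prop) : Prop :=
  exists rho : gT -> 'M[C]_n,
    [/\ injective rho, forall x y, rho (x * y)%g = rho x *m rho y &
        forall g, G g <-> exists x, rho x = g].

(* The fixed space of g on column vectors is the eigenspace of g^T.           *)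
Definition pseudo_reflection (g : 'M[C]_n) : Prop :=
  (exists2 m : nat, (0 < m)%N & iter m (mulmx g) 1%:M = 1%:M) /\
  (\rank (eigenspace g^T 1)).+1 = n.

Definition small_group (G : 'M[C]_n -> Prop) : Prop :=
  forall g, G g -> ~ pseudo_reflection g.

(* f |-> f o g on polynomial functions on C^n. *)
Definition mxact (g : 'M[C]_n) (f : {mpoly C[n]}) : {mpoly C[n]} :=
  f \mPo [tuple \sum_(j < n) g i j *: 'X_j | i < n].

Variable G : 'M[C]_n -> Prop.

Definition invariant : {pred {mpoly C[n]}} :=
  fun f => `[< forall g, G g -> mxact g f = f >].

Lemma invariant_divring_closed : divring_closed invariant.
Proof.
split.
- by apply/asboolP => g _; rewrite /mxact rmorph1.
- move=> f h /asboolP fG /asboolP hG; apply/asboolP => g Gg.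
  by rewrite /mxact rmorphB /= -!/(mxact _ _) fG ?hG.
- move=> f h /asboolP fG /asboolP hG; apply/asboolP => g Gg.
  rewrite /mxact rmorphM /= -!/(mxact _ _) fG //; congr (_ * _).
  have [hU|hU] := boolP (h \is a GRing.unit).
    by rewrite /mxact rmorphV //= -/(mxact _ _) hG.
  by rewrite invr_out // hG.
Qed.
HB.instance Definition _ :=
  GRing.isDivringClosed.Build {mpoly C[n]} invariant invariant_divring_closed.

(* The coordinate ring of C^n / G. *)
Record invRing := InvRing { inv_poly :> {mpoly C[n]}; _ : invariant inv_poly }.
HB.instance Definition _ := [isSub for inv_poly].
HB.instance Definition _ := [Choice of invRing by <:].
HB.instance Definition _ := [SubChoice_isSubIntegralDomain of invRing by <:].

Lemma inv_const_subproof (c : C) : invariant c%:MP.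
Proof. by apply/asboolP => g _; rewrite /mxact comp_mpolyC. Qed.

Definition inv_const (c : C) : invRing := InvRing (inv_const_subproof c).
End MatrixGroups.

Section Data.
Variable C : fieldType.

Definition mx_of (R : pzRingType) m n (rows : seq (seq int)) : 'M[R]_(m, n) :=
  \matrix_(i, j) (nth 0 (nth [::] rows i) j)%:~R.

(* T_1, ..., T_r in the numbering from 1. *)
Definition Tvar r (j : nat) : {mpoly C[r.+1]} := 'X_(inord j.-1).

Definition S3_gens : seq 'M[C]_4 := [::
  mx_of C 4 4 [:: [:: 0; -1; 0;  0];
                  [:: 1; -1; 0;  0];
                  [:: 0;  0; 0; -1];
                  [:: 0;  0; 1; -1]];
  mx_of C 4 4 [:: [:: -1; 1;  0; 0];
                  [::  0; 1;  0; 0];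
                  [::  0; 0; -1; 1];
                  [::  0; 0;  0; 1]]].

Definition S3_degrees : 'M['Z_2]_(1, 12) := mx_of _ 1 12
  [:: [:: 1; 1; 1; 1; 1; 0; 0; 0; 0; 0; 0; 0]].

Definition S3_relations : seq {mpoly C[12]} :=
  let T := @Tvar 11 in [::
      3 * T 9 * T 10 - T 7 * T 11 + T 6 * T 12;
      3 * T 5 * T 10 - 2 * T 4 * T 11 + T 3 * T 12;
      3 * T 6 * T 8 + T 9 * T 11 - T 7 * T 12;
      3 * T 4 * T 8 - T 2 * T 11 - 2 * T 5 * T 12;
      3 * T 3 * T 8 - 3 * T 2 * T 10 - T 5 * T 11 - T 4 * T 12;
      T 5 * T 7 - 2 * T 4 * T 9 + T 1 * T 12;
      T 4 * T 7 - 2 * T 3 * T 9 + T 1 * T 11;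
      T 2 * T 7 - 3 * T 1 * T 8 + 2 * T 5 * T 9;
      T 5 * T 6 - T 3 * T 9 + T 1 * T 11;
      2 * T 4 * T 6 - T 3 * T 7 + 3 * T 1 * T 10;
      T 2 * T 6 + T 4 * T 9 - T 1 * T 12;
      T 1 * T 5 + 6 * T 9 * T 11 - 3 * T 7 * T 12;
      T 4 ^+ 2 - T 3 * T 5 - 3 * T 11 ^+ 2 + 9 * T 10 * T 12;
      T 2 * T 4 + T 5 ^+ 2 + 9 * T 8 * T 11 - 3 * T 12 ^+ 2;
      T 1 * T 4 + 3 * T 7 * T 11 - 6 * T 6 * T 12;
      T 2 * T 3 + T 4 * T 5 + 27 * T 8 * T 10 - 3 * T 11 * T 12;
      T 1 * T 3 + 9 * T 7 * T 10 - 6 * T 6 * T 11;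
      T 1 * T 2 + 9 * T 7 * T 8 - 6 * T 9 * T 12;
      T 1 ^+ 2 + 3 * T 7 ^+ 2 - 12 * T 6 * T 9;
      4 * T 9 ^+ 3 - T 2 ^+ 2 - 27 * T 8 ^+ 2;
      2 * T 7 * T 9 ^+ 2 + T 2 * T 5 - 9 * T 8 * T 12;
      4 * T 6 * T 9 ^+ 2 - T 5 ^+ 2 - 3 * T 12 ^+ 2;
      2 * T 1 * T 9 ^+ 2 - 9 * T 5 * T 8 - 3 * T 2 * T 12;
      T 7 ^+ 2 * T 9 - 4 * T 6 * T 9 ^+ 2 - 9 * T 8 * T 11 + 3 * T 12 ^+ 2;
      2 * T 6 * T 7 * T 9 - T 4 * T 5 - 3 * T 11 * T 12;
      T 1 * T 7 * T 9 - 3 * T 2 * T 11 - 3 * T 5 * T 12;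
      4 * T 6 ^+ 2 * T 9 - T 3 * T 5 - 6 * T 11 ^+ 2 + 9 * T 10 * T 12;
      2 * T 1 * T 6 * T 9 + 3 * T 5 * T 11 - 3 * T 4 * T 12;
      T 7 ^+ 3 - 4 * T 6 * T 7 * T 9 - 27 * T 8 * T 10 + 3 * T 11 * T 12;
      T 6 * T 7 ^+ 2 - 4 * T 6 ^+ 2 * T 9 + 3 * T 11 ^+ 2 - 9 * T 10 * T 12;
      T 1 * T 7 ^+ 2 - 4 * T 1 * T 6 * T 9 - 9 * T 3 * T 8 - 3 * T 5 * T 11 + 6 * T 4 * T 12;
      2 * T 6 ^+ 2 * T 7 - T 3 * T 4 - 9 * T 10 * T 11;
      T 1 * T 6 * T 7 + 3 * T 4 * T 11 - 3 * T 3 * T 12;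
      4 * T 6 ^+ 3 - T 3 ^+ 2 - 27 * T 10 ^+ 2;
      2 * T 1 * T 6 ^+ 2 + 9 * T 4 * T 10 - 3 * T 3 * T 11].

Definition D8_gens : seq 'M[C]_4 := [::
  mx_of C 4 4 [:: [:: 0; -1; 0;  0];
                  [:: 1;  0; 0;  0];
                  [:: 0;  0; 0; -1];
                  [:: 0;  0; 1;  0]];
  mx_of C 4 4 [:: [:: 1;  0; 0;  0];
                  [:: 0; -1; 0;  0];
                  [:: 0;  0; 1;  0];
                  [:: 0;  0; 0; -1]]].

Definition D8_degrees : 'M['Z_2]_(2, 10) := mx_of _ 2 10
  [:: [:: 1; 1; 1; 1; 1; 1; 0; 0; 0; 0];
      [:: 1; 1; 1; 0; 0; 0; 1; 0; 0; 0]].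

Definition D8_relations : seq {mpoly C[10]} :=
  let T := @Tvar 9 in [::
      T 5 * T 8 + T 4 * T 9 - 2 * T 6 * T 10;
      T 3 * T 8 + T 1 * T 9 - T 2 * T 10;
      T 7 ^+ 2 - T 8 * T 9 + T 10 ^+ 2;
      T 6 * T 7 + 2 * T 1 * T 9 - T 2 * T 10;
      T 5 * T 7 + T 2 * T 9 - 2 * T 3 * T 10;
      T 4 * T 7 - T 2 * T 8 + 2 * T 1 * T 10;
      2 * T 3 * T 7 - T 6 * T 9 + T 5 * T 10;
      T 2 * T 7 - T 4 * T 9 + T 6 * T 10;
      2 * T 1 * T 7 + T 6 * T 8 - T 4 * T 10;
      T 4 * T 5 - T 6 ^+ 2 + T 8 * T 9 - T 10 ^+ 2;
      T 2 * T 5 - 2 * T 3 * T 6 + T 7 * T 9;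
      2 * T 1 * T 5 - T 2 * T 6 + T 7 * T 10;
      T 3 * T 4 - T 1 * T 5 - T 7 * T 10;
      T 2 * T 4 - 2 * T 1 * T 6 - T 7 * T 8;
      4 * T 3 ^+ 2 + T 5 ^+ 2 - T 9 ^+ 2;
      2 * T 2 * T 3 + T 5 * T 6 - T 9 * T 10;
      4 * T 1 * T 3 + T 6 ^+ 2 - T 10 ^+ 2;
      T 2 ^+ 2 + T 6 ^+ 2 - T 8 * T 9;
      2 * T 1 * T 2 + T 4 * T 6 - T 8 * T 10;
      4 * T 1 ^+ 2 + T 4 ^+ 2 - T 8 ^+ 2].
End Data.

(* Main.v *)
(* Let S = C[x_1, ..., x_4] and let r and s generate the dihedral group G,     *)
(* where s and r s are involutions. A homogeneous fraction of semi-invariants *)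
(* of G has a divisor on X_0, and since S is factorial and each character has *)
(* two coprime semi-invariants, the height one primes of the invariant ring   *)
(* correspond to the primes among the homogeneous elements of the grading of  *)
(* S^[G,G] by characters. Hence Cl(X_0) is the character group, and sending   *)
(* f X^D to f times the fraction with divisor D, normalised to turn chi into  *)
(* the identity on K^0, identifies the Cox ring with S^[G,G]. The commutator  *)
(* subgroup is cyclic and acts diagonally in suitable coordinates, so S^[G,G] *)
(* is spanned by the monomials of weight zero; the generators are linear      *)
(* combinations of such monomials of degree two and three. Modulo the listed  *)
(* relations a product of these monomials depends only on the resulting       *)
(* monomial, which yields a linear left inverse to the parametrisation of     *)
(* S^[G,G] by C[T_1, ..., T_r] / I.                                           *)
From HB Require Import structures.
Require Import Defs.
From mathcomp Require Import all_boot all_order all_algebra.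
From mathcomp Require Import all_fingroup all_solvable.
From mathcomp Require Import boolp classical_sets ring zify.
From mathcomp Require Import reals complex ssrcomplements freeg mpoly.
Set Implicit Arguments.
Unset Strict Implicit.
Unset Printing Implicit Defensive.
Import Order.TTheory GRing.Theory Num.Theory.
Local Open Scope ring_scope.


(** * Factorial domains *)

(** Both groups are dihedral, generated by a rotation r and a reflection s, so all characters have
    values 1 and -1 and the character group W is killed by 2. Let S be the polynomial ring and A the
    ring of invariants. The spaces of semi-invariants are the components of a W-graded subring of S,
    the invariants of the commutator subgroup, with A in degree 0. The record [grading] isolates
    what is used of this: units of S have degree 0 and square roots, homogeneous elements have
    homogeneous gcds (S is factorial by [factorial_mpoly]; see [semi_inv_cofactors]), and each
    degree contains two coprime elements.

    Class group: homogeneous elements factor into homogeneous primes, and these cut out exactly the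
    height one primes of A ([hprime_height1], [primeDiv_hprime]). Each degree has an element not
    divisible by a given homogeneous prime, so the localisation there has units of every degree, and
    orders can be measured by that prime instead of a uniformizer ([ord_geP], [ord_eqP]). Thus a
    Weil divisor D belongs to a homogeneous fraction [divfun D] of degree [divdeg D], is principal
    exactly when this degree is 0 ([principal_divdeg]), and every degree occurs; so the class group
    is W ([class_deg_bij]).

    Cox ring: for any choice of K and chi, the quotient of chi(E) by [divfun E] is a unit depending
    multiplicatively on E in K0. It extends to K, because 2K lies in K0 and units have square roots
    ([hom_extension]). This gives X^D a value in the fraction field of S; evaluation kills exactly
    the ideal of the relations ([cox_eval_ker]), and homogeneous fractions regular at all height one
    primes lie in S ([locL_regular]). Hence the Cox ring is the graded subring, and
    [cox_presentation_of_grading] reduces the claim to generators and relations of that subring.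

    Relations: in coordinates that diagonalise the commutator subgroup, the subring is spanned by
    monomials of weight zero. Such a monomial is sent to a product of generators modulo the
    relations; these make the result independent of how the letters are grouped ([pairword_perm],
    [balword_perm]), hence multiplicative, and linear extension gives a left inverse of the
    parametrisation ([ker_of_monomial_section]). For D_8 the letters are grouped in pairs, for S_3
    in pairs u v and triples u u u, v v v.

    The isomorphism types follow from normal forms of words in r and s ([dihedral_mx_group_iso]);
    the groups are small because they act by two copies of a plane representation, so that all fixed
    spaces have even dimension. *)

Section Divides.
Variable R : idomainType.
Implicit Types a b c p q u : R.

Definition divides a b := exists c, b = a * c.

Definition prime_elt p :=
  [/\ p != 0, p \isn't a GRing.unit &
      forall a b, divides p (a * b) -> divides p a \/ divides p b].

Inductive prime_product : R -> Prop :=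
| prime_product_unit u of u \is a GRing.unit : prime_product u
| prime_product_cons p a of prime_elt p & prime_product a :
    prime_product (p * a).

Lemma divides_refl a : divides a a.
Proof. by exists 1; rewrite mulr1. Qed.

Lemma divides0 a : divides a 0.
Proof. by exists 0; rewrite mulr0. Qed.

Lemma divides_mulr a b c : divides a b -> divides a (b * c).
Proof. by move=> [d ->]; exists (d * c); rewrite mulrA. Qed.

Lemma divides_mull a b c : divides a b -> divides a (c * b).
Proof. by rewrite mulrC; exact: divides_mulr. Qed.

Lemma dividesD a b c : divides a b -> divides a c -> divides a (b + c).
Proof. by move=> [d ->] [e ->]; exists (d + e); rewrite mulrDr. Qed.

Lemma dividesB a b c : divides a b -> divides a c -> divides a (b - c).
Proof. by move=> [d ->] [e ->]; exists (d - e); rewrite mulrBr. Qed.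

Lemma divides_trans a b c : divides a b -> divides b c -> divides a c.
Proof. by move=> ab [d ->]; exact: divides_mulr. Qed.

Lemma divides_unit a u : divides a u -> u \is a GRing.unit -> a \is a GRing.unit.
Proof. by move=> [c ->]; rewrite unitrM => /andP[]. Qed.

Lemma unit_neq0 a : a \is a GRing.unit -> a != 0.
Proof. by apply: contraTneq => ->; rewrite unitr0. Qed.

Lemma prime_product_mul a b :
  prime_product a -> prime_product b -> prime_product (a * b).
Proof.
move=> aP bP; elim: aP => [u uU|p c pP _ IH]; last first.
  by rewrite -mulrA; exact: prime_product_cons.
elim: bP => [v vU|p c pP _ IH]; first by left; rewrite unitrM uU.
by rewrite mulrCA; exact: prime_product_cons.
Qed.

Lemma prime_divides_prime p q :
  prime_elt p -> prime_elt q -> divides q p -> divides p q.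
Proof.
move=> [p0 _ pP] [_ qU _] [e pE].
have [|//|[f eE]] := pP q e; first by rewrite -pE; exact: divides_refl.
case/negP: qU; apply/unitrPr; exists f; apply: (mulfI p0).
by rewrite mulr1 [p * (q * f)]mulrCA -eE -pE.
Qed.
End Divides.

Definition factorial_domain (R : idomainType) :=
  forall a : R, a != 0 -> prime_product a.

(* In a factorial domain this splits off the greatest common divisor; the     *)
(* condition on the cofactors says that they are coprime.                     *)
Lemma coprime_cofactors (R : idomainType) (a b : R) :
  prime_product a -> exists d a' b', [/\ a = d * a', b = d * b' &
    forall c, divides a' (b' * c) -> divides a' c].
Proof.
move=> aP; elim: aP b => {a} [u uU|p a pP _ IH] b.
  exists 1, u, b; rewrite !mul1r; split=> // c _.
  by exists (u^-1 * c); rewrite mulrA divrr // mul1r.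
have [[b1 ->]|pb] := pselect (divides p b).
  have [d [a' [b' [-> -> H]]]] := IH b1.
  by exists (p * d), a', b'; split=> //; rewrite mulrA.
have [d [a' [b' [aE bE H]]]] := IH b.
exists d, (p * a'), b'; split=> //; first by rewrite aE mulrCA.
move=> c [e cE]; have /H[c' c'E] : divides a' (b' * c).
  by exists (p * e); rewrite cE mulrA [a' * p]mulrC.
have [p0 _ pPr] := pP; case: (eqVneq a' 0) => [a'0|a'0].
  by rewrite c'E a'0 mul0r; exact: divides0.
have [|[f bf]|[f cf]] := pPr b' c'.
- by exists e; apply: (mulfI a'0); rewrite mulrCA -c'E cE mulrCA mulrA.
- by case: pb; exists (f * d); rewrite bE bf mulrC mulrA.
- by exists f; rewrite c'E cf mulrCA mulrA.
Qed.

(** * Gauss's lemma: factoriality of polynomials in one variable *)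

Section FactorialPoly.
Variable R : idomainType.
Implicit Types (f g h q : {poly R}) (p c : R).

(** Look at constant terms: p divides their product, hence one of them. Subtracting that term and
    dividing by ['X] leaves a shorter product still divisible by p, whence an induction on the total
    size. *)
Lemma prime_elt_polyC p : prime_elt p -> prime_elt p%:P.
Proof.
move=> [p0 pU pP]; split; first by rewrite polyC_eq0.
- by rewrite poly_unitE size_polyC coefC /= (negPf pU) andbF.
have key n : forall f g, (size f + size g <= n)%N -> divides p%:P (f * g) ->
    divides p%:P f \/ divides p%:P g.
  elim: n => [|n IH] f g.
    rewrite leqn0 addn_eq0 size_poly_eq0 => /andP[/eqP-> _] _.
    by left; exact: divides0.
  have [->|f0] := eqVneq f 0; first by left; exact: divides0.
  have [->|g0] := eqVneq g 0; first by right; exact: divides0.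
  have fE : f = drop_poly 1 f * 'X + (f`_0)%:P.
    by rewrite -{1}(poly_take_drop 1 f) addrC expr1 /take_poly poly_def
               big_ord1 expr0 alg_polyC.
  have gE : g = drop_poly 1 g * 'X + (g`_0)%:P.
    by rewrite -{1}(poly_take_drop 1 g) addrC expr1 /take_poly poly_def
               big_ord1 expr0 alg_polyC.
  move=> sn [q qE].
  have cancelX h : divides p%:P (h * 'X) -> divides p%:P h.
    move=> [e eE]; exists (drop_poly 1 e); apply/polyP=> i.
    rewrite coefCM coef_drop_poly addn1.
    by have /polyP/(_ i.+1) := eE; rewrite coefMX coefCM.
  have : divides p (f`_0 * g`_0) by rewrite -coef0M qE coefCM; exists q`_0.
  move=> /pP[] [c cE].
  - have f0p : divides p%:P (f`_0)%:P by exists c%:P; rewrite cE polyCM.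
    have : divides p%:P (drop_poly 1 f * g * 'X).
      have -> : drop_poly 1 f * g * 'X = f * g - (f`_0)%:P * g.
        by rewrite {2}fE mulrDl addrK mulrAC.
      by apply: dividesB; [exists q | exact: divides_mulr].
    move=> /cancelX/IH[|f1p|]; [|left|by right].
      move: sn; rewrite size_drop_poly; move: f0; rewrite -size_poly_gt0.
      by case: (size f) => // k _; rewrite subn1 /= addSn ltnS.
    by rewrite fE; apply: dividesD => //; exact: divides_mulr.
  - have g0p : divides p%:P (g`_0)%:P by exists c%:P; rewrite cE polyCM.
    have : divides p%:P (f * drop_poly 1 g * 'X).
      have -> : f * drop_poly 1 g * 'X = f * g - f * (g`_0)%:P.
        by rewrite {2}gE mulrDr addrK mulrA.
      by apply: dividesB; [exists q | exact: divides_mull].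
    move=> /cancelX/IH[||g1p]; [|by left|right].
      move: sn; rewrite size_drop_poly; move: g0; rewrite -size_poly_gt0.
      by case: (size g) => // k _; rewrite subn1 /= addnS ltnS.
    by rewrite gE; apply: dividesD => //; exact: divides_mulr.
by move=> f g; exact: key.
Qed.

Lemma prime_product_polyC c : prime_product c -> prime_product c%:P.
Proof.
elim=> [u uU|p a pP _ IH].
  by left; rewrite poly_unitE size_polyC coefC /= uU unit_neq0.
by rewrite polyCM; right=> //; exact: prime_elt_polyC.
Qed.

Definition primitive f := forall p, prime_elt p -> ~ divides p%:P f.

(** The primes of c are cancelled one at a time: each divides [f * q] but not the primitive f, hence
    q. This brings divisibility over the fraction field back to R. *)
Lemma primitive_divides c f g q :
  prime_product c -> primitive f -> c%:P * g = f * q -> divides f g.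
Proof.
move=> cP fP; elim: cP q => {c} [u uU|p c pP _ IH] q E.
  exists (u^-1%:P * q); rewrite mulrCA -E mulrA -polyCM mulVr //.
  by rewrite mul1r.
have [p0 _ pPr] := prime_elt_polyC pP.
have [||[q' qE]] := pPr f q; first by exists (c%:P * g); rewrite -E polyCM mulrA.
- by move=> /fP; case.
- apply: (IH q'); apply: (mulfI p0).
  by rewrite mulrA -polyCM E qE mulrCA.
Qed.

(** Each prime of c divides g or h and is cancelled there; so a factorisation over the fraction
    field descends to R with the same degrees. *)
Lemma clear_constant c f g h : prime_product c -> c%:P * f = g * h ->
  exists g' h', [/\ f = g' * h', size g' = size g & size h' = size h].
Proof.
move=> cP; elim: cP g h => {c} [u uU|p c pP _ IH] g h E.
  exists (u^-1%:P * g), h; split=> //.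
    by rewrite -mulrA -E mulrA -polyCM mulVr // mul1r.
  by rewrite mul_polyC size_scale // invr_eq0 unit_neq0.
have [p0 _ pPr] := prime_elt_polyC pP.
have sz k : size (p%:P * k) = size k.
  by rewrite mul_polyC size_scale //; case: pP.
have [|[k kE]|[k kE]] := pPr g h.
- by exists (c%:P * f); rewrite -E polyCM mulrA.
- have [|g' [h' [-> sg sh]]] := IH k h; last by exists g', h'; rewrite kE sz.
  by apply: (mulfI p0); rewrite mulrA -polyCM E kE mulrA.
- have [|g' [h' [-> sg sh]]] := IH g k; last by exists g', h'; rewrite kE sz.
  by apply: (mulfI p0); rewrite mulrA -polyCM E kE mulrCA.
Qed.

Hypothesis R_factorial : factorial_domain R.

Lemma primitive_part f : f != 0 ->
  exists c g, [/\ f = c%:P * g, prime_product c & primitive g].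
Proof.
(* Every prime divisor of f divides its leading coefficient b * a; the primes *)
(* of the part b already examined do not divide f.                            *)
have key a : prime_product a -> forall f b, f != 0 ->
    divides (lead_coef f) (b * a) ->
    (forall p, prime_elt p -> divides p b -> ~ divides p%:P f) ->
    exists c g, [/\ f = c%:P * g, prime_product c & primitive g].
  elim=> {a} [u uU|p a pP _ IH] h b h0 ha hb.
    exists 1, h; rewrite mul1r; split=> //; first by left; rewrite unitr1.
    move=> p pP ph; apply: (hb p pP) => //.
    have : divides p (b * u).
      apply: divides_trans ha; have [k kE] := ph; exists (lead_coef k).
      by rewrite kE lead_coefM lead_coefC.
    case: pP => p0 pU pPr /pPr[//|pu].
    by rewrite (divides_unit pu uU) in pU.
  have [p0 pU pPr] := pP; have [[k kE]|ph] := pselect (divides p%:P h).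
    have k0 : k != 0 by apply: contraNneq h0 => k0; rewrite kE k0 mulr0.
    have [|q qP /(hb q qP) qh qk|c [g [gE cP gP]]] := IH k b k0.
    - have [e eE] := ha; exists e; apply: (mulfI p0).
      by rewrite mulrCA eE kE lead_coefM lead_coefC mulrA.
    - by apply: qh; rewrite kE; exact: divides_mull.
    - exists (p * c), g; split=> //; first by rewrite kE gE polyCM mulrA.
      by right.
  apply: (IH h (b * p)) => // [|q qP]; first by rewrite -mulrA.
  have [q0 qU qPr] := qP; case/qPr => [/(hb q qP)//|qp [k kE]].
  apply: ph; rewrite kE; apply: divides_mulr.
  by have [e ->] := prime_divides_prime pP qP qp; exists e%:P; rewrite polyCM.
move=> f0; apply: (key (lead_coef f) _ f 1) => // [||p [_ pU _] p1].
- by apply: R_factorial; rewrite lead_coef_eq0.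
- by rewrite mul1r; exact: divides_refl.
- by case/negP: pU; exact: divides_unit p1 (unitr1 _).
Qed.

(** Induction on the size, after splitting off the content. A nonconstant primitive polynomial that
    is not a product of two smaller ones is irreducible for the pseudo-divisibility [%|], which is
    divisibility over the fraction field. There Euclid's lemma holds, and primitivity brings its
    conclusion back to R. *)
Lemma factorial_poly : factorial_domain {poly R}.
Proof.
have key n : forall f, (size f <= n)%N -> f != 0 -> prime_product f.
  elim: n => [|n IH] f; first by rewrite leqn0 size_poly_eq0 => ->.
  move=> sf f0; have [c [g [fE cP gP]]] := primitive_part f0.
  have c0 : c != 0 by apply: contraNneq f0 => c0; rewrite fE c0 mul0r.
  have g0 : g != 0 by apply: contraNneq f0 => g0; rewrite fE g0 mulr0.
  rewrite fE; apply: prime_product_mul; first exact: prime_product_polyC.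
  have {}sf : (size g <= n.+1)%N by rewrite fE mul_polyC size_scale in sf.
  have [|sg] := leqP (size g) 1.
    move=> /size1_polyC gc; rewrite gc; apply/prime_product_polyC/R_factorial.
    by rewrite -polyC_eq0 -gc.
  have [[g1 [g2 [gE s1 s2]]]|irr] := pselect (exists g1 g2,
      [/\ g = g1 * g2, (size g1 < size g)%N & (size g2 < size g)%N]).
    have [g10 g20] : g1 != 0 /\ g2 != 0.
      by apply/andP; rewrite -negb_or -mulf_eq0 -gE.
    rewrite gE; apply: prime_product_mul; apply: IH => //.
      by rewrite -ltnS; exact: leq_trans s1 sf.
    by rewrite -ltnS; exact: leq_trans s2 sf.
  (* From b g = q d, [clear_constant] makes a factorisation of g itself with factors of the sizes of
     q and d; as d is not constant and g has no smaller factors, d has the size of g. *)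
  have g_irr : irreducible_poly g.
    split=> // d d1 /Pdiv.Idomain.dvdpP[[b q] /= b0 E].
    have [g' [d' [gE' sg' sd']]] : exists g' h',
        [/\ g = g' * h', size g' = size q & size h' = size d].
      by apply: (@clear_constant b); [exact: R_factorial | rewrite mul_polyC].
    have [g'0 d'0] : g' != 0 /\ d' != 0.
      by apply/andP; rewrite -negb_or -mulf_eq0 -gE'.
    have dg : d %| g by apply/Pdiv.Idomain.dvdpP; exists (b, q).
    rewrite -Pdiv.Idomain.dvdp_size_eqp //; apply/eqP/esym.
    apply/eqP; rewrite eqn_leq -sd'; apply/andP; split; last first.
      rewrite gE' size_mul //; move: g'0; rewrite -size_poly_gt0.
      by case: (size g') => // k _; rewrite addSn leq_addl.
    rewrite leqNgt; apply/negP => sd; case: irr; exists g', d'; split=> //.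
    have sd1 : (1 < size d')%N by rewrite ltn_neqAle eq_sym sd' d1 -sd' size_poly_gt0.
    rewrite gE' size_mul //; move: sd1; case: (size d') => [|[|k]] // _.
    by rewrite !addnS ltnS leq_addr.
  have gprime : prime_elt g.
    split=> // [|a b [q qE]].
      by rewrite poly_unitE; apply/negP => /andP[/eqP s1]; rewrite s1 in sg.
    have divg h : g %| h -> divides g h.
      move=> /Pdiv.Idomain.dvdpP[[e k] /= e0 E].
      apply: (@primitive_divides e g h k) => //; first exact: R_factorial.
      by rewrite mul_polyC E mulrC.
    have gab : g %| a * b by rewrite qE; apply: Pdiv.Idomain.dvdp_mulr.
    have [cp|] := boolP (coprimep g a).
      by right; apply: divg; rewrite -(Pdiv.Idomain.Gauss_dvdpr _ cp).
    rewrite /coprimep => /(g_irr.2 _)/(_ (Pdiv.Idomain.dvdp_gcdl _ _)) ga.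
    left; apply: divg; rewrite -(Pdiv.Idomain.eqp_dvdl _ ga).
    exact: Pdiv.Idomain.dvdp_gcdr.
  by rewrite -[g]mulr1; right=> //; left; rewrite unitr1.
by move=> f; exact: key.
Qed.
End FactorialPoly.

Lemma factorial_can (R R' : idomainType) (f : {rmorphism R -> R'})
    (g : {rmorphism R' -> R}) :
  cancel f g -> cancel g f -> factorial_domain R' -> factorial_domain R.
Proof.
move=> fK gK R'_factorial a a0.
have unitP x : (g x \is a GRing.unit) = (x \is a GRing.unit).
  apply/idP/idP => [|/(rmorph_unit g)//].
  by move=> /(rmorph_unit f); rewrite gK.
have divP x y : divides (g x) (g y) <-> divides x y.
  split=> [[c /(congr1 f)]|[c ->]]; last by exists (g c); rewrite rmorphM.
  by rewrite rmorphM /= !gK => ->; exists (f c).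
have key x : prime_product x -> prime_product (g x).
  elim=> [u uU|p b [p0 pU pP] _ IH]; first by left; rewrite unitP.
  rewrite rmorphM; right=> //; split; rewrite ?unitP //.
    by rewrite -(rmorph0 g) (can_eq gK).
  by move=> c d; rewrite -[c]fK -[d]fK -rmorphM !divP; exact: pP.
rewrite -[a]fK; apply/key/R'_factorial.
by rewrite -(rmorph0 f) (can_eq fK).
Qed.

(** * Factoriality in several variables, by induction on their number *)

Section FactorialMpoly.
Variable F : fieldType.

(** The inverse of [muni], which singles out the last variable as ['X]. *)
Definition of_muni n (p : {poly {mpoly F[n]}}) : {mpoly F[n.+1]} :=
  (map_poly (@mwiden n F) p).['X_ord_max].

Lemma of_muni_is_zmod_morphism n : zmod_morphism (@of_muni n).
Proof. by move=> p q; rewrite /of_muni rmorphB hornerD hornerN. Qed.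

Lemma of_muni_is_monoid_morphism n : monoid_morphism (@of_muni n).
Proof.
by split=> [|p q]; rewrite /of_muni ?rmorph1 ?hornerC // rmorphM hornerM.
Qed.

HB.instance Definition _ n := GRing.isZmodMorphism.Build
  {poly {mpoly F[n]}} {mpoly F[n.+1]} (@of_muni n) (@of_muni_is_zmod_morphism n).
HB.instance Definition _ n := GRing.isMonoidMorphism.Build
  {poly {mpoly F[n]}} {mpoly F[n.+1]} (@of_muni n) (@of_muni_is_monoid_morphism n).

Lemma of_muniD n : {morph @of_muni n : p q / p + q}.
Proof. exact: rmorphD. Qed.

Lemma of_muniM n : {morph @of_muni n : p q / p * q}.
Proof. exact: rmorphM. Qed.

Lemma muniX n (i : 'I_n.+1) : muni 'X_i =
  if fintype.split (cast_ord (esym (addn1 n)) i) is inl j then ('X_j)%:P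
  else 'X :> {poly {mpoly F[n]}}.
Proof. by rewrite /muni mmapX mmap1U. Qed.

Lemma muniK n : cancel (@muni n F) (@of_muni n).
Proof.
move=> p; elim/mpolyind: p => [|c m p _ _ IH]; first by rewrite !rmorph0.
rewrite muniD of_muniD; congr (_ + _); last exact: IH.
rewrite -mul_mpolyC muniM of_muniM muniC; congr (_ * _).
  by rewrite /of_muni map_polyC hornerC /= mwidenC.
rewrite mpolyXE_id !rmorph_prod; apply: eq_bigr => i _.
rewrite !rmorphXn /=; congr (_ ^+ _); rewrite muniX.
case: splitP => [j|j] /= ij.
  rewrite /of_muni map_polyC hornerC /= mwidenX mnmwiden1.
  by congr 'X_[U_(_)]; apply: val_inj; rewrite /= ij.
rewrite /of_muni map_polyX hornerX; congr 'X_[U_(_)]; apply: val_inj => /=.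
by rewrite ij ord1 addn0.
Qed.

Lemma of_muniK n : cancel (@of_muni n) (@muni n F).
Proof.
move=> p; elim/poly_ind: p => [|p c IH]; first by rewrite !rmorph0.
rewrite of_muniD of_muniM muniD muniM; congr (_ * _ + _); first exact: IH.
  rewrite /of_muni map_polyX hornerX muniX; case: splitP => //= j ij.
  by have := ltn_ord j; rewrite -ij ltnn.
rewrite /of_muni map_polyC hornerC /=.
elim/mpolyind: c => [|d m q _ _ IHq]; first by rewrite !rmorph0.
rewrite mwidenD muniD polyCD; congr (_ + _); last exact: IHq.
rewrite -mul_mpolyC mwidenM muniM polyCM mwidenC muniC; congr (_ * _).
rewrite mpolyXE_id !rmorph_prod; apply: eq_bigr => i _.
rewrite !rmorphXn /=; congr (_ ^+ _); rewrite mwidenX mnmwiden1 muniX.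
case: splitP => [j /= ij|j /= ij]; first by congr ('X_[U_(_)])%:P; exact: val_inj.
by have := ltn_ord i; rewrite ij ltnNge leq_addr.
Qed.

Lemma factorial_mpoly n : factorial_domain {mpoly F[n]}.
Proof.
elim: n => [|n IH]; last first.
  exact: factorial_can (@muniK n) (@of_muniK n) (factorial_poly IH).
move=> p p0; left.
have pE : p = (p@_0)%:MP.
  apply/mpolyP => m; rewrite mcoeffC; have -> : m = 0%MM by apply/mnmP; case.
  by rewrite eqxx mulr1.
rewrite pE; apply/unitrPr; exists (p@_0)^-1%:MP.
rewrite -mpolyCM mulfV ?mpolyC1 //.
by apply: contraNneq p0 => p00; rewrite pE p00 mpolyC0.
Qed.
End FactorialMpoly.


(** * Homogeneous primes of a factorially graded domain *)

Section Grading.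
Variables (A S : idomainType) (W : finZmodType).

(* The homogeneous component of degree w of the graded subring of S is        *)
(* [{a | gr_hom w a}], and [gr_in] identifies A with the component of degree 0. *)
Record grading := Grading {
  gr_hom : W -> S -> Prop;
  gr_in : {rmorphism A -> S};
  gr_deg : S -> nat;
  gr_addww : forall w : W, w + w = 0;
  gr_hom0 : forall w, gr_hom w 0;
  gr_homB : forall w (a b : S), gr_hom w a -> gr_hom w b -> gr_hom w (a - b);
  gr_homM : forall u v (a b : S), gr_hom u a -> gr_hom v b -> gr_hom (u + v) (a * b);
  gr_hom_div : forall u v (a b : S), a != 0 -> gr_hom u a -> gr_hom v (a * b) ->
    gr_hom (u + v) b;
  gr_hom_direct : forall a : W -> S, (forall w, gr_hom w (a w)) ->
    \sum_w a w = 0 -> forall w, a w = 0;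
  gr_homE : forall s, gr_hom 0 s <-> exists a, s = gr_in a;
  gr_in_inj : injective gr_in;
  gr_hom_unit : forall u : S, u \is a GRing.unit -> gr_hom 0 u;
  gr_unit_sqrt : forall u : S, u \is a GRing.unit -> exists v, v ^+ 2 = u;
  gr_degM : forall a b : S, a != 0 -> b != 0 -> gr_deg (a * b) = (gr_deg a + gr_deg b)%N;
  gr_deg_unit : forall a : S, a != 0 -> gr_deg a = 0%N -> a \is a GRing.unit;
  gr_cofactors : forall u v (a b : S), a != 0 -> gr_hom u a -> gr_hom v b ->
    exists w d a' b', [/\ gr_hom w d, a = d * a', b = d * b' &
      forall c, divides a' (b' * c) -> divides a' c];
  gr_coprime_pair : forall w, exists b b', [/\ gr_hom w b, gr_hom w b' &
      forall d, divides d b -> divides d b' -> d \is a GRing.unit] }.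
End Grading.

Section HomogeneousPrimes.
Variables (A S : idomainType) (W : finZmodType) (G : grading A S W).
Local Notation hom := (gr_hom G).
Local Notation j := (gr_in G).
Implicit Types (a b c d p : S) (u v w : W).

Definition homogen a := exists w, hom w a.

(** Primality is tested on homogeneous factors only; such an element may factor further in S. *)
Definition hprime p :=
  [/\ homogen p, p != 0, p \isn't a GRing.unit &
      forall a b, homogen a -> homogen b -> divides p (a * b) ->
        divides p a \/ divides p b].

Lemma gr_oppw w : - w = w.
Proof. by apply/eqP; rewrite -subr_eq0 -opprD oppr_eq0 (gr_addww G). Qed.

Lemma gr_addKw u v : u + (u + v) = v.
Proof. by rewrite addrA (gr_addww G) add0r. Qed.

Lemma hom_in x : hom 0 (j x).
Proof. by apply/gr_homE; exists x. Qed.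

Lemma hom1 : hom 0 1.
Proof. by apply: gr_hom_unit; exact: unitr1. Qed.

Lemma homN w a : hom w a -> hom w (- a).
Proof. by move=> wa; rewrite -sub0r; exact: gr_homB (gr_hom0 _ _) wa. Qed.

Lemma homD w a b : hom w a -> hom w b -> hom w (a + b).
Proof. by move=> wa wb; rewrite -[b]opprK; apply: gr_homB wa (homN wb). Qed.

Lemma hom_sum w I (r : seq I) (P : pred I) (F : I -> S) :
  (forall i, P i -> hom w (F i)) -> hom w (\sum_(i <- r | P i) F i).
Proof.
by move=> homF; elim/big_ind: _ => //; [exact: gr_hom0 | exact: homD].
Qed.

Lemma hom_deg_inj u v a : a != 0 -> hom u a -> hom v a -> u = v.
Proof.
move=> a0 ua va; apply/eqP; apply: contraNT a0 => uv.
pose f w := if w == u then a else if w == v then - a else 0.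
have fP w : hom w (f w).
  rewrite /f; case: eqP => [-> //|_]; case: eqP => [->|_]; first exact: homN.
  exact: gr_hom0.
have := @gr_hom_direct _ _ _ G f fP; rewrite (bigD1 u) //= (bigD1 v) 1?eq_sym //=.
rewrite big1 => [|w /andP[wu wv]]; last by rewrite /f (negPf wu) (negPf wv).
rewrite /f eqxx [v == u]eq_sym (negPf uv) eqxx addr0 subrr => /(_ erefl u).
by rewrite eqxx => ->.
Qed.

Lemma homogen_in x : homogen (j x). Proof. by exists 0; exact: hom_in. Qed.

Lemma homogen1 : homogen 1. Proof. by exists 0; exact: hom1. Qed.

Lemma homogenM a b : homogen a -> homogen b -> homogen (a * b).
Proof. by move=> [u ua] [v vb]; exists (u + v); exact: gr_homM. Qed.

Lemma homogenX a n : homogen a -> homogen (a ^+ n).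
Proof.
by move=> ha; elim: n => [|n IH]; [exact: homogen1 | rewrite exprS; exact: homogenM].
Qed.

Lemma homogen_div a b : a != 0 -> homogen a -> homogen (a * b) -> homogen b.
Proof. by move=> a0 [u ua] [v vb]; exists (u + v); exact: gr_hom_div vb. Qed.

(** Let d be the homogeneous gcd of p and a, and [p = d * p']. If d is a unit, coprimality of the
    cofactors makes p divide b; if p' is a unit, p divides a because d does. *)
Lemma hprime_irr p : homogen p -> p != 0 -> p \isn't a GRing.unit ->
  (forall a b, homogen a -> homogen b -> p = a * b ->
     a \is a GRing.unit \/ b \is a GRing.unit) -> hprime p.
Proof.
move=> hp p0 pU irr; split=> // a b [v va] _ [e eE]; have [u up] := hp.
have [w [d [p' [a' [wd pE aE cop]]]]] := gr_cofactors p0 up va.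
have d0 : d != 0 by apply: contraNneq p0 => d0; rewrite pE d0 mul0r.
have hd : homogen d by exists w.
have hp' : homogen p' by apply: homogen_div d0 hd _; rewrite -pE.
have [dU|p'U] := irr d p' hd hp' pE.
- right; have /cop[c ->] : divides p' (a' * b).
    by exists e; apply: (mulfI d0); rewrite !mulrA -aE -pE eE.
  by exists (d^-1 * c); rewrite pE mulrACA divrr // mul1r.
- left; exists (p'^-1 * a'); rewrite aE pE -mulrA; congr (_ * _).
  by rewrite mulrA divrr // mul1r.
Qed.

Lemma hprime_exists a : homogen a -> a != 0 -> a \isn't a GRing.unit ->
  exists2 p, hprime p & divides p a.
Proof.
have [n] := ubnP (gr_deg G a); elim: n a => // n IH a an ha a0 aU.
have [[b [c [hb hc aE bU cU]]]|irr] := pselect (exists b c,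
  [/\ homogen b, homogen c, a = b * c, b \isn't a GRing.unit & c \isn't a GRing.unit]).
  have [b0 c0] : b != 0 /\ c != 0 by apply/andP; rewrite -negb_or -mulf_eq0 -aE.
  have [|p pP pb] := IH b _ hb b0 bU; last first.
    by exists p => //; rewrite aE; exact: divides_mulr.
  rewrite -ltnS; apply: leq_trans an; rewrite ltnS aE gr_degM // -addn1 leq_add2l.
  by rewrite lt0n; apply: contra cU => /eqP/gr_deg_unit->.
exists a; last exact: divides_refl.
apply: hprime_irr => // b c hb hc aE; apply: contrapT => /not_orP[/negP bU /negP cU].
by apply: irr; exists b, c.
Qed.

Lemma hprime_ind (P : S -> Prop) :
  (forall s, s \is a GRing.unit -> P s) ->
  (forall p a, hprime p -> homogen a -> a != 0 -> P a -> P (p * a)) ->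
  forall a, homogen a -> a != 0 -> P a.
Proof.
move=> P1 PM a; have [n] := ubnP (gr_deg G a); elim: n a => // n IH a an ha a0.
have [/P1//|aU] := boolP (a \is a GRing.unit).
have [p pP [b aE]] := hprime_exists ha a0 aU; have [hp p0 pU _] := pP.
have b0 : b != 0 by apply: contraNneq a0 => b0; rewrite aE b0 mulr0.
have hb : homogen b by apply: homogen_div p0 hp _; rewrite -aE.
rewrite aE; apply: PM => //; apply: IH => //.
rewrite -ltnS; apply: leq_trans an; rewrite ltnS aE gr_degM // -add1n leq_add2r.
by rewrite lt0n; apply: contra pU => /eqP/gr_deg_unit->.
Qed.

(** Two coprime elements of degree w are not both divisible by p. The one that escapes becomes a
    unit of degree w in the localisation at p. *)
Lemma hprime_avoid p w : hprime p -> exists2 y, hom w y & ~ divides p y.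
Proof.
move=> [_ _ /negP pU _]; have [b [b' [wb wb' cop]]] := gr_coprime_pair G w.
have [pb|pb] := pselect (divides p b); last by exists b.
by exists b' => // pb'; apply: pU; exact: cop.
Qed.

Lemma hprime_divides p q : hprime p -> hprime q -> divides q p -> divides p q.
Proof.
move=> [hp p0 _ pP] [hq q0 qU _] [e pE].
have he : homogen e by apply: homogen_div q0 hq _; rewrite -pE.
have [|//|[f eE]] := pP q e hq he; first by rewrite -pE; exact: divides_refl.
case/negP: qU; apply/unitrPr; exists f; apply: (mulfI p0).
by rewrite mulr1 [p * (q * f)]mulrCA -eE -pE.
Qed.

Lemma hprime_multiplicity p a : hprime p -> homogen a -> a != 0 ->
  exists n b, [/\ a = p ^+ n * b, homogen b & ~ divides p b].
Proof.
move=> pP; have [hp p0 pU _] := pP.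
have [n] := ubnP (gr_deg G a); elim: n a => // n IH a an ha a0.
have [[b aE]|pa] := pselect (divides p a); last by exists 0%N, a; rewrite mul1r.
have b0 : b != 0 by apply: contraNneq a0 => b0; rewrite aE b0 mulr0.
have hb : homogen b by apply: homogen_div p0 hp _; rewrite -aE.
have [|k [c [bE hc pc]]] := IH b _ hb b0; last first.
  by exists k.+1, c; rewrite exprS -mulrA -bE.
rewrite -ltnS; apply: leq_trans an; rewrite ltnS aE gr_degM // -add1n leq_add2r.
by rewrite lt0n; apply: contra pU => /eqP/gr_deg_unit->.
Qed.

(** * Divisors on the spectrum of the component of degree zero *)

Definition hprime_pred p : A -> bool := fun x => `[< divides p (j x) >].

Lemma hprime_spec_subproof p : hprime p ->
  `[< idealr_closed (hprime_pred p) /\ prime_idealr_closed (hprime_pred p) >].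
Proof.
move=> [hp p0 pU pP]; apply/asboolP; split; first split.
- by apply/asboolP; rewrite rmorph0; exact: divides0.
- by apply/asboolP; rewrite rmorph1 => /divides_unit/(_ (unitr1 _)); exact/negP.
- move=> x y z /asboolP py /asboolP pz; apply/asboolP.
  by rewrite rmorphD rmorphM; apply: dividesD => //; exact: divides_mull.
- move=> x y /asboolP; rewrite rmorphM.
  by case/(pP _ _ (homogen_in x) (homogen_in y)) => h; apply/orP; [left|right]; apply/asboolP.
Qed.

Definition hprime_spec p (pP : hprime p) : spec A := Spec (hprime_spec_subproof pP).

(** The ideal is nonzero because [p * p] has degree 0. For minimality, write a nonzero x in q as p^n
    b with b not divisible by p, and y as p e. An element z of the degree of b, not divisible by p,
    moves the cofactors into degree 0: y^n (b z) = x (e^n z) lies in q, while b z does not even lie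
    in the larger prime. *)
Lemma hprime_height1 p (pP : hprime p) : height1 (hprime_spec pP).
Proof.
have [hp p0 pU pPr] := pP; split.
  have [w wp] := hp; have : hom 0 (p * p) by rewrite -(gr_addww G w); exact: gr_homM.
  move=> /gr_homE[x xE]; exists x; first by apply/asboolP; rewrite -xE; exists p.
  by rewrite -(inj_eq (@gr_in_inj _ _ _ G)) rmorph0 -xE mulf_neq0.
move=> q qp [x qx x0] y /asboolP[e yE].
have [[q0 q1 qI] qP] := specP q.
have jx0 : j x != 0 by rewrite -(rmorph0 j) (inj_eq (@gr_in_inj _ _ _ G)).
have [n [b [xE [v vb] pb]]] := hprime_multiplicity pP (homogen_in x) jx0.
have [z vz pz] := hprime_avoid v pP.
have b0 : b != 0 by apply: contra_notN pb => /eqP->; exact: divides0.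
have [[u up] pn0] : homogen (p ^+ n) /\ p ^+ n != 0.
  by split; [exact: homogenX | rewrite expf_neq0].
(* The product x has degree 0, and W is killed by 2. *)
have uv : u = v.
  rewrite -[v](gr_addKw u) -[LHS]addr0; congr (_ + _); apply: (hom_deg_inj jx0).
    exact: hom_in.
  by rewrite xE; exact: gr_homM.
have /gr_homE[t tE] : hom 0 (b * z) by rewrite -(gr_addww G v); exact: gr_homM.
have e_n : hom v (e ^+ n).
  rewrite -[v](addr0 v) -uv; apply: (gr_hom_div pn0 up).
  by rewrite -exprMn -yE -rmorphXn; exact: hom_in.
have /gr_homE[s sE] : hom 0 (e ^+ n * z) by rewrite -(gr_addww G v); exact: gr_homM.
have E : y ^+ n * t = x * s.
  apply: (@gr_in_inj _ _ _ G); rewrite !rmorphM rmorphXn /= -tE -sE yE xE exprMn.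
  by rewrite !mulrA; congr (_ * _); rewrite -!mulrA [e ^+ n * b]mulrC.
have : q (y ^+ n * t) by rewrite E mulrC -[s * x]addr0; exact: qI.
case/(qP _ _)/orP => [|/qp/asboolP]; last first.
  rewrite -tE => pbz; have hb : homogen b by exists v.
  have hz : homogen z by exists v.
  by case: (pPr _ _ hb hz pbz).
by apply: contraTT => qy; elim: n {E e_n xE up pn0 sE} => [|n IH]; rewrite ?exprS ?spec1 ?specM.
Qed.
End HomogeneousPrimes.


(** * Functoriality of the field of fractions *)

Lemma expfz_div (K : fieldType) (x y : K) (n : int) : (x / y) ^ n = x ^ n / y ^ n.
Proof. by rewrite expfzMl exprz_inv invr_expz. Qed.

Lemma fdiv_neq0 (K : fieldType) (x y : K) : x != 0 -> y != 0 -> x / y != 0.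
Proof. by move=> x0 y0; rewrite mulf_neq0 ?invr_eq0. Qed.

Lemma frac_repr (R : idomainType) (f : {fraction R}) :
  f = tofrac (generic_quotient.repr f).1 / tofrac (generic_quotient.repr f).2.
Proof.
pose x := generic_quotient.repr f; have x20 : x.2 != 0 := denom_ratioP x.
apply: (@mulIf _ (tofrac x.2)); rewrite ?tofrac_eq0 // divfK ?tofrac_eq0 //.
rewrite -/x -[LHS]/(FracField.mul f _) -[f in LHS]reprK -/x !piE; apply/eqmodP.
rewrite /= FracField.equivfE /FracField.mulf !numden_Ratio ?oner_neq0 ?mulr1 //.
by rewrite mulrC.
Qed.

Lemma fractionP (R : idomainType) (f : {fraction R}) :
  exists a b, b != 0 /\ f = tofrac a / tofrac b.
Proof.
by exists (generic_quotient.repr f).1, (generic_quotient.repr f).2; split; [exact: denom_ratioP | exact: frac_repr].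
Qed.

Section FractionMap.
Variables (A S : idomainType) (j : {rmorphism A -> S}).
Local Notation "x %:F" := (tofrac x).

Hypothesis j_inj : injective j.

Definition frac_map (f : {fraction A}) : {fraction S} :=
  (j (generic_quotient.repr f).1)%:F / (j (generic_quotient.repr f).2)%:F.

Lemma in_eq0 x : (j x == 0) = (x == 0).
Proof. by rewrite -(rmorph0 j) (inj_eq j_inj). Qed.

Lemma frac_mapE a b : b != 0 -> frac_map (a%:F / b%:F) = (j a)%:F / (j b)%:F.
Proof.
move=> b0; pose f := a%:F / b%:F; pose x := generic_quotient.repr f.
rewrite /frac_map -/f -/x.
have x20 : x.2 != 0 := denom_ratioP x.
have E : a * x.2 = x.1 * b.
  apply/eqP; rewrite -tofrac_eq !tofracM -(@eqr_div {fraction A}) ?tofrac_eq0 //.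
  exact/eqP/(frac_repr f).
apply/eqP; rewrite eqr_div ?tofrac_eq0 ?in_eq0 //.
by rewrite -!tofracM tofrac_eq -!rmorphM E.
Qed.

Lemma frac_map_tofrac a : frac_map a%:F = (j a)%:F.
Proof. by rewrite -[a%:F]divr1 -tofrac1 frac_mapE ?oner_neq0 // rmorph1 tofrac1 divr1. Qed.

Lemma frac_map_is_zmod_morphism : zmod_morphism frac_map.
Proof.
move=> f g; have [a [b [b0 ->]]] := fractionP f; have [c [d [d0 ->]]] := fractionP g.
have subE (R : idomainType) (x y z t : R) : y != 0 -> t != 0 ->
    x%:F / y%:F - z%:F / t%:F = (x * t - z * y)%:F / (y * t)%:F.
  by move=> y0 t0; rewrite -mulNr addf_div ?tofrac_eq0 // mulNr -!tofracM -tofracB.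
rewrite subE // !frac_mapE ?mulf_neq0 // subE ?in_eq0 //.
by rewrite rmorphB !rmorphM.
Qed.

Lemma frac_map_is_monoid_morphism : monoid_morphism frac_map.
Proof.
split=> [|f g]; first by rewrite -tofrac1 frac_map_tofrac rmorph1.
have [a [b [b0 ->]]] := fractionP f; have [c [d [d0 ->]]] := fractionP g.
have mulE (R : idomainType) (x y z t : R) :
    x%:F / y%:F * (z%:F / t%:F) = (x * z)%:F / (y * t)%:F.
  by rewrite mulf_div -!tofracM.
by rewrite mulE !frac_mapE ?mulf_neq0 // mulE !rmorphM.
Qed.

Lemma frac_map_inj : injective frac_map.
Proof.
move=> f g; have [a [b [b0 ->]]] := fractionP f; have [c [d [d0 ->]]] := fractionP g.
rewrite !frac_mapE // => /eqP; rewrite eqr_div ?tofrac_eq0 ?in_eq0 //.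
rewrite -!tofracM tofrac_eq -!rmorphM (inj_eq j_inj) => /eqP E.
by apply/eqP; rewrite eqr_div ?tofrac_eq0 // -!tofracM E.
Qed.
End FractionMap.


(** * Local rings and valuations *)

Section LocalRings.
Variables (A S : idomainType) (W : finZmodType) (G : grading A S W).
Local Notation hom := (gr_hom G).
Local Notation j := (gr_in G).
Local Notation "x %:F" := (tofrac x).
Local Notation F := {fraction A}.
Local Notation L := {fraction S}.
Implicit Types (a b : S) (p : spec A) (u v w : W) (z t : L) (P : primeDiv A).

(* Locked, because unification would unfold it to a quotient of lifts. *)
Fact gr_frac_key : unit. Proof. by []. Qed.
Definition gr_frac : F -> L := locked_with gr_frac_key (frac_map j).

Lemma gr_frac_unlock : gr_frac = frac_map j.
Proof. exact: locked_withE. Qed.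

Lemma gr_frac_is_zmod_morphism : zmod_morphism gr_frac.
Proof. by rewrite gr_frac_unlock; exact: frac_map_is_zmod_morphism (@gr_in_inj _ _ _ G). Qed.

Lemma gr_frac_is_monoid_morphism : monoid_morphism gr_frac.
Proof. by rewrite gr_frac_unlock; exact: frac_map_is_monoid_morphism (@gr_in_inj _ _ _ G). Qed.

HB.instance Definition _ := GRing.isZmodMorphism.Build F L gr_frac
  gr_frac_is_zmod_morphism.
HB.instance Definition _ := GRing.isMonoidMorphism.Build F L gr_frac
  gr_frac_is_monoid_morphism.

Lemma gr_fracE x y : y != 0 -> gr_frac (x%:F / y%:F) = (j x)%:F / (j y)%:F.
Proof. by move=> y0; rewrite gr_frac_unlock frac_mapE //; exact: gr_in_inj. Qed.

Lemma gr_in_eq0 x : (j x == 0) = (x == 0).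
Proof. exact: in_eq0 (@gr_in_inj _ _ _ G) x. Qed.

Lemma gr_frac_inj : injective gr_frac.
Proof. by rewrite gr_frac_unlock; exact: frac_map_inj (@gr_in_inj _ _ _ G). Qed.

Lemma gr_frac_eq0 f : (gr_frac f == 0) = (f == 0).
Proof. by rewrite -(rmorph0 gr_frac) (inj_eq gr_frac_inj). Qed.

(** Taking denominators only from A loses nothing, since [b * b] has degree 0 for every homogeneous
    b ([homL_div]). This is [locL] at the generic point. *)
Definition homL w z := exists a (x : A), [/\ hom w a, x != 0 & z = a%:F / (j x)%:F].

Definition locL (p : spec A) w z :=
  exists a (x : A), [/\ hom w a, ~~ p x & z = a%:F / (j x)%:F].

Lemma locLB p w z t : locL p w z -> locL p w t -> locL p w (z - t).
Proof.
move=> [a [x [wa px ->]]] [b [y [wb py ->]]].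
exists (a * j y - b * j x), (x * y); split; last 1 first.
- have [jx0 jy0] : (j x)%:F != 0 /\ (j y)%:F != 0.
    by split; rewrite tofrac_eq0 gr_in_eq0 -tofrac_eq0 ?(spec_neq0 px) ?(spec_neq0 py).
  by rewrite -mulNr addf_div // mulNr rmorphM tofracB !tofracM.
- rewrite -[w](addr0 w); apply: gr_homB; apply: gr_homM => //; exact: hom_in.
- exact: specM.
Qed.

Lemma locL0 p w : locL p w 0.
Proof.
by exists 0, 1; split; [exact: gr_hom0 | exact: spec1 | rewrite tofrac0 mul0r].
Qed.

Lemma locLN p w z : locL p w z -> locL p w (- z).
Proof. by rewrite -sub0r; apply: locLB; exact: locL0. Qed.

Lemma locLD p w z t : locL p w z -> locL p w t -> locL p w (z + t).
Proof. by move=> wz wt; rewrite -[t]opprK; apply: locLB wz (locLN wt). Qed.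

Lemma locL_sum p w I (r : seq I) (Q : pred I) (E : I -> L) :
  (forall i, Q i -> locL p w (E i)) -> locL p w (\sum_(i <- r | Q i) E i).
Proof.
by move=> EP; elim/big_ind: _ => //; [exact: locL0 | exact: locLD].
Qed.

Lemma locLM p v w z t : locL p v z -> locL p w t -> locL p (v + w) (z * t).
Proof.
move=> [a [x [wa px ->]]] [b [y [wb py ->]]]; exists (a * b), (x * y).
by split; [exact: gr_homM | exact: specM | rewrite mulf_div rmorphM !tofracM].
Qed.

Lemma locL_tofrac p w a : hom w a -> locL p w a%:F.
Proof. by exists a, 1; rewrite spec1 rmorph1 tofrac1 divr1. Qed.

Lemma locL1 p : locL p 0 1.
Proof. by rewrite -tofrac1; apply: locL_tofrac; exact: hom1. Qed.

Lemma locL_gr_frac p f : locring p f <-> locL p 0 (gr_frac f).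
Proof.
split=> [[x [s [ps ->]]]|[a [x [/gr_homE[y ->] px E]]]].
  exists (j x), s; split=> //; first exact: hom_in.
  by rewrite gr_fracE // -tofrac_eq0 (spec_neq0 ps).
exists y, x; split=> //; apply: gr_frac_inj; rewrite E gr_fracE //.
by rewrite -tofrac_eq0 (spec_neq0 px).
Qed.

Lemma homLM v w z t : homL v z -> homL w t -> homL (v + w) (z * t).
Proof. exact: (@locLM (generic_point A)). Qed.

Lemma homL0 w : homL w 0.
Proof. exact: (locL0 (generic_point A)). Qed.

Lemma homL1 : homL 0 1.
Proof. exact: (locL1 (generic_point A)). Qed.

Lemma homL_gr_frac f : homL 0 (gr_frac f).
Proof.
by have [a [b [b0 ->]]] := fractionP f; apply/(locL_gr_frac (generic_point A)); exists a, b.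
Qed.

Lemma homL_div u v a b : b != 0 -> hom u a -> hom v b -> homL (u + v) (a%:F / b%:F).
Proof.
move=> b0 ua vb; have /gr_homE[x xE] : hom 0 (b * b).
  by rewrite -(gr_addww G v); exact: gr_homM.
exists (a * b), x; split; first exact: gr_homM.
  by rewrite -gr_in_eq0 -xE mulf_neq0.
rewrite -xE; apply/eqP; rewrite eqr_div ?tofrac_eq0 ?mulf_neq0 // -!tofracM.
by rewrite -mulrA.
Qed.

Lemma homL_hom w a : homL w a%:F -> hom w a.
Proof.
move=> [b [x [wb x0 E]]]; have jx0 : j x != 0 by rewrite gr_in_eq0.
rewrite -[w]add0r; apply: (gr_hom_div jx0 (hom_in G x)).
suff -> : j x * a = b by [].
apply/eqP; rewrite -tofrac_eq tofracM E mulrC divfK ?tofrac_eq0 //.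
Qed.

Lemma homL_eq0 (z : W -> L) : (forall w, homL w (z w)) -> \sum_w z w = 0 ->
  forall w, z w = 0.
Proof.
move=> homz sz.
have [x xP] : {x : W -> A & forall w, exists2 a,
    hom w a & x w != 0 /\ z w = a%:F / (j (x w))%:F}.
  apply: (@choice _ _ (fun w x => exists2 a, hom w a & x != 0 /\ z w = a%:F / (j x)%:F)).
  by move=> w; have [a [y [wa y0 zE]]] := homz w; exists y, a.
have [a aP] : {a : W -> S & forall w,
    hom w (a w) /\ x w != 0 /\ z w = (a w)%:F / (j (x w))%:F}.
  apply: (@choice _ _ (fun w a => hom w a /\ x w != 0 /\ z w = a%:F / (j (x w))%:F)).
  by move=> w; have [b wb xz] := xP w; exists b.
pose X := \prod_w x w; have X0 : (j X)%:F != 0.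
  by rewrite tofrac_eq0 gr_in_eq0; apply/prodf_neq0 => w _; case: (aP w) => _ [].
pose b w := a w * j (\prod_(v | v != w) x v).
have bE w : (b w)%:F = z w * (j X)%:F.
  have [_ [xw0 ->]] := aP w; rewrite /b /X [\prod_v x v](bigD1 w) //= (rmorphM j) !tofracM.
  by rewrite [RHS]mulrA divfK // tofrac_eq0 gr_in_eq0.
have wb w : hom w (b w).
  by have [wa _] := aP w; have := gr_homM wa (hom_in G (\prod_(v | v != w) x v)); rewrite addr0.
have sb : \sum_w b w = 0.
  apply/eqP; rewrite -tofrac_eq0 rmorph_sum /=.
  by under eq_bigr do rewrite bE; rewrite -mulr_suml sz mul0r.
move=> w; apply: (mulIf X0); rewrite -bE mul0r.
by rewrite (gr_hom_direct wb sb) tofrac0.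
Qed.

(** ** Generators of the height one primes *)

(** Start from a nonzero x0 in P. If every element of A divisible by [q * b] lies in P, the same
    holds for q or for b, because P is prime. Descending through the homogeneous factorisation of
    [j x0] one meets a homogeneous prime q whose height one prime lies in P, hence equals P by
    minimality. *)
Lemma primeDiv_hprime P :
  exists2 q, hprime G q & forall x, P x = `[< divides q (j x) >].
Proof.
have [[x0 Px0 x00] Pmin] : height1 P by case: P => p /= /asboolP.
have [[P0 P1 PI] PP] := specP P.
have key : forall a, homogen G a -> a != 0 -> (forall x, divides a (j x) -> P x) ->
    exists2 q, hprime G q & forall x, divides q (j x) -> P x.
  apply: hprime_ind => [u uU|q b qP hb b0 IH] Pa.
    have /negP[] := spec1 P; apply: Pa; rewrite rmorph1.
    by exists u^-1; rewrite divrr.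
  have [qS|] := pselect (forall x, divides q (j x) -> P x); first by exists q.
  move=> /existsNP[x /not_implyP[[c qx] /negP Px]]; apply: IH => y [d by_].
  have /Pa/(PP _ _)/orP[/(negP Px)//|//] : divides (q * b) (j (x * y)).
  by exists (c * d); rewrite rmorphM qx by_ mulrACA.
have [|x [c]|q qP qS] := key (j x0) (homogen_in G x0); first by rewrite gr_in_eq0.
  move=> xE; have /gr_homE[y yE] : hom 0 c.
    rewrite -[0](gr_addww G 0); apply: (gr_hom_div _ (hom_in G x0)).
      by rewrite gr_in_eq0.
    by rewrite -xE; exact: hom_in.
  move: xE; rewrite yE -rmorphM => /(@gr_in_inj _ _ _ G) ->.
  by rewrite mulrC -[y * x0]addr0; exact: PI.
exists q => // x; apply/idP/asboolP => [Px|]; last exact: qS.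
have [q1 _] := hprime_height1 qP.
have /(_ x Px)/asboolP := Pmin (hprime_spec qP) (fun x qx => qS x (asboolW qx)) q1.
by [].
Qed.

Definition pgen P := sval (cid2 (primeDiv_hprime P)).

Lemma pgenP P : hprime G (pgen P).
Proof. by rewrite /pgen; case: cid2. Qed.

Lemma pgenE P x : P x = `[< divides (pgen P) (j x) >].
Proof. by rewrite /pgen; case: cid2. Qed.
End LocalRings.


(** * Orders along height one primes, measured by homogeneous generators *)

Section Valuations.
Variables (A S : idomainType) (W : finZmodType) (G : grading A S W).
Local Notation hom := (gr_hom G).
Local Notation j := (gr_in G).
Local Notation "x %:F" := (tofrac x).
Local Notation F := {fraction A}.
Local Notation L := {fraction S}.
Local Notation Div := (weilDiv A).
Local Notation pi := (pgen G).
Local Notation jF := (gr_frac G).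
Local Notation locL := (locL G).
Implicit Types (a b : S) (p : spec A) (u v w : W) (z t : L) (P : primeDiv A).
Implicit Types (D E : Div).

Definition pdeg P : W := sval (cid (let: And4 h _ _ _ := pgenP G P in h)).

Lemma pdegP P : hom (pdeg P) (pi P).
Proof. by rewrite /pdeg; case: cid. Qed.

Lemma pi_neq0 P : (pi P)%:F != 0.
Proof. by rewrite tofrac_eq0; case: (pgenP G P). Qed.

(** The inverse is asked for in the same degree, because W is killed by 2. *)
Definition locU p w z := [/\ z != 0, locL p w z & locL p w z^-1].

Lemma locU1 p : locU p 0 1.
Proof. by split; rewrite ?invr1 ?oner_neq0 //; exact: locL1. Qed.

Lemma locUM p v w z t : locU p v z -> locU p w t -> locU p (v + w) (z * t).
Proof.
by move=> [z0 vz vz'] [t0 wt wt']; split; rewrite ?mulf_neq0 ?invfM //; exact: locLM.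
Qed.

Lemma locUV p w z : locU p w z -> locU p w z^-1.
Proof. by move=> [z0 wz wz']; split; rewrite ?invr_eq0 ?invrK. Qed.

Lemma locUX p w z (n : int) : locU p w z -> locU p (w *~ n) (z ^ n).
Proof.
move=> wz; have key m : locU p (w *+ m) (z ^+ m).
  elim: m => [|m IH]; first exact: locU1.
  by rewrite mulrS exprS; exact: locUM.
case: n => m; first exact: key.
by rewrite NegzE -exprnN mulrNz (gr_oppw G); apply: locUV; exact: key.
Qed.

Lemma pgen_avoid P w : exists2 y, hom w y & ~ divides (pi P) y.
Proof. exact: hprime_avoid (pgenP G P). Qed.

Lemma not_divides_neq0 a b : ~ divides a b -> b != 0.
Proof. by move=> ab; apply: contra_notN ab => /eqP->; exact: divides0. Qed.

(** The inverse of y is t / (y t), where t has the same degree and is not divisible by the generator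
    either: y t then has degree 0 and lies outside P. *)
Lemma locU_avoid P w y : hom w y -> ~ divides (pi P) y -> locU P w y%:F.
Proof.
move=> wy py; have y0 := not_divides_neq0 py; split.
- by rewrite tofrac_eq0.
- exact: locL_tofrac.
have [t wt pt] := pgen_avoid P w.
have /gr_homE[x xE] : hom 0 (y * t) by rewrite -(gr_addww G w); exact: gr_homM.
exists t, x; split=> //.
  apply/negP; rewrite (pgenE G) -xE => /asboolP.
  have [_ _ _ pP] := pgenP G P.
  by case/(pP _ _ (ex_intro _ w wy) (ex_intro _ w wt)).
rewrite -xE tofracM invfM mulrCA divff ?mulr1 // tofrac_eq0.
exact: not_divides_neq0 pt.
Qed.

Lemma locmax_pgen P f : locmax P f <-> locL P (pdeg P) (jF f / (pi P)%:F).
Proof.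
have p0 := pi_neq0 P; have wp := pdegP P.
split=> [[x [s [Px Ps ->]]]|[a [x [wa Px E]]]].
  move: Px; rewrite (pgenE G) => /asboolP[e eE]; exists e, s; split=> //.
    rewrite -[pdeg P]addr0; apply: (gr_hom_div _ wp); first by rewrite -tofrac_eq0.
    by rewrite -eE; exact: hom_in.
  rewrite gr_fracE; last by rewrite -tofrac_eq0 (spec_neq0 Ps).
  by rewrite eE tofracM mulrAC [_%:F * _]mulrC mulfK.
have /gr_homE[y yE] : hom 0 (pi P * a).
  by rewrite -(gr_addww G (pdeg P)); exact: gr_homM.
exists y, x; split=> //.
  by rewrite (pgenE G); apply/asboolP; rewrite -yE; exists a.
apply: (@gr_frac_inj _ _ _ G).
rewrite gr_fracE; last by rewrite -tofrac_eq0 (spec_neq0 Px).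
by rewrite -yE tofracM -mulrA -E mulrC divfK.
Qed.

(** Divide the generator by an element y of its degree that it does not divide: the quotient has
    degree 0 and y is a homogeneous unit at P. Existence is essential, as [ord_ge] and [ord_eq]
    quantify over all uniformizers. *)
Lemma uniformizer_exists P : exists2 t, uniformizer P t &
  locU P (pdeg P) (jF t / (pi P)%:F).
Proof.
have p0 := pi_neq0 P; have wp := pdegP P.
have [y wy py] := pgen_avoid P (pdeg P).
have y0 := not_divides_neq0 py; have yU := locU_avoid wy py.
have /gr_homE[x xE] : hom 0 (pi P * y).
  by rewrite -(gr_addww G (pdeg P)); exact: gr_homM.
have /gr_homE[s sE] : hom 0 (y * y).
  by rewrite -(gr_addww G (pdeg P)); exact: gr_homM.
have s0 : s != 0 by rewrite -(gr_in_eq0 G) -sE mulf_neq0.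
have tE : jF (x%:F / s%:F) = (pi P)%:F / y%:F.
  rewrite gr_fracE // -xE -sE; apply/eqP.
  rewrite eqr_div ?tofrac_eq0 ?mulf_neq0 // -!tofracM; apply/eqP.
  by rewrite mulrA.
have yF0 : y%:F != 0 by rewrite tofrac_eq0.
have t0 : jF (x%:F / s%:F) != 0 by rewrite tE; exact: fdiv_neq0.
exists (x%:F / s%:F); last first.
  by rewrite tE mulrAC divff // mul1r; exact: locUV.
split=> [|f]; first by rewrite -(gr_frac_eq0 G).
rewrite locmax_pgen (locL_gr_frac G) fmorph_div /= tE invf_div mulrA mulrAC.
have [_ yL yVL] := yU.
split=> [H|H].
  by rewrite -(gr_addww G (pdeg P)); exact: locLM.
by rewrite -[_ / _](mulfK yF0) -[pdeg P]add0r; exact: locLM.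
Qed.

Lemma uniformizer_pgen P (t : F) : uniformizer P t ->
  locU P (pdeg P) (jF t / (pi P)%:F).
Proof.
move=> [t0 tP]; have [s [s0 sP] [sp0 spL spVL]] := uniformizer_exists P.
have p0 := pi_neq0 P; have jt0 : jF t != 0 by rewrite gr_frac_eq0.
have js0 : jF s != 0 by rewrite gr_frac_eq0.
split; first exact: fdiv_neq0.
  by apply/locmax_pgen/tP; rewrite divff //; exact: locring1.
have /tP/(locL_gr_frac G) st : locmax P s by apply/sP; rewrite divff //; exact: locring1.
move: st; rewrite fmorph_div /= => st; have := locLM st spVL; rewrite add0r.
by congr locL; rewrite !invf_div mulrC mulrA divfK.
Qed.

Lemma ord_geP P f (n : int) :
  ord_ge P f n <-> locL P (pdeg P *~ n) (jF f / (pi P)%:F ^ n).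
Proof.
have p0 := pi_neq0 P; split=> [fn|fn t tP].
  have [t tP tp] := uniformizer_exists P.
  have := fn t tP; rewrite (locL_gr_frac G) fmorph_div fmorphXz /= => H.
  have [_ tpn _] := locUX n tp; have := locLM H tpn; rewrite add0r.
  congr locL; rewrite expfz_div mulrA divfK // expfz_neq0 //.
  by rewrite gr_frac_eq0; case: tP.
have tp := uniformizer_pgen tP.
rewrite (locL_gr_frac G) fmorph_div fmorphXz /=.
have [_ _ tpn] := locUX n tp; have := locLM fn tpn; rewrite (gr_addww G).
congr locL; rewrite expfz_div invf_div.
by rewrite mulrA divfK // expfz_neq0.
Qed.

Lemma ord_eqP P f (n : int) :
  ord_eq P f n <-> locU P (pdeg P *~ n) (jF f / (pi P)%:F ^ n).
Proof.
have p0 := pi_neq0 P; split=> [fn|[fn0 fn fnV] t tP].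
  have [t tP tp] := uniformizer_exists P.
  have [f0 H1 H2] := fn t tP.
  have [jt0 _ _] := locUX n tp.
  have tn0 : jF t ^ n != 0 by rewrite expfz_neq0 // gr_frac_eq0; case: tP.
  have := locUM (p := P) (v := 0) (z := jF f / jF t ^ n) _ (locUX n tp).
  rewrite add0r expfz_div mulrA divfK //; apply.
  split; first by rewrite -fmorphXz -fmorph_div gr_frac_eq0.
    by rewrite -fmorphXz -fmorph_div; apply/locL_gr_frac.
  by rewrite -fmorphXz -fmorph_div -fmorphV; apply/locL_gr_frac.
have tp := uniformizer_pgen tP.
have : locU P 0 (jF f / jF t ^ n).
  have := locUM (And3 fn0 fn fnV) (locUV (locUX n tp)); rewrite (gr_addww G).
  congr locU; rewrite expfz_div invf_div.
  by rewrite mulrA divfK // expfz_neq0.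
rewrite -fmorphXz -fmorph_div => -[f0 H1 H2]; split.
- by rewrite gr_frac_eq0 in f0.
- exact/(locL_gr_frac G).
- by apply/(locL_gr_frac G); rewrite fmorphV.
Qed.
End Valuations.


(** * The class group *)

Section DivisorSum.
Variables (R : nzRingType) (T : choiceType) (M : Type) (idx : M).
Variables (op : Monoid.com_law idx) (f : T -> R -> M).
Hypothesis f0 : forall x, f x 0 = idx.
Hypothesis fD : forall x m n, f x (m + n) = op (f x m) (f x n).
Implicit Types D E : {freeg T / R}.

(** The common form of the fraction [divfun], the degree [divdeg] and the evaluation [cox_eval]. *)
Definition div_big D : M := \big[op/idx]_(x <- dom D) f x (coeff x D).

Lemma div_big_widen D (r : seq T) : uniq r -> {subset dom D <= r} ->
  div_big D = \big[op/idx]_(x <- r) f x (coeff x D).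
Proof.
move=> r_uniq Dr; rewrite [RHS](bigID (mem (dom D))) /=.
rewrite [X in op _ X]big1 ?Monoid.mulm1 => [|x /coeff_outdom->]; last exact: f0.
rewrite -big_filter /div_big; apply: perm_big; apply: uniq_perm.
- exact: uniq_dom.
- exact: filter_uniq.
- by move=> x; rewrite mem_filter; case: (boolP (x \in dom D)) => //= /Dr->.
Qed.

Lemma div_bigD D E : div_big (D + E) = op (div_big D) (div_big E).
Proof.
pose r := undup (dom D ++ dom E); have r_uniq : uniq r := undup_uniq _.
have rE x : (x \in r) = (x \in dom D) || (x \in dom E) by rewrite mem_undup mem_cat.
rewrite !(@div_big_widen _ r) //; last 3 first.
- by move=> x xE; rewrite rE xE orbT.
- by move=> x xD; rewrite rE xD.
- by move=> x /domD_subset; rewrite mem_cat rE.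
by rewrite -big_split /=; apply: eq_bigr => x _; rewrite coeffD fD.
Qed.

Lemma div_big0 : div_big 0 = idx.
Proof. by rewrite /div_big dom0 big_nil. Qed.

Lemma div_bigU c x : div_big << c *g x >> = f x c.
Proof.
have [->|c0] := eqVneq c 0; last by rewrite /div_big domU // big_seq1 coeffU eqxx mulr1.
by rewrite freegU0 div_big0 f0.
Qed.
End DivisorSum.

Section ClassGroup.
Variables (A S : idomainType) (W : finZmodType) (G : grading A S W).
Local Notation hom := (gr_hom G).
Local Notation j := (gr_in G).
Local Notation "x %:F" := (tofrac x).
Local Notation F := {fraction A}.
Local Notation L := {fraction S}.
Local Notation Div := (weilDiv A).
Local Notation pi := (pgen G).
Local Notation jF := (gr_frac G).
Local Notation locL := (locL G).
Local Notation locU := (locU G).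
Implicit Types (a b : S) (p : spec A) (u v w : W) (z t : L) (P Q : primeDiv A).
Implicit Types (D E : Div).

(* The homogeneous fraction of S with divisor D, and its degree. *)
Definition divfun D : L := div_big *%R (fun P n => (pi P)%:F ^ n) D.
Definition divdeg D : W := div_big +%R (fun P n => pdeg G P *~ n) D.

Lemma divfunD D E : divfun (D + E) = divfun D * divfun E.
Proof.
by apply: div_bigD => [P|P m n]; rewrite ?expr0z // expfzDr ?pi_neq0.
Qed.

Lemma divdegD D E : divdeg (D + E) = divdeg D + divdeg E.
Proof. by apply: div_bigD => [P|P m n]; rewrite ?mulr0z // mulrzDr. Qed.

Lemma divfun_neq0 D : divfun D != 0.
Proof.
rewrite /divfun /div_big; elim/big_ind: _ => [|x y|P _]; first exact: oner_neq0.
- exact: mulf_neq0.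
- exact/expfz_neq0/pi_neq0.
Qed.

Lemma divdeg0 : divdeg 0 = 0. Proof. exact: div_big0. Qed.

Lemma divfun0 : divfun 0 = 1. Proof. exact: div_big0. Qed.

Lemma divdegN D : divdeg (- D) = divdeg D.
Proof.
by apply/eqP; rewrite -subr_eq0 -[- divdeg D]/(- divdeg D) (gr_oppw G) -divdegD addNr divdeg0.
Qed.

Lemma divfunN D : divfun (- D) = (divfun D)^-1.
Proof.
by apply: (mulfI (divfun_neq0 D)); rewrite divff ?divfun_neq0 // -divfunD subrr divfun0.
Qed.

Lemma primeDiv_inj P Q : divides (pi P) (pi Q) -> P = Q.
Proof.
move=> PQ; have QP x : Q x -> P x.
  by rewrite !(pgenE G) => /asboolP Qx; apply/asboolP; exact: divides_trans Qx.
have Ph : height1 P by case: P {PQ QP} => p /= /asboolP.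
have [Q1 _] : height1 Q by case: Q {PQ QP} => p /= /asboolP.
apply/val_inj/val_inj/funext => x /=.
by apply/idP/idP; [exact: Ph.2 | exact: QP].
Qed.

(** The generators of the height one primes other than P are homogeneous units at P and are
    collected in e. *)
Lemma divfun_at P D : exists v e, [/\ locU P v e,
  divfun D = (pi P)%:F ^ (coeff P D) * e & divdeg D = pdeg G P *~ coeff P D + v].
Proof.
pose r := undup (P :: dom D); have r_uniq : uniq r := undup_uniq _.
have Pr : P \in r by rewrite mem_undup mem_head.
have Dr : {subset dom D <= r} by move=> x xD; rewrite mem_undup inE xD orbT.
rewrite /divfun (div_big_widen *%R (f := fun P n => (pi P)%:F ^ n) (fun=> expr0z _) r_uniq Dr).
rewrite /divdeg (div_big_widen +%R (f := fun P n => pdeg G P *~ n) (fun=> mulr0z _) r_uniq Dr).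
rewrite !(bigD1_seq P) //=; set v := \sum_(i <- r | _) _; set e := \prod_(i <- r | _) _.
exists v, e; split=> //; rewrite /v /e; elim/big_ind2: _ => [|x1 x2 y1 y2|Q QP].
- exact: locU1.
- exact: locUM.
- apply/locUX/locU_avoid; first exact: pdegP.
  by move=> /primeDiv_inj PQ; rewrite PQ eqxx in QP.
Qed.

Lemma sheafO_divfun D h f : sheafO D h f <->
  forall P, ~~ P h -> locL P (divdeg D) (jF f * divfun D).
Proof.
have key P : ord_ge P f (- coeff P D) <-> locL P (divdeg D) (jF f * divfun D).
  have [v [e [[e0 eL eV] -> ->]]] := divfun_at P D; rewrite (ord_geP G).
  rewrite -invr_expz invrK mulrNz (gr_oppw G); split=> [fL|fL].
    by rewrite mulrA; exact: locLM.
  have := locLM fL eV; rewrite mulrA mulfK // -addrA (gr_addww G) addr0.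
  by [].
by split=> H P Ph; apply/key/H.
Qed.

Lemma is_div_divfun f D : is_div f D <->
  f != 0 /\ forall P, locU P (divdeg D) (jF f / divfun D).
Proof.
have key P : ord_eq P f (coeff P D) <-> locU P (divdeg D) (jF f / divfun D).
  have [v [e [eU -> ->]]] := divfun_at P D; rewrite (ord_eqP G); split=> fU.
    by rewrite invfM mulrA; apply: locUM => //; exact: locUV.
  have := locUM fU eU; rewrite -addrA (gr_addww G) addr0 invfM mulrA divfK //.
  by case: eU.
by split=> -[f0 H]; split=> // P; apply/key/H.
Qed.

Lemma homL_divfun D : homL G (divdeg D) (divfun D).
Proof.
rewrite /divdeg /divfun /div_big; elim/big_ind2: _ => [|x1 x2 y1 y2|P _].
- exact: homL1.
- exact: homLM.
- have [|//] := @locUX _ _ _ G (generic_point A) (pdeg G P) (pi P)%:F (coeff P D).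
  have p0 := pi_neq0 G P; rewrite tofrac_eq0 in p0.
  split; rewrite ?tofrac_eq0 //; first by apply: locL_tofrac; exact: pdegP.
  rewrite -[_^-1]mul1r -tofrac1 -[pdeg G P]add0r.
  by apply: homL_div => //; [exact: hom1 | exact: pdegP].
Qed.

Lemma hprime_primeDiv q : hprime G q ->
  exists P, (forall x, P x = `[< divides q (j x) >]) /\
            divides q (pi P) /\ divides (pi P) q.
Proof.
move=> qP; have qh : `[< height1 (hprime_spec qP) >].
  by apply/asboolP; exact: hprime_height1.
exists (PrimeDiv qh); split=> //; have [[w wq] _ _ _] := qP.
have /gr_homE[x xE] : hom 0 (q * q) by rewrite -(gr_addww G w); exact: gr_homM.
suff pq : divides (pi (PrimeDiv qh)) q.
  by split=> //; exact: hprime_divides qP (pgenP G _) pq.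
have : PrimeDiv qh x by apply/asboolP; rewrite -xE; exists q.
rewrite (pgenE G) -xE => /asboolP; have [_ _ _ pP] := pgenP G (PrimeDiv qh).
by case/(pP _ _ (ex_intro _ w wq) (ex_intro _ w wq)).
Qed.

(* Regularity at all height one primes: a prime factor of the denominator of  *)
(* a reduced fraction would give a height one prime where it is not regular.  *)
Lemma locL_regular w z : homL G w z -> (forall P, locL P w z) ->
  exists2 s, hom w s & z = s%:F.
Proof.
move=> wz zL; have [b [x [wb x0 zE]]] := wz.
have jx0 : j x != 0 by rewrite gr_in_eq0.
have [v [d [a' [b' [vd xE bE cop]]]]] := gr_cofactors jx0 (hom_in G x) wb.
have [d0 a'0] : d != 0 /\ a' != 0 by apply/andP; rewrite -negb_or -mulf_eq0 -xE.
have ha' : homogen G a'.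
  by apply: (homogen_div d0); [exists v | rewrite -xE; exact: homogen_in].
have {}zE : z = b'%:F / a'%:F.
  rewrite zE bE xE; apply/eqP; rewrite eqr_div ?tofrac_eq0 ?mulf_neq0 //.
  by rewrite -!tofracM mulrAC mulrA mulrAC [b' * _]mulrC.
have [a'U|a'U] := boolP (a' \is a GRing.unit); last first.
  have [q qP qa] := hprime_exists ha' a'0 a'U.
  have [P [PE _]] := hprime_primeDiv qP.
  have [c [y [wc Py zE']]] := zL P; case/negP: (Py); rewrite PE; apply/asboolP.
  apply: divides_trans qa _; apply: cop; exists c.
  apply/eqP; rewrite -tofrac_eq !tofracM [_ * c%:F]mulrC -eqr_div ?tofrac_eq0 //.
    by rewrite -zE zE'.
  by rewrite gr_in_eq0 -tofrac_eq0 (spec_neq0 Py).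
have {}zE : z = (b' / a')%:F.
  by rewrite zE; apply: (canLR (mulfK _)); rewrite ?tofrac_eq0 // -tofracM divrK.
by exists (b' / a') => //; apply: (@homL_hom _ _ _ G); rewrite -zE.
Qed.

(** The quotient of f by [divfun D] and its inverse are regular at all height one primes, so both
    lie in S by [locL_regular]. *)
Lemma is_div_unit f D : is_div f D ->
  exists2 c, c \is a GRing.unit & jF f = c%:F * divfun D.
Proof.
move=> /is_div_divfun[f0 fU].
have fL : homL G (divdeg D) (jF f / divfun D).
  rewrite -[divdeg D]add0r; apply: homLM; first exact: homL_gr_frac.
  by rewrite -divfunN -divdegN; exact: homL_divfun.
have fVL : homL G (divdeg D) (jF f / divfun D)^-1.
  have [a [x [wa x0 ->]]] := fL; rewrite invf_div -[divdeg D]add0r.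
  have [a0|a0] := eqVneq a 0; last by apply: homL_div => //; exact: hom_in.
  by rewrite a0 tofrac0 invr0 mulr0; exact: homL0.
have [|c wc cE] := locL_regular fL; first by move=> P; case: (fU P).
have [|d wd dE] := locL_regular fVL; first by move=> P; case: (fU P).
exists c; last by rewrite -cE divfK ?divfun_neq0.
apply/unitrPr; exists d; apply/eqP; rewrite -tofrac_eq tofracM tofrac1 -cE -dE.
by rewrite divff // fdiv_neq0 ?gr_frac_eq0 ?divfun_neq0.
Qed.

(** If f has divisor D, then [divfun D] is f up to a unit, so it is nonzero and homogeneous both of
    degree 0 and of degree [divdeg D]. Conversely, a [divfun D] of degree 0 comes from the fraction
    field of A. *)
Lemma principal_divdeg D : (D \in @principal A) = (divdeg D == 0).
Proof.
apply/asboolP/eqP => [[f fD]|D0].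
  have [c cU E] := is_div_unit fD; have c0 := unit_neq0 cU.
  have [f0 _] := fD.
  have : homL G (divdeg D) (jF f / c%:F).
    by rewrite E mulrC mulKf ?tofrac_eq0 //; exact: homL_divfun.
  move=> fL; have fL0 : homL G 0 (jF f / c%:F).
    rewrite -[0](gr_addww G 0); apply: homLM; first exact: homL_gr_frac.
    rewrite -[_^-1]mul1r -tofrac1 -[0](gr_addww G 0).
    by apply: homL_div => //; [exact: hom1 | exact: gr_hom_unit].
  have z0 : jF f / c%:F != 0 by rewrite fdiv_neq0 ?gr_frac_eq0 ?tofrac_eq0.
  have [a [x [wa x0 aE]]] := fL; have [b [y [wb y0 bE]]] := fL0.
  have [jx0 jy0] : (j x)%:F != 0 /\ (j y)%:F != 0 by rewrite !tofrac_eq0 !gr_in_eq0.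
  have E1 : a * j y = b * j x.
    by apply/eqP; rewrite -tofrac_eq !tofracM -eqr_div // -aE -bE.
  have a0 : a != 0 by apply: contraNneq z0 => a0; rewrite aE a0 tofrac0 mul0r.
  have ay0 : a * j y != 0 by rewrite mulf_neq0 // -tofrac_eq0.
  have := hom_deg_inj ay0 (gr_homM wa (hom_in G y)) (v := 0 + 0).
  by rewrite !addr0; apply; rewrite E1 -[0](gr_addww G 0); apply: gr_homM => //; exact: hom_in.
have [a [x [wa x0 E]]] := homL_divfun D.
move: wa; rewrite D0 => /gr_homE[y yE].
have fE : jF (y%:F / x%:F) = divfun D by rewrite gr_fracE // E yE.
exists (y%:F / x%:F); apply/is_div_divfun; split.
  by rewrite -(gr_frac_eq0 G) fE divfun_neq0.
by move=> P; rewrite fE divff ?divfun_neq0 // D0; exact: locU1.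
Qed.

Lemma divdeg_hom a : homogen G a -> a != 0 -> exists D, hom (divdeg D) a.
Proof.
move: a; apply: hprime_ind => [u uU|q a qP ha a0 [D wa]].
  by exists 0; rewrite divdeg0; exact: gr_hom_unit.
have [P [_ [[c pE] [d qE]]]] := hprime_primeDiv qP.
have [_ q0 _ _] := qP; have cdU : d \is a GRing.unit.
  apply/unitrPr; exists c; apply: (mulfI q0).
  by rewrite mulr1 mulrA mulrAC -pE -qE.
exists (<< P >> + D); rewrite divdegD /divdeg div_bigU => [|Q]; rewrite ?mulr0z ?mulr1z //.
apply: gr_homM => //; rewrite qE -[pdeg G P]addr0.
by apply: gr_homM; [exact: pdegP | exact: gr_hom_unit].
Qed.

Lemma divdeg_onto w : exists D, divdeg D = w.
Proof.
have [b [b' [wb wb' cop]]] := gr_coprime_pair G w.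
have [a wa a0] : exists2 a, hom w a & a != 0.
  have [b0|b0] := eqVneq b 0; last by exists b.
  exists b' => //; apply/eqP => b'0; have := cop 0.
  rewrite b0 b'0 => /(_ (divides0 _) (divides0 _)); by rewrite unitr0.
have [|D wD] := divdeg_hom _ a0; first by exists w.
by exists D; exact: hom_deg_inj wD wa.
Qed.

Definition class_deg (c : classGroup A) : W := divdeg (generic_quotient.repr c).

Lemma class_degE D : class_deg (divClass D) = divdeg D.
Proof.
apply/eqP; rewrite /class_deg -subr_eq0 (gr_oppw G) -divdegN -divdegD.
rewrite addrC -principal_divdeg Quotient.idealrBE /divClass.
by rewrite generic_quotient.reprK.
Qed.

Lemma class_deg_is_zmod_morphism : zmod_morphism class_deg.
Proof.
move=> c d; rewrite -[c]generic_quotient.reprK -[d]generic_quotient.reprK.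
set D := generic_quotient.repr c; set E := generic_quotient.repr d.
have -> : (\pi_(classGroup A) D - \pi_(classGroup A) E)%qT = divClass (D - E).
  by rewrite /divClass [RHS]raddfB.
by rewrite -!/(divClass _) !class_degE divdegD divdegN (gr_oppw G).
Qed.

HB.instance Definition _ := GRing.isZmodMorphism.Build
  (classGroup A) W class_deg class_deg_is_zmod_morphism.

Lemma class_deg_bij : bijective class_deg.
Proof.
have [g gK] : {g : W -> classGroup A & cancel g class_deg}.
  apply: (@choice _ _ (fun w c => class_deg c = w)) => w.
  by have [D Dw] := divdeg_onto w; exists (divClass D); rewrite class_degE.
exists g => // c; apply/eqP; rewrite -subr_eq0 -[_ - _]generic_quotient.reprK.
set D := generic_quotient.repr _.
have : D \in @principal A.
  rewrite principal_divdeg -class_degE /divClass generic_quotient.reprK.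
  by rewrite raddfB /= gK subrr.
rewrite -[D in D \in _]subr0 Quotient.idealrBE => /eqP ->.
by apply/eqP; exact: raddf0.
Qed.
End ClassGroup.


(** * The Cox ring *)

(* A homomorphism into a group closed under square roots extends along an     *)
(* extension of exponent two.                                                 *)
Lemma hom_extension (M : zmodType) (L : fieldType) (U : L -> Prop)
    (H : M -> Prop) (c : M -> L) (gens : seq M) :
  (forall z t, U z -> U t -> U (z * t)) ->
  (forall z, U z -> exists2 t, U t & t ^+ 2 = z) ->
  H 0 -> (forall x y, H x -> H y -> H (x - y)) ->
  (forall x, H x -> U (c x)) ->
  (forall x y, H x -> H y -> c (x + y) = c x * c y) ->
  (forall g, g \in gens -> H (g + g)) ->
  exists (H' : M -> Prop) c', [/\ forall x, H x -> H' x,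
      forall x y, H' x -> H' y -> H' (x - y), forall g, g \in gens -> H' g &
      forall x, H x -> c' x = c x] /\
    [/\ forall x, H' x -> U (c' x) &
      forall x y, H' x -> H' y -> c' (x + y) = c' x * c' y].
Proof.
move=> UM Usq; elim: gens H c => [|g gens IH] H c H0 HB HU cM Hg.
  by exists H, c.
have HN x : H x -> H (- x) by rewrite -sub0r; exact: HB.
have HD x y : H x -> H y -> H (x + y).
  by move=> Hx Hy; rewrite -[y]opprK; apply: HB => //; exact: HN.
have HNE x y : H x -> H (x + y) -> H y.
  by move=> Hx Hxy; rewrite -(addKr x y); apply: HD => //; exact: HN.
have Hgg : H (g + g) by apply: Hg; rewrite mem_head.
(* As [g + g] is in H, adjoining g gives the union of H and one translate. The value at g is a
   square root v of the value at [g + g]; if g is already in H, the branch with v does not occur on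
   H1. *)
pose H1 x := H x \/ H (x - g).
have [v Uv vE] := Usq _ (HU _ Hgg).
pose c1 x := if `[< H x >] then c x else c (x - g) * v.
have sum2 x y : x + y = (x - g) + (y - g) + (g + g) by rewrite addrACA !subrK.
have HBgN x : H (x - g) -> H (- x - g).
  move=> Hx; rewrite (_ : - x - g = - (x - g) - (g + g)); first exact: HB (HN _ Hx) Hgg.
  by rewrite opprB opprD addrA [g - x]addrC addrK.
have H1D x y : H1 x -> H1 y -> H1 (x + y).
  move=> [Hx|Hx] [Hy|Hy]; [left|right|right|left].
  - exact: HD.
  - by rewrite -addrA; exact: HD.
  - by rewrite addrAC; exact: HD.
  - by rewrite sum2; exact: HD (HD _ _ Hx Hy) Hgg.
have H1B x y : H1 x -> H1 y -> H1 (x - y).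
  move=> Hx Hy; apply: H1D => //; case: Hy => Hy; [left; exact: HN|right; exact: HBgN].
have c1U x : H1 x -> U (c1 x).
  move=> H1x; rewrite /c1; case: asboolP => Hx; first exact: HU.
  by case: H1x => // Hxg; apply: UM => //; exact: HU.
have c1M x y : H1 x -> H1 y -> c1 (x + y) = c1 x * c1 y.
  move=> H1x H1y; rewrite /c1; case: asboolP => Hxy; case: asboolP => Hx;
    case: asboolP => Hy; first exact: cM.
  + by case: Hy; exact: HNE Hxy.
  + by case: Hx; move: Hxy; rewrite addrC; exact: HNE.
  + case: H1x => // Hxg; case: H1y => // Hyg.
    by rewrite sum2 (cM _ _ (HD _ _ Hxg Hyg) Hgg) cM // -vE expr2 mulrACA.
  + by case: Hxy; exact: HD.
  + by case: H1y => // Hyg; rewrite -addrA (cM _ _ Hx Hyg) mulrA.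
  + by case: H1x => // Hxg; rewrite addrAC (cM _ _ Hxg Hy) mulrAC.
  + case: H1x => // Hxg; case: H1y => // Hyg; case: Hxy.
    by rewrite sum2; exact: HD (HD _ _ Hxg Hyg) Hgg.
have H1g k : k \in gens -> H1 (k + k).
  by move=> kg; left; apply: Hg; rewrite inE kg orbT.
have [H' [c' [[HH' H'B H'g H'c] [c'U c'M]]]] :=
  IH H1 c1 (or_introl H0) H1B c1U c1M H1g.
exists H', c'; split; split=> // [x Hx|k|x Hx].
- by apply: HH'; left.
- rewrite inE => /orP[/eqP->|/H'g//]; apply: HH'; right; by rewrite subrr.
- rewrite H'c; last by left.
  by rewrite /c1 asboolT.
Qed.


Section CoxRingOfGrading.
Variables (A S : idomainType) (W : finZmodType) (G : grading A S W).
Variable K : coxData A.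
Local Notation hom := (gr_hom G).
Local Notation j := (gr_in G).
Local Notation "x %:F" := (tofrac x).
Local Notation F := {fraction A}.
Local Notation L := {fraction S}.
Local Notation Div := (weilDiv A).
Local Notation GA := (grpAlg F Div).
Local Notation jF := (gr_frac G).
Local Notation locL := (locL G).
Local Notation homL := (homL G).
Local Notation divdeg := (divdeg G).
Local Notation divfun := (divfun G).
Implicit Types (p : spec A) (w : W) (P : primeDiv A) (D E : Div) (x y : GA).

(* [coxw D] is the value at which X^D is evaluated: the unit by which it      *)
(* differs from [divfun D] turns [cox_chi] into a homomorphism on all of K.   *)
Lemma cox_weight_exists : exists wt : Div -> L,
  [/\ forall D E, coxK K D -> coxK K E -> wt (D + E) = wt D * wt E,
      forall E, coxK0 K E -> wt E = jF (cox_chi K E) &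
      forall D, coxK K D -> exists2 c, c \is a GRing.unit & wt D = c%:F * divfun D].
Proof.
pose U z := exists2 c : S, c \is a GRing.unit & z = c%:F.
(* This unit is multiplicative on K0, and K0 contains 2K because W is killed by 2; so
   [hom_extension] extends it to all of K. *)
pose c0 E := jF (cox_chi K E) / divfun E.
have c0U E : coxK0 K E -> U (c0 E).
  move=> [KE E0]; have [c cU E1] := is_div_unit G (cox_chi_div KE E0).
  by exists c => //; rewrite /c0 E1 mulfK // divfun_neq0.
have UM z t : U z -> U t -> U (z * t).
  by move=> [c cU ->] [d dU ->]; exists (c * d); rewrite ?unitrM ?cU ?tofracM.
have Usq z : U z -> exists2 t, U t & t ^+ 2 = z.
  move=> [c cU ->]; have [d dE] := gr_unit_sqrt G cU.
  exists d%:F; last by rewrite -dE tofracXn.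
  by exists d => //; rewrite -(unitrX_pos _ (isT : 0 < 2)%N) dE.
have K00 : coxK0 K 0 by split; [exact: coxK_0 | exact: rpred0].
have K0B D E : coxK0 K D -> coxK0 K E -> coxK0 K (D - E).
  by move=> [KD D0] [KE E0]; split; [exact: coxKB | exact: rpredB].
have c0M D E : coxK0 K D -> coxK0 K E -> c0 (D + E) = c0 D * c0 E.
  move=> [KD D0] [KE E0].
  by rewrite /c0 cox_chiM // rmorphM /= divfunD invfM mulrACA.
have gensK g : g \in cox_gens K -> coxK K g.
  move=> /tnthP[i ->]; exists [ffun k => (k == i)%:Z].
  rewrite (bigD1 i) //= ffunE eqxx mulr1z big1 ?addr0 => [|k /negPf ki].
    by rewrite (tnth_nth 0).
  by rewrite ffunE ki mulr0z.
have gens2 g : g \in cox_gens K -> coxK0 K (g + g).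
  move=> /gensK Kg; split; first exact: coxKD.
  by rewrite (principal_divdeg G) divdegD (gr_addww G).
have [H [c [[K0H HB Hg cE] [cU cM]]]] :=
  hom_extension UM Usq K00 K0B c0U c0M gens2.
have H0 : H 0 by exact: K0H.
have HD D E : H D -> H E -> H (D + E).
  move=> HD' HE; rewrite -[E]opprK; apply: (HB) => //; rewrite -sub0r.
  exact: HB.
have KH D : coxK K D -> H D.
  move=> [a ->]; elim/big_ind: _ => // i _.
  have Hi : H (cox_gens K)`_i by apply: Hg; rewrite mem_nth // size_tuple.
  have HX n : H ((cox_gens K)`_i *+ n).
    by elim: n => [|n IH] //; rewrite mulrS; exact: HD.
  case: (a i) => n; first exact: HX.
  by rewrite NegzE mulrNz -sub0r; apply: HB => //; exact: HX.
exists (fun D => c D * divfun D); split=> [D E /KH HD1 /KH HE|E KE|D /KH/cU[d dU ->]].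
- by rewrite cM // divfunD mulrACA.
- by rewrite cE // divfK // divfun_neq0.
- by exists d.
Qed.

Definition coxw : Div -> L := sval (cid cox_weight_exists).

Lemma coxwD D E : coxK K D -> coxK K E -> coxw (D + E) = coxw D * coxw E.
Proof. by rewrite /coxw; case: cid => wt [H _ _] /=; exact: H. Qed.

Lemma coxw_chi E : coxK0 K E -> coxw E = jF (cox_chi K E).
Proof. by rewrite /coxw; case: cid => wt [_ H _] /=; exact: H. Qed.

Lemma coxw_unit D : coxK K D ->
  exists2 c, c \is a GRing.unit & coxw D = c%:F * divfun D.
Proof. by rewrite /coxw; case: cid => wt [_ _ H] /=; exact: H. Qed.

Lemma coxw_neq0 D : coxK K D -> coxw D != 0.
Proof.
move=> /coxw_unit[c cU ->]; rewrite mulf_neq0 ?divfun_neq0 ?tofrac_eq0 //.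
exact: unit_neq0.
Qed.

Lemma coxw0 : coxw 0 = 1.
Proof.
have K0 := coxK_0 K; apply: (mulfI (coxw_neq0 K0)).
by rewrite -coxwD // addr0 mulr1.
Qed.

(** ** Evaluation of the group algebra *)

Definition cox_eval x : L := div_big +%R (fun D c => jF c * coxw D) x.

Definition cox_eval_at w x : L :=
  div_big +%R (fun D c => if divdeg D == w then jF c * coxw D else 0) x.

Lemma cox_evalD x y : cox_eval (x + y) = cox_eval x + cox_eval y.
Proof. by apply: div_bigD => [D|D c d]; rewrite ?rmorph0 ?mul0r // rmorphD mulrDl. Qed.

Lemma cox_evalU c D : cox_eval (gmon c D) = jF c * coxw D.
Proof. by apply: div_bigU => E; rewrite rmorph0 mul0r. Qed.

Lemma cox_eval0 : cox_eval 0 = 0. Proof. exact: div_big0. Qed.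

Lemma cox_evalB x y : cox_eval (x - y) = cox_eval x - cox_eval y.
Proof. by have := cox_evalD (x - y) y; rewrite subrK => ->; rewrite addrK. Qed.

Lemma cox_eval_sum I (r : seq I) (Q : pred I) (E : I -> GA) :
  cox_eval (\sum_(i <- r | Q i) E i) = \sum_(i <- r | Q i) cox_eval (E i).
Proof. by apply: big_morph; [exact: cox_evalD | exact: cox_eval0]. Qed.

Lemma cox_eval1 : cox_eval 1 = 1.
Proof. by rewrite -gmon10 cox_evalU rmorph1 mul1r coxw0. Qed.

Lemma cox_evalM x y : (forall D, D \in dom x -> coxK K D) ->
  (forall D, D \in dom y -> coxK K D) -> cox_eval (x * y) = cox_eval x * cox_eval y.
Proof.
move=> xK yK; rewrite -[x](@freeg_sumE F Div) -[y](@freeg_sumE F Div).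
rewrite mulr_suml !cox_eval_sum mulr_suml big_seq [RHS]big_seq.
apply: eq_bigr => D /xK KD; rewrite mulr_sumr cox_eval_sum mulr_sumr.
rewrite big_seq [RHS]big_seq; apply: eq_bigr => E /yK KE.
rewrite -/(gmon _ D) -/(gmon _ E) gmonM !cox_evalU rmorphM coxwD //.
by rewrite mulrACA.
Qed.

Lemma coxwN D : coxK K D -> coxw (- D) = (coxw D)^-1.
Proof.
move=> KD; apply: (mulfI (coxw_neq0 KD)); rewrite divff ?coxw_neq0 //.
by rewrite -coxwD ?subrr ?coxw0 //; exact: coxKN.
Qed.

Lemma cox_eval_chi_rel x : chi_rel K x -> cox_eval x = 0.
Proof.
move=> [E KE ->]; have [KE1 _] := KE.
rewrite cox_evalB cox_eval1 cox_evalU coxwN // -coxw_chi // divff ?subrr //.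
exact: coxw_neq0.
Qed.

Lemma sheafS_coxK h x D : sheafS K h x -> D \in dom x -> coxK K D.
Proof. by move=> xS /xS[]. Qed.

Lemma chi_rel_coxK x D : chi_rel K x -> D \in dom x -> coxK K D.
Proof.
have KU c E : coxK K E -> forall D', D' \in dom (gmon c E) -> coxK K D'.
  move=> KE D'; rewrite mem_dom coeffU; case: (E =P D') => [<- //|_].
  by rewrite mulr0 eqxx.
move=> [E [KE _] ->] /domB; rewrite mem_cat => /orP[]; rewrite -?gmon10.
  exact: KU (coxK_0 K) _.
exact: KU (coxKN KE) _.
Qed.

Lemma cox_eval_ideal h x : ideal_gen (sheafS K h) (chi_rel K) x -> cox_eval x = 0.
Proof.
move=> [n [a [g [Sa Gg ->]]]]; rewrite cox_eval_sum big1 // => i _.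
rewrite cox_evalM => [|D|D]; first by rewrite (cox_eval_chi_rel (Gg i)) mulr0.
  exact: sheafS_coxK (Sa i).
exact: chi_rel_coxK (Gg i).
Qed.

Lemma cox_eval_stalkI p x : stalkI K p x -> cox_eval x = 0.
Proof. by move=> [h _]; exact: cox_eval_ideal. Qed.

Lemma cox_eval_atE x : cox_eval x = \sum_w cox_eval_at w x.
Proof.
rewrite /cox_eval_at /div_big exchange_big; apply: eq_bigr => D _ /=.
by rewrite (bigD1 (divdeg D)) //= eqxx big1 ?addr0 // => w /negPf; rewrite eq_sym => ->.
Qed.

Lemma cox_eval_at_term w h x D : sheafS K h x -> D \in dom x -> divdeg D = w ->
  homL w (jF (coeff D x) * coxw D) /\
  forall P, ~~ P h -> locL P w (jF (coeff D x) * coxw D).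
Proof.
move=> xS /xS[KD OD] <-; have [c cU ->] := coxw_unit KD; split=> [|P Ph].
  rewrite -[divdeg D]add0r; apply: homLM; first exact: homL_gr_frac.
  rewrite -[divdeg D]add0r; apply: homLM; last exact: homL_divfun.
  exact: (@locL_tofrac _ _ _ G (generic_point A) 0 c (gr_hom_unit G cU)).
rewrite mulrCA -[divdeg D]add0r; apply: locLM; last by move/(sheafO_divfun G): OD; exact.
by apply: locL_tofrac; exact: gr_hom_unit.
Qed.

Lemma homL_cox_eval_at w h x : sheafS K h x -> homL w (cox_eval_at w x).
Proof.
move=> xS; rewrite /cox_eval_at /div_big big_seq.
apply: (@locL_sum _ _ _ G (generic_point A)) => D Dx; case: eqP => [Dw|_].
  by have [] := cox_eval_at_term xS Dx Dw.
exact: homL0.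
Qed.

Lemma locL_cox_eval_at w h x P : sheafS K h x -> ~~ P h -> locL P w (cox_eval_at w x).
Proof.
move=> xS Ph; rewrite /cox_eval_at /div_big big_seq; apply: locL_sum => D Dx.
case: eqP => [Dw|_]; last exact: locL0.
by have [_] := cox_eval_at_term xS Dx Dw; apply.
Qed.

Lemma cox_rep_exists w : exists D, coxK K D /\ divdeg D = w.
Proof.
have [E Ew] := divdeg_onto G w; have [D KD DE] := cox_onto K (divClass E).
by exists D; split=> //; rewrite -(class_degE G) DE class_degE.
Qed.

Lemma ideal_gen_sum (R : comNzRingType) (S' gens : R -> Prop) (I : eqType)
    (r : seq I) (E : I -> R) :
  (forall i, i \in r -> ideal_gen S' gens (E i)) ->
  ideal_gen S' gens (\sum_(i <- r) E i).
Proof.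
move=> EI; rewrite big_seq; elim/big_rec: _ => [|i x ir xI]; first exact: ideal_gen0.
by apply: ideal_genD => //; exact: EI.
Qed.

(* Modulo the ideal every X^D can be moved to a fixed representative of the   *)
(* class of D.                                                                *)
Lemma cox_eval_ker h x : sheafS K h x -> cox_eval x = 0 ->
  ideal_gen (sheafS K h) (chi_rel K) x.
Proof.
move=> xS; rewrite cox_eval_atE => x0.
have {}x0 := homL_eq0 (fun w => homL_cox_eval_at w xS) x0.
have [d dP] : {d : W -> Div & forall w, coxK K (d w) /\ divdeg (d w) = w}.
  exact: choice cox_rep_exists.
pose e D := D - d (divdeg D).
have eK D : coxK K D -> coxK0 K (e D).
  move=> KD; have [Kd dd] := dP (divdeg D); split; first exact: coxKB.
  by rewrite (principal_divdeg G) divdegD divdegN dd (gr_addww G).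
pose t D := gmon (coeff D x * cox_chi K (e D)) (d (divdeg D)).
(* In each degree w all terms now sit at the same divisor [d w]; the value of their sum is the
   component of degree w of the value of x, which is 0. *)
have st : \sum_(D <- dom x) t D = 0.
  rewrite (partition_big divdeg xpredT) //= big1 // => w _.
  pose g := \sum_(D <- dom x | divdeg D == w) coeff D x * cox_chi K (e D).
  rewrite (_ : \sum_(_ <- _ | _) _ = gmon g (d w)).
    suff -> : g = 0 by rewrite /gmon freegU0.
    have [Kd dd] := dP w; apply/eqP; rewrite -(gr_frac_eq0 G) -(mulIr_eq0 _ (mulIf (coxw_neq0 Kd))).
    apply/eqP; rewrite -[RHS](x0 w) /cox_eval_at /div_big rmorph_sum mulr_suml.
    rewrite -big_mkcond /= big_seq_cond [RHS]big_seq_cond.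
    apply: eq_bigr => D /andP[Dx /eqP Dw]; have KD := sheafS_coxK xS Dx.
    rewrite rmorphM -mulrA /= -coxw_chi; last exact: eK.
    rewrite -coxwD //; last by case: (eK D KD).
    by rewrite /e Dw subrK.
  rewrite /g; elim: (dom x) => [|D r IH]; first by rewrite !big_nil /gmon freegU0.
  rewrite !big_cons; case: eqP => [Dw|_]; last exact: IH.
  by rewrite gmonD IH /t Dw.
have -> : x = \sum_(D <- dom x) (gmon (coeff D x) D - t D).
  by rewrite sumrB st subr0 [RHS](@freeg_sumE F Div).
apply: ideal_gen_sum => D Dx; have [KD OD] := xS D Dx.
rewrite (_ : _ - t D = gmon (coeff D x) D * (1 - gmon (cox_chi K (e D)) (- e D))).
  exists 1%N, (fun=> gmon (coeff D x) D), (fun=> 1 - gmon (cox_chi K (e D)) (- e D)).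
  split; last by rewrite big_ord1.
    by move=> _; exact: sheafS_gmon.
  by move=> _; exists (e D) => //; exact: eK.
by rewrite mulrBr mulr1 gmonM opprB [D + _]addrC subrK.
Qed.
End CoxRingOfGrading.


(** * The Cox ring as a subring of the fraction field of S *)

Section CoxRingPresentation.
Variables (A S : idomainType) (W : finZmodType) (G : grading A S W).
Local Notation hom := (gr_hom G).
Local Notation j := (gr_in G).
Local Notation "x %:F" := (tofrac x).
Local Notation F := {fraction A}.
Local Notation L := {fraction S}.
Local Notation Div := (weilDiv A).
Local Notation GA := (grpAlg F Div).
Local Notation jF := (gr_frac G).
Local Notation locL := (locL G).
Local Notation homL := (homL G).
Local Notation divdeg := (divdeg G).
Local Notation divfun := (divfun G).
Implicit Types (p : spec A) (w : W) (P : primeDiv A) (D E : Div) (x y : GA).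

Section Values.
Variable K : coxData A.
Local Notation ev := (cox_eval G K).
Local Notation ev_at := (cox_eval_at G K).

Definition section_val (s : coxSection K) : L := ev (s (generic_point A)).

Lemma section_local (deg : Div -> Prop) (s : spec A -> GA) p :
  is_quot_section K deg s -> exists h x, [/\ ~~ p h, sheafS K h x,
    forall D, D \in dom x -> deg D & forall q : spec A, ~~ q h -> ev (s q) = ev x].
Proof.
move=> /(_ p)[h [x [ph xS xdeg sx]]]; exists h, x; split=> // q qh.
have /(cox_eval_stalkI G) := sx q qh.
by rewrite cox_evalB => /eqP; rewrite subr_eq0 => /eqP.
Qed.

Lemma generic_notin p (h : A) : ~~ p h -> ~~ generic_point A h.
Proof. by move=> ph; rewrite -[_ h]/(h == 0) -tofrac_eq0 (spec_neq0 ph). Qed.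

(** The generic point lies in every nonempty principal open set, so the values at all points agree
    with the generic one. *)
Lemma section_germ (s : coxSection K) p : ev (s p) = section_val s.
Proof.
case: s => s sP; have /(section_local p)[h [x [ph _ _ E]]] := asboolP _ sP.
by rewrite /section_val /= !E //; exact: generic_notin ph.
Qed.

Lemma section_stalk (s : coxSection K) p : exists2 h, ~~ p h & sheafS K h (s p).
Proof. by case: s => s sP; exact: cox_section_stalkS. Qed.

Lemma section_germsB (s t : coxSection K) p : (s - t) p = s p - t p.
Proof. reflexivity. Qed.

Lemma section_germsM (s t : coxSection K) p : (s * t) p = s p * t p.
Proof. reflexivity. Qed.

Lemma section_valB s t : section_val (s - t) = section_val s - section_val t.
Proof. by rewrite /section_val section_germsB cox_evalB. Qed.

Lemma section_valM s t : section_val (s * t) = section_val s * section_val t.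
Proof.
have [h _ sS] := section_stalk s (generic_point A).
have [k _ tS] := section_stalk t (generic_point A).
rewrite /section_val section_germsM cox_evalM // => D.
- exact: sheafS_coxK sS.
- exact: sheafS_coxK tS.
Qed.

Lemma section_val_null (s : coxSection K) : s \in @cox_null A K <-> section_val s = 0.
Proof.
split=> [/asboolP/(_ (generic_point A))/(cox_eval_stalkI G)//|s0].
apply/asboolP => p; have [h ph sS] := section_stalk s p.
by exists h => //; apply: (cox_eval_ker sS (G := G)); rewrite section_germ.
Qed.

(** Near each height one prime the components of the value are those of a local section, hence
    regular there; by [locL_regular] they lie in S. *)
Lemma section_regular (deg : Div -> Prop) (s : coxSection K) :
  is_quot_section K deg s ->
  exists a : W -> S, [/\ forall w, hom w (a w), section_val s = \sum_w (a w)%:F &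
    forall w, (forall D, deg D -> divdeg D != w) -> a w = 0].
Proof.
move=> sdeg; have [h0 _ s0S] := section_stalk s (generic_point A).
pose z w := ev_at w (s (generic_point A)).
have zh w : homL w (z w) by exact: homL_cox_eval_at s0S.
have zE p : exists h x, [/\ ~~ p h, sheafS K h x,
    forall D, D \in dom x -> deg D & forall w, z w = ev_at w x].
  have [h [x [ph xS xdeg sx]]] := section_local p sdeg; exists h, x; split=> // w.
  apply/eqP; rewrite -subr_eq0; apply/eqP; move: w.
  apply: (@homL_eq0 _ _ _ G) => [w|].
    by apply: (@locLB _ _ _ G (generic_point A)); [exact: zh | exact: homL_cox_eval_at xS].
  rewrite sumrB -!cox_eval_atE sx ?subrr //.
  exact: generic_notin ph.
have zL w P : locL P w (z w).
  by have [h [x [Ph xS _ ->]]] := zE P; exact: locL_cox_eval_at xS Ph.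
have [a aP] : {a : W -> S & forall w, hom w (a w) /\ z w = (a w)%:F}.
  apply: (@choice _ _ (fun w s => hom w s /\ z w = s%:F)) => w.
  by have [b wb bE] := locL_regular (zh w) (zL w); exists b.
exists a; split=> [w||w degw]; first by case: (aP w).
  by rewrite /section_val cox_eval_atE; apply: eq_bigr => w _; case: (aP w).
apply/eqP; rewrite -tofrac_eq0; have [_ <-] := aP w.
have [h [x [_ _ xdeg ->]]] := zE (generic_point A).
rewrite /cox_eval_at /div_big big_seq big1 // => D /xdeg/degw.
by move=> /negPf->.
Qed.

Lemma const_section_val a : section_val (CoxSection (const_section_subproof K a)) = (j a)%:F.
Proof.
rewrite /section_val /= cox_evalU coxw0 mulr1 -[a%:F]divr1 -tofrac1.
by rewrite gr_fracE ?oner_neq0 // rmorph1 tofrac1 divr1.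
Qed.

(** The section is f X^D with D in K of class c and f = b / [coxw D], a fraction of degree 0. *)
Lemma section_of_hom w (b : S) (c : classGroup A) : hom w b -> class_deg G c = w ->
  exists2 s : coxSection K, is_quot_section K (fun D => divClass D = c) s &
    section_val s = b%:F.
Proof.
move=> wb cw; have [D KD Dc] := cox_onto K c.
have Dw : divdeg D = w by rewrite -class_degE Dc.
have [u uU uE] := coxw_unit G KD.
have uF0 : u%:F != 0 by rewrite tofrac_eq0 unit_neq0.
have D0 : divfun D != 0 := divfun_neq0 G D.
have [d [x [wd x0 dE]]] := homL_divfun G D.
have d0 : d != 0.
  by apply: contraNneq D0 => d0; rewrite dE d0 tofrac0 mul0r.
have jx0 : j x != 0 by rewrite gr_in_eq0.
have [f fE] : exists f, jF f = b%:F / coxw G K D.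
  have : homL 0 (b%:F / coxw G K D).
    have -> : b%:F / coxw G K D = (b * j x)%:F / (u * d)%:F.
      by rewrite uE dE !tofracM mulrA invf_div mulrA.
    rewrite -[0](gr_addww G w); apply: homL_div.
    - by rewrite mulf_neq0 // unit_neq0.
    - by rewrite -[w]addr0; apply: gr_homM => //; exact: hom_in.
    - by rewrite -Dw -[divdeg D]add0r; apply: gr_homM => //; exact: gr_hom_unit.
  move=> [a [y [/gr_homE[z ->] y0 ->]]]; exists (z%:F / y%:F).
  by rewrite gr_fracE.
have fS h : sheafS K h (gmon f D).
  apply: sheafS_gmon => //; apply/(sheafO_divfun G) => P _.
  suff -> : jF f * divfun D = (b / u)%:F.
    apply: locL_tofrac; rewrite Dw -[w]addr0; apply: gr_homM => //.
    by apply: gr_hom_unit; rewrite unitrV.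
  rewrite fE uE invfM mulrA divfK //; apply: (canLR (mulfK uF0)).
  by rewrite -tofracM divrK.
have sP deg : deg D -> is_quot_section K deg (fun=> gmon f D).
  move=> degD p; exists 1, (gmon f D); split=> //; first exact: spec1.
    move=> E; rewrite mem_dom coeffU; case: (D =P E) => [<- //|_].
    by rewrite mulr0 eqxx.
  by move=> q _; rewrite subrr; exact: stalkI0.
have sP1 : cox_section K (fun=> gmon f D) by apply/asboolP; exact: sP.
exists (CoxSection sP1); first exact: sP.
by rewrite /section_val /= cox_evalU fE divfK // coxw_neq0.
Qed.

Definition cox_val (y : coxRing K) : L := section_val (generic_quotient.repr y).

Lemma cox_valE (s : coxSection K) :
  cox_val (\pi_({ideal_quot @cox_null A K}) s)%qT = section_val s.
Proof.
apply/eqP; rewrite /cox_val -subr_eq0 -section_valB; apply/eqP/section_val_null.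
by rewrite Quotient.idealrBE generic_quotient.reprK.
Qed.

Lemma cox_val_is_zmod_morphism : zmod_morphism cox_val.
Proof.
move=> y z; rewrite -[y]generic_quotient.reprK -[z]generic_quotient.reprK.
by rewrite -[X in cox_val X]raddfB !cox_valE section_valB.
Qed.

Lemma cox_val_is_monoid_morphism : monoid_morphism cox_val.
Proof.
split=> [|y z].
  have -> : (1 : coxRing K) = (\pi_({ideal_quot @cox_null A K}) 1)%qT by rewrite rmorph1.
  by rewrite cox_valE; exact: cox_eval1.
rewrite -[y]generic_quotient.reprK -[z]generic_quotient.reprK.
by rewrite -[X in cox_val X]rmorphM !cox_valE section_valM.
Qed.

HB.instance Definition _ := GRing.isZmodMorphism.Build
  (coxRing K) L cox_val cox_val_is_zmod_morphism.
HB.instance Definition _ := GRing.isMonoidMorphism.Build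
  (coxRing K) L cox_val cox_val_is_monoid_morphism.

Lemma cox_val_inj : injective cox_val.
Proof.
apply: raddf_inj => y /section_val_null; rewrite -[y in y = _]generic_quotient.reprK.
rewrite -[X in X \in _]subr0 Quotient.idealrBE => /eqP->.
by rewrite rmorph0.
Qed.
End Values.

(** One divisor per degree generates K, and chi(E) can be [divfun E] itself, which is multiplicative
    in E. *)
Lemma coxData_exists : inhabited (coxData A).
Proof.
have [d dP] : {d : W -> Div & forall w, divdeg (d w) = w}.
  exact: choice (divdeg_onto G).
pose gens := [tuple d (enum_val i) | i < #|W|].
have gensE (i : 'I_#|W|) : gens`_i = d (enum_val i).
  by rewrite -tnth_nth tnth_mktuple.
have [f fE] : {f : Div -> F & forall E, E \in @principal A -> jF (f E) = divfun E}.
  apply: (@choice _ _ (fun E f => E \in @principal A -> jF f = divfun E)) => E.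
  have [E0|E0] := boolP (E \in @principal A); last by exists 0.
  have [a [x [wa x0 aE]]] := homL_divfun G E.
  move: E0 wa; rewrite (principal_divdeg G) => /eqP-> /gr_homE[y yE].
  by exists (y%:F / x%:F) => _; rewrite gr_fracE // aE yE.
have gens_onto (c : classGroup A) : exists2 D, inIntSpan gens D & divClass D = c.
  exists (d (class_deg G c)).
    exists [ffun i => (i == enum_rank (class_deg G c))%:Z].
    rewrite (bigD1 (enum_rank (class_deg G c))) // big1 ?addr0 => [|i /negPf ki].
      by rewrite ffunE eqxx mulr1z gensE enum_rankK /= addr0.
    by rewrite ffunE ki mulr0z.
  by apply: (bij_inj (class_deg_bij G)); rewrite class_degE dP.
have div_f E : inIntSpan gens E -> E \in @principal A -> is_div (f E) E.
  move=> _ E0; apply/(is_div_divfun G); split.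
    by rewrite -(gr_frac_eq0 G) fE // divfun_neq0.
  move=> P; rewrite fE // divff ?divfun_neq0 //.
  by move: E0; rewrite (principal_divdeg G) => /eqP->; exact: locU1.
have fM E E' : inIntSpan gens E -> E \in @principal A -> inIntSpan gens E' ->
    E' \in @principal A -> f (E + E') = f E * f E'.
  move=> _ E0 _ E'0; apply: (@gr_frac_inj _ _ _ G).
  by rewrite rmorphM /= !fE ?divfunD // rpredD.
by constructor; exact: (CoxData gens_onto div_f fM).
Qed.

(** Through the embedding [cox_val], generation, relations and degrees in the Cox ring can all be
    checked on a parametrisation with values in S. *)
Lemma cox_presentation_of_grading (C : fieldType) (iota : C -> A) (r : nat)
    (Q : 'I_r -> W) (rels : seq {mpoly C[r]}) (ev : {rmorphism {mpoly C[r]} -> S}) :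
  (forall c, ev c%:MP = j (iota c)) ->
  (forall i, hom (Q i) (ev 'X_i)) ->
  (forall p : {mpoly C[r]}, ev p = 0 <-> ideal_gen (fun=> True) (fun g => g \in rels) p) ->
  (forall w b, hom w b -> exists p : {mpoly C[r]}, ev p = b) ->
  cox_presentation iota Q rels.
Proof.
move=> evC evX ev_ker ev_onto0.
have wX (m : 'X_{1..r}) : hom (\sum_(i < r) Q i *+ m i) (ev 'X_[m]).
  rewrite mpolyXE_id rmorph_prod; elim/big_ind2: _ => [|w a v b|i _].
  - exact: hom1.
  - exact: gr_homM.
  rewrite rmorphXn /=; elim: (m i) => [|k IH]; first exact: hom1.
  by rewrite exprS mulrS; exact: gr_homM.
have ev_hom w (p : {mpoly C[r]}) : whomog Q w p -> hom w (ev p).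
  move=> wp; rewrite [p]mpolyE rmorph_sum /= big_seq; apply: hom_sum => m /wp <-.
  rewrite -mul_mpolyC rmorphM /= evC -[X in hom X _]add0r.
  by apply: gr_homM => //; exact: hom_in.
(* A preimage can be made homogeneous by keeping its terms of weight w: the other parts map to other
   degrees and cancel by directness. *)
have ev_onto w b : hom w b -> exists2 p : {mpoly C[r]}, whomog Q w p & ev p = b.
  move=> wb; have [p pE] := ev_onto0 w b wb.
  pose part v := \sum_(m <- msupp p | \sum_(i < r) Q i *+ m i == v) p@_m *: 'X_[m].
  have part_hom v : whomog Q v (part v).
    move=> m /msupp_sum_le/flattenP[t /mapP[k]]; rewrite mem_filter => /andP[/eqP <- _] ->.
    by move=> /msuppZ_le; rewrite msuppX inE => /eqP->.
  have pS : \sum_v part v = p.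
    by rewrite [RHS]mpolyE [RHS](partition_big (fun m : 'X_{1..r} => \sum_(i < r) Q i *+ m i) xpredT).
  exists (part w) => //; apply/eqP; rewrite -subr_eq0; apply/eqP.
  pose a v := ev (part v) - if v == w then b else 0.
  have -> : ev (part w) - b = a w by rewrite /a eqxx.
  apply: (gr_hom_direct (g := G)) => [v|].
    apply: gr_homB; first exact/ev_hom/part_hom.
    by case: eqP => [->|_] //; exact: gr_hom0.
  rewrite sumrB -rmorph_sum pS pE (bigD1 w) //= eqxx big1 ?addr0 ?subrr // => v /negPf->.
  by [].
exists (class_deg G); split.
- exact: class_deg_bij.
- exact: coxData_exists.
move=> K.
(* The image of p has to be the element of value [ev p]. It is constructed for single terms;
   injectivity of [cox_val] then makes the choice a ring homomorphism. *)
have psi_ex (p : {mpoly C[r]}) : exists y : coxRing K, cox_val y = (ev p)%:F.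
  rewrite [p]mpolyE; elim/big_ind: _ => [|p1 p2 [y1 E1] [y2 E2]|m _].
  - by exists 0; rewrite !rmorph0.
  - by exists (y1 + y2); rewrite rmorphD /= E1 E2 (rmorphD ev) tofracD.
  have [f fK gf] := class_deg_bij G.
  have [|s _ sE] := @section_of_hom K (\sum_(i < r) Q i *+ m i)
    (ev (p@_m *: 'X_[m])) (f (\sum_(i < r) Q i *+ m i)) _ (gf _).
    by apply: ev_hom => m' /msuppZ_le; rewrite msuppX inE => /eqP->.
  by exists (\pi_({ideal_quot @cox_null A K}) s)%qT; rewrite cox_valE.
have [psi psiE] := choice psi_ex.
have psiB : zmod_morphism psi.
  by move=> p q; apply: cox_val_inj; rewrite rmorphB /= !psiE rmorphB tofracB.
have psiM : monoid_morphism psi.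
  split=> [|p q]; apply: cox_val_inj; first by rewrite rmorph1 psiE rmorph1 tofrac1.
  by rewrite rmorphM /= !psiE rmorphM tofracM.
pose psi_mixin := GRing.isZmodMorphism.Build _ _ psi psiB.
pose psi_mixin' := GRing.isMonoidMorphism.Build _ _ psi psiM.
pose PSI : {rmorphism {mpoly C[r]} -> coxRing K} := HB.pack psi psi_mixin psi_mixin'.
have val_onto (y : coxRing K) (deg : Div -> Prop) (s : coxSection K) :
  is_quot_section K deg s -> y = (\pi_({ideal_quot @cox_null A K}) s)%qT ->
  exists a : W -> S, [/\ forall w, hom w (a w), cox_val y = \sum_w (a w)%:F &
    forall w, (forall D, deg D -> divdeg D != w) -> a w = 0].
  by move=> /section_regular[a aP] ->; exists a; rewrite cox_valE.
exists PSI; split.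
- by move=> c; apply: cox_val_inj; rewrite /= psiE evC cox_valE const_section_val.
- move=> y; have sP : is_quot_section K (fun=> True) (generic_quotient.repr y).
    by case: (generic_quotient.repr y) => s sP; exact: (asboolP _ sP).
  have [|a [wa aE _]] := val_onto y _ _ sP; first by rewrite generic_quotient.reprK.
  have [q qP] := choice (fun w => let: ex_intro2 p wp pE := ev_onto w (a w) (wa w) in
    ex_intro (fun p : {mpoly C[r]} => ev p = a w) p pE).
  exists (\sum_w q w); apply: cox_val_inj; rewrite /= psiE aE !rmorph_sum /=.
  by apply: eq_bigr => w _; rewrite qP.
- move=> p; rewrite -ev_ker /=; split=> [p0|p0].
    by apply/eqP; rewrite -tofrac_eq0 -psiE p0 rmorph0.
  by apply: cox_val_inj; rewrite psiE p0 tofrac0 rmorph0.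
move=> c y; split=> [[s sc yE]|[p wp <-]].
  have [a [wa aE a0]] := val_onto y _ _ sc yE.
  have [p wp pE] := ev_onto _ _ (wa (class_deg G c)); exists p => //.
  apply: cox_val_inj; rewrite /= psiE pE aE (bigD1 (class_deg G c)) //=.
  rewrite big1 ?addr0 // => w wc; rewrite a0 ?tofrac0 // => D Dc.
  by rewrite -class_degE Dc eq_sym.
have [s sc sE] := @section_of_hom K _ _ c (ev_hom _ _ wp) erefl.
by exists s => //; apply: cox_val_inj; rewrite /= psiE cox_valE sE.
Qed.
End CoxRingPresentation.


(** * Semi-invariants of linear groups acting on polynomials *)

Section MxAction.
Variables (C : fieldType) (n : nat).
Implicit Types (g h : 'M[C]_n) (f : {mpoly C[n]}).

HB.instance Definition _ g := GRing.isZmodMorphism.Build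
  {mpoly C[n]} {mpoly C[n]} (mxact g)
  (@comp_mpoly_is_additive n C n [tuple \sum_(j < n) g i j *: 'X_j | i < n]).
Lemma mxact_is_monoid_morphism g : monoid_morphism (mxact g).
Proof.
by split=> [|p q]; [exact: comp_mpoly1 | rewrite /mxact rmorphM].
Qed.

HB.instance Definition _ g := GRing.isMonoidMorphism.Build
  {mpoly C[n]} {mpoly C[n]} (mxact g) (mxact_is_monoid_morphism g).

Lemma mxactC g c : mxact g c%:MP = c%:MP.
Proof. exact: comp_mpolyC. Qed.

Lemma mxactX g i : mxact g 'X_i = \sum_(j < n) g i j *: 'X_j.
Proof. by rewrite /mxact comp_mpolyXU -tnth_nth tnth_mktuple. Qed.

Lemma mpoly_morph_ext (R : pzRingType) m (u v : {rmorphism {mpoly C[m]} -> R}) :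
  (forall c, u c%:MP = v c%:MP) -> (forall i, u 'X_i = v 'X_i) -> u =1 v.
Proof.
move=> uvC uvX p; rewrite [p]mpolyE !rmorph_sum; apply: eq_bigr => k _.
rewrite -mul_mpolyC !rmorphM uvC mpolyXE_id !rmorph_prod; congr (_ * _).
by apply: eq_bigr => i _; rewrite !rmorphXn uvX.
Qed.

(** Substitution is contravariant, which reverses the product. *)
Lemma mxactM g h f : mxact g (mxact h f) = mxact (h *m g) f.
Proof.
apply: (mpoly_morph_ext (u := mxact g \o mxact h) (v := mxact (h *m g))) => [c|i] /=.
  by rewrite !mxactC.
rewrite !mxactX rmorph_sum /=.
under eq_bigr do rewrite -mul_mpolyC rmorphM /= mxactC mxactX mul_mpolyC scaler_sumr.
rewrite exchange_big; apply: eq_bigr => k _ /=; rewrite mxE scaler_suml.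
by apply: eq_bigr => l _; rewrite scalerA.
Qed.

Lemma mxact1 f : mxact 1%:M f = f.
Proof.
apply: (mpoly_morph_ext (u := mxact 1%:M) (v := idfun)) => [c|i] /=.
  exact: mxactC.
rewrite mxactX (bigD1 i) //= mxE eqxx scale1r big1 ?addr0 // => k /negPf ki.
by rewrite mxE eq_sym ki scale0r.
Qed.

Lemma gengroup_invariant (gens : seq 'M[C]_n) f :
  (forall g, g \in gens -> g \in unitmx) ->
  (forall g, g \in gens -> mxact g f = f) -> forall g, gengroup gens g -> mxact g f = f.
Proof.
move=> gU gf g Gg; suff [] : g \in unitmx /\ mxact g f = f by [].
elim: Gg => {g} [g gg||g h _ [gU' gf'] _ [hU hf]|g _ [gU' gf']].
- by split; [exact: gU | exact: gf].
- by split; [exact: unitmx1 | exact: mxact1].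
- by rewrite unitmx_mul gU' hU -mxactM gf' hf.
- split; first by rewrite unitmx_inv.
  by rewrite -{1}gf' mxactM mulmxV // mxact1.
Qed.

Lemma mpoly_unitE (f : {mpoly C[n]}) : f \is a GRing.unit -> exists2 c, c != 0 & f = c%:MP.
Proof.
move=> /andP[/eqP fE f0]; exists f@_0 => //; apply: contraTneq f0 => ->.
by rewrite unitr0.
Qed.

Lemma mpolyC_unit (c : C) : c != 0 -> (c%:MP : {mpoly C[n]}) \is a GRing.unit.
Proof.
by move=> c0; apply/unitrPr; exists c^-1%:MP; rewrite -mpolyCM mulfV ?mpolyC1.
Qed.

Lemma mdegM (a b : {mpoly C[n]}) : a != 0 -> b != 0 ->
  (msize (a * b)).-1 = ((msize a).-1 + (msize b).-1)%N.
Proof.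
move=> a0 b0; rewrite msizeM //; rewrite (mpolySpred _ a0) (mpolySpred _ b0).
by rewrite addnS.
Qed.

Lemma mdeg0_unit (a : {mpoly C[n]}) : a != 0 -> (msize a).-1 = 0%N -> a \is a GRing.unit.
Proof.
move=> a0; rewrite (mpolySpred _ a0) /= => sa.
have aE : a = (a@_0)%:MP by apply: msize1_polyC; rewrite (mpolySpred _ a0) sa.
by rewrite aE; apply: mpolyC_unit; apply: contraNneq a0 => a00; rewrite aE a00 mpolyC0.
Qed.
End MxAction.

(** * The grading by semi-invariants of a dihedral group *)

Section DihedralGrading.
Variables (C : numClosedFieldType) (n : nat) (r s : 'M[C]_n).
Variables (W : finZmodType) (chi1 chi2 : W -> bool) (m : nat).
Local Notation S := {mpoly C[n]}.
Local Notation G := (gengroup [:: r; s]).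
Implicit Types (f a b d : S) (w : W).

(* [semi_inv w] is the space of semi-invariants of the character of G with    *)
(* values (-1)^(chi1 w) at r and (-1)^(chi2 w) at s.                          *)
Definition semi_inv w f :=
  mxact r f = (-1) ^+ chi1 w * f /\ mxact s f = (-1) ^+ chi2 w * f.

Hypothesis ss1 : s *m s = 1%:M.
Hypothesis rsrs1 : r *m s *m (r *m s) = 1%:M.
Hypothesis rm1 : forall f, iter m (mxact r) f = f.
Hypothesis W2 : forall w, w + w = 0.
Hypothesis chi1D : {morph chi1 : u v / u + v >-> u (+) v}.
Hypothesis chi2D : {morph chi2 : u v / u + v >-> u (+) v}.
Hypothesis chi_inj : forall u v, chi1 u = chi1 v -> chi2 u = chi2 v -> u = v.
Hypothesis chi_onto : forall b1 b2 : bool, ~~ (b1 && odd m) ->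
  exists w, chi1 w = b1 /\ chi2 w = b2.
Hypothesis coprime_pair : forall w, exists b b', [/\ semi_inv w b, semi_inv w b' &
  forall d, divides d b -> divides d b' -> d \is a GRing.unit].

Let s_unit : s \in unitmx. Proof. by case/mulmx1_unit: ss1. Qed.
Let rs_unit : r *m s \in unitmx. Proof. by case/mulmx1_unit: rsrs1. Qed.
Let r_unit : r \in unitmx. Proof. by move: rs_unit; rewrite unitmx_mul => /andP[]. Qed.

Let chi10 : chi1 0 = false.
Proof. by rewrite -(addr0 0) chi1D addbb. Qed.
Let chi20 : chi2 0 = false.
Proof. by rewrite -(addr0 0) chi2D addbb. Qed.

Lemma semi_inv0 w : semi_inv w 0.
Proof. by split; rewrite rmorph0 mulr0. Qed.

Lemma semi_invB w a b : semi_inv w a -> semi_inv w b -> semi_inv w (a - b).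
Proof. by move=> [ra sa] [rb sb]; split; rewrite rmorphB /= ?ra ?sa ?rb ?sb mulrBr. Qed.

Lemma semi_invM u v a b : semi_inv u a -> semi_inv v b -> semi_inv (u + v) (a * b).
Proof.
move=> [ra sa] [rb sb]; split; rewrite rmorphM /= ?ra ?sa ?rb ?sb.
  by rewrite mulrACA chi1D signr_addb.
by rewrite mulrACA chi2D signr_addb.
Qed.

Lemma semi_inv_div u v a b : a != 0 -> semi_inv u a -> semi_inv v (a * b) ->
  semi_inv (u + v) b.
Proof.
move=> a0 [ra sa] [rab sab].
have key g (c d : bool) : mxact g a = (-1) ^+ c * a -> mxact g (a * b) = (-1) ^+ d * (a * b) ->
    mxact g b = (-1) ^+ (c (+) d) * b.
  move=> ga; rewrite rmorphM /= ga => E; apply: (mulfI a0).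
  rewrite -[LHS](signrMK c) [X in _ * X]mulrA E signr_addb [RHS]mulrCA.
  by rewrite -[RHS]mulrA.
by split; [rewrite chi1D | rewrite chi2D]; exact: key.
Qed.

Lemma semi_inv_const (c : C) : semi_inv 0 c%:MP.
Proof. by split; rewrite mxactC ?chi10 ?chi20 mul1r. Qed.

Lemma semi_inv_invariant f : semi_inv 0 f <-> exists a : invRing G, f = inv_poly a.
Proof.
rewrite /semi_inv chi10 chi20 !mul1r; split=> [[rf sf]|[[a aG] -> /=]].
  have fG : Defs.invariant G f.
    apply/asboolP => g; apply: gengroup_invariant => h; rewrite !inE.
      by case/orP=> /eqP->.
    by case/orP=> /eqP->.
  by exists (InvRing fG).
have {}aG := asboolP _ aG.
by split; apply: aG; apply: gengroup_gen; rewrite !inE eqxx ?orbT.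
Qed.

Lemma semi_inv_direct (a : W -> S) : (forall w, semi_inv w (a w)) ->
  \sum_w a w = 0 -> forall w, a w = 0.
Proof.
move=> wa sa w.
(* The eigenvalue, on the component v, of the product of the operators 1 + chi(r) r and 1 + chi(s) s
   for the character chi of w. It is 4 for v = w and 0 otherwise. *)
pose q v : S := (1 + (-1) ^+ (chi1 w (+) chi1 v)) * (1 + (-1) ^+ (chi2 w (+) chi2 v)).
have : \sum_v q v * a v = 0.
  pose T1 f := f + (-1) ^+ chi1 w * mxact r f.
  pose T2 f := f + (-1) ^+ chi2 w * mxact s f.
  have T10 : T1 0 = 0 by rewrite /T1 rmorph0 mulr0 addr0.
  have T20 : T2 0 = 0 by rewrite /T2 rmorph0 mulr0 addr0.
  have T1D : {morph T1 : x y / x + y}.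
    by move=> x y; rewrite /T1 rmorphD mulrDr addrACA.
  have T2D : {morph T2 : x y / x + y}.
    by move=> x y; rewrite /T2 rmorphD mulrDr addrACA.
  rewrite (_ : \sum_v _ = T1 (T2 (\sum_v a v))); first by rewrite sa T20 T10.
  rewrite (big_morph T2 T2D T20) (big_morph T1 T1D T10); apply: eq_bigr => v _.
  have [ra s_a] := wa v; rewrite /T1 /T2 rmorphD rmorphM /= rmorphXn rmorphN1.
  rewrite s_a rmorphM rmorphXn rmorphN1 /= ra /q !signr_addb.
  move: ((-1) ^+ chi1 w) ((-1) ^+ chi2 w) ((-1) ^+ chi1 v) ((-1) ^+ chi2 v).
  by move=> x y z t; ring.
rewrite (bigD1 w) //= big1 ?addr0 => [|v vw]; last first.
  rewrite /q; have [E1|E1] := eqVneq (chi1 w) (chi1 v); last first.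
    have -> : chi1 w (+) chi1 v by move: E1; case: (chi1 w); case: (chi1 v).
    by rewrite expr1 subrr !mul0r.
  have [E2|E2] := eqVneq (chi2 w) (chi2 v); last first.
    have -> : chi2 w (+) chi2 v by move: E2; case: (chi2 w); case: (chi2 v).
    by rewrite expr1 subrr mulr0 mul0r.
  by rewrite (chi_inj E1 E2) eqxx in vw.
rewrite /q !addbb expr0 => /eqP; rewrite mulf_eq0 => /orP[|/eqP//].
by rewrite -!mulr2n -natrM -mpolyC_nat mpolyC_eq0 pnatr_eq0.
Qed.

(** Applying g to the second divisibility shows that d divides its image under g; so the two differ
    by a unit, which is a constant. *)
Let mxact_unit_const g d : g \in unitmx -> d != 0 ->
  divides (mxact g d) d -> divides (mxact (invmx g) d) d ->
  exists c : C, mxact g d = c%:MP * d.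
Proof.
move=> gU d0 [e eE] [e' e'E].
have e1 : mxact g e' * e = 1.
  apply: (mulfI d0); rewrite mulr1 mulrA; have := congr1 (mxact g) e'E.
  by rewrite rmorphM /= mxactM mulVmx // mxact1 => <-.
have /mpoly_unitE[c _ cE] : mxact g e' \is a GRing.unit by apply/unitrPr; exists e.
exists c; have := congr1 (mxact g) e'E.
by rewrite rmorphM /= mxactM mulVmx // mxact1 cE mulrC => ->.
Qed.

(* The greatest common divisor of two semi-invariants is a semi-invariant:    *)
(* it is multiplied by constants c and c' under r and s, and the dihedral     *)
(* relations force c^2 = c'^2 = 1.                                            *)
Lemma semi_inv_cofactors u v a b : a != 0 -> semi_inv u a -> semi_inv v b ->
  exists w d a' b', [/\ semi_inv w d, a = d * a', b = d * b' &
    forall c, divides a' (b' * c) -> divides a' c].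
Proof.
move=> a0 [ra sa] [rb sb].
have [d [a' [b' [aE bE cop]]]] := coprime_cofactors b (factorial_mpoly a0).
have [d0 a'0] : d != 0 /\ a' != 0 by apply/andP; rewrite -negb_or -mulf_eq0 -aE.
(* Coprimality of the cofactors gives d the universal property of a gcd. It will be applied to the
   images of d under r, s and their inverses, which again divide a and b. *)
have gcd e : divides e a -> divides e b -> divides e d.
  move=> [x xE] [y yE]; have e0 : e != 0 by apply: contraNneq a0 => e0; rewrite xE e0 mul0r.
  have /cop[z zE] : divides a' (b' * x).
    by exists y; apply: (mulfI e0); rewrite mulrCA -xE aE [RHS]mulrCA -yE bE mulrCA mulrA mulrAC -mulrA mulrCA.
  by exists z; apply: (mulIf a'0); rewrite -aE xE zE mulrA mulrAC.
have sgd g (e e' : S) (k : bool) : mxact g e = (-1) ^+ k * e -> divides e' e ->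
    divides (mxact g e') e.
  move=> gE [x xE]; exists ((-1) ^+ k * mxact g x).
  by rewrite mulrCA -rmorphM /= -xE gE signrMK.
have sgV g (e : S) (k : bool) : g \in unitmx -> mxact g e = (-1) ^+ k * e ->
    mxact (invmx g) e = (-1) ^+ k * e.
  move=> gU /(congr1 (mxact (invmx g))).
  rewrite mxactM mulmxV // mxact1 rmorphM rmorphXn rmorphN1 /= => E.
  by rewrite [X in _ * X]E signrMK.
have constP g (k l : bool) : g \in unitmx -> mxact g a = (-1) ^+ k * a ->
    mxact g b = (-1) ^+ l * b -> exists c : C, mxact g d = c%:MP * d.
  move=> gU ga gb; have [da db] : divides d a /\ divides d b by split; [exists a'|exists b'].
  apply: mxact_unit_const => //; apply: gcd.
  - exact: sgd ga da.
  - exact: sgd gb db.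
  - exact: sgd (sgV _ _ _ gU ga) da.
  - exact: sgd (sgV _ _ _ gU gb) db.
have [c rd] := constP r _ _ r_unit ra rb.
have [c' sd] := constP s _ _ s_unit sa sb.
have cancel (x : C) : x%:MP * d = d -> x = 1.
  move=> E; apply/eqP; rewrite -subr_eq0 -(mpolyC_eq0 n) mpolyCB mpolyC1 subr_eq0.
  by apply/eqP/(mulIf d0); rewrite E mul1r.
have c'2 : c' ^+ 2 = 1.
  apply: cancel; rewrite -[RHS]mxact1 -ss1 -mxactM sd (rmorphM (mxact s)) /= mxactC sd.
  by rewrite mulrA -mpolyCM.
have cc' : (c * c') ^+ 2 = 1.
  have E : mxact (r *m s) d = (c * c')%:MP * d.
    by rewrite -mxactM rd (rmorphM (mxact s)) /= mxactC sd mulrA -mpolyCM.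
  apply: cancel; rewrite -[RHS]mxact1 -rsrs1 -mxactM E (rmorphM (mxact (r *m s))) /= mxactC E.
  by rewrite mulrA -mpolyCM.
have c2 : c ^+ 2 = 1 by move: cc'; rewrite exprMn c'2 mulr1.
have cm : c ^+ m = 1.
  apply: cancel; rewrite -[RHS]rm1; elim: m => [|k IH]; first by rewrite mul1r.
  by rewrite iterS -IH (rmorphM (mxact r)) /= mxactC rd mulrA exprSr mpolyCM.
have C2 : (1 == -1 :> C) = false by rewrite -subr_eq0 opprK -mulr2n pnatr_eq0.
have sgE (x : C) : x ^+ 2 = 1 -> x = (-1) ^+ (x == -1).
  move=> /eqP; rewrite sqrf_eq1 => /orP[/eqP->|/eqP->]; last by rewrite eqxx.
  by rewrite C2.
(* For odd m the equation c^m = 1 excludes c = -1, as the condition in [chi_onto] demands. *)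
have [|w [w1 w2]] := @chi_onto (c == -1) (c' == -1).
  apply/negP => /andP[/eqP c1]; move: cm; rewrite c1 -signr_odd => /[swap] ->.
  by move/eqP; rewrite expr1 eq_sym C2.
exists w, d, a', b'; split=> //; split.
  by rewrite rd {1}(sgE c c2) w1 rmorphXn /= mpolyCN mpolyC1.
by rewrite sd {1}(sgE c' c'2) w2 rmorphXn /= mpolyCN mpolyC1.
Qed.

Lemma semi_inv_unit u : u \is a GRing.unit -> semi_inv 0 u.
Proof. by move=> /mpoly_unitE[c _ ->]; exact: semi_inv_const. Qed.

Lemma mpoly_unit_sqrt (u : S) : u \is a GRing.unit -> exists v, v ^+ 2 = u.
Proof.
by move=> /mpoly_unitE[c _ ->]; exists (sqrtC c)%:MP; rewrite -rmorphXn /= sqrtCK.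
Qed.

Definition semi_inv_grading : grading (invRing G) S W :=
  @Grading (invRing G) S W semi_inv (val : {rmorphism invRing G -> S})
    (fun a => (msize a).-1) W2 semi_inv0 semi_invB semi_invM semi_inv_div
    semi_inv_direct semi_inv_invariant val_inj semi_inv_unit mpoly_unit_sqrt
    (@mdegM C n) (@mdeg0_unit C n) semi_inv_cofactors coprime_pair.
End DihedralGrading.


(** * Kernels of monomial parametrisations *)

(** The predicate [ok] restricts the length, since the functions below are symmetric only for words
    of even length or of a given length modulo 3. *)
Lemma swap_perm_eq (T : eqType) (X : Type) (ok : pred nat) (f : seq T -> X) :
  (forall s1 a b s2, ok (size (s1 ++ a :: b :: s2)) ->
     f (s1 ++ a :: b :: s2) = f (s1 ++ b :: a :: s2)) ->
  forall s t, ok (size s) -> perm_eq s t -> f s = f t.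
Proof.
move=> swap s; elim: s ok f swap => [|a s IH] ok f swap t oks.
  by rewrite perm_sym => /perm_nilP->.
have pull t0 t1 t2 : ok (size (t0 ++ t1 ++ a :: t2)) ->
    f (t0 ++ t1 ++ a :: t2) = f (t0 ++ a :: t1 ++ t2).
  elim: t1 t0 => [//|b t1 IHt] t0 okt.
  have := IHt (rcons t0 b); rewrite -!cats1 -!catA /= => ->; last exact: okt.
  apply: esym; apply: swap; move: okt.
  by rewrite !size_cat /= !size_cat /= !addnS.
move=> st; have at_ : a \in t by rewrite -(perm_mem st) mem_head.
case/splitPr: at_ st => t1 t2 st.
have okt : ok (size (t1 ++ a :: t2)) by rewrite -(perm_size st).
rewrite (pull [::] t1 t2 okt) /=.
apply: (IH (ok \o S) (fun u => f (a :: u))) => // [s1 b c s2 oku|].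
  exact: (swap (a :: s1)).
by rewrite -(perm_cons a); apply: (perm_trans st); rewrite perm_catC /= perm_cons perm_catC.
Qed.

Section MonomialExtension.
Variables (C : comNzRingType) (n : nat) (Q : comNzRingType).
Variables (f : {rmorphism C -> Q}) (h : 'X_{1..n} -> Q).
Implicit Types p q : {mpoly C[n]}.

Definition linext p : Q := \sum_(m <- msupp p) f p@_m * h m.

Lemma linextE p i : (msize p <= i)%N ->
  linext p = \sum_(m : 'X_{1..n < i}) f p@_m * h m.
Proof.
move=> le_pi; set I : subFinType _ := 'X_{1..n < i}.
rewrite /linext (big_mksub I) ?msupp_uniq //=; first last.
  by move=> x /msize_mdeg_lt /leq_trans; apply.
rewrite big_rmcond //= => m /memN_msupp_eq0 ->.
by rewrite rmorph0 mul0r.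
Qed.

Lemma linext_is_zmod_morphism : zmod_morphism linext.
Proof.
move=> p q; pose i := maxn (msize (p - q)) (maxn (msize p) (msize q)).
rewrite !(@linextE _ i) ?leq_max ?leqnn ?orbT // -sumrB; apply: eq_bigr => m _.
by rewrite mcoeffB rmorphB mulrBl.
Qed.

HB.instance Definition _ := GRing.isZmodMorphism.Build {mpoly C[n]} Q linext
  linext_is_zmod_morphism.

Lemma linextZX c m : linext (c *: 'X_[m]) = f c * h m.
Proof.
have [->|c0] := eqVneq c 0; first by rewrite scale0r raddf0 rmorph0 mul0r.
by rewrite /linext msuppMCX // big_seq1 mcoeffZ mcoeffX eqxx mulr1.
Qed.

Lemma linextX m : linext 'X_[m] = h m.
Proof. by rewrite -['X_[m]]scale1r linextZX rmorph1 mul1r. Qed.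

Lemma linextZ c p : linext (c *: p) = f c * linext p.
Proof.
elim/mpolyind: p => [|d m p _ _ IH]; first by rewrite scaler0 !raddf0 mulr0.
by rewrite scalerDr !raddfD /= IH scalerA !linextZX rmorphM mulrDr mulrA.
Qed.

Variable P : pred 'X_{1..n}.
Hypothesis hM : forall m m', P m -> P m' -> h (m + m')%MM = h m * h m'.

Lemma linextM p q : {subset msupp p <= P} -> {subset msupp q <= P} ->
  linext (p * q) = linext p * linext q.
Proof.
move=> Pp Pq; rewrite mpolyME raddf_sum big_allpairs /= mulr_suml.
rewrite big_seq [RHS]big_seq; apply: eq_bigr => m mp; rewrite mulr_sumr.
rewrite big_seq [RHS]big_seq; apply: eq_bigr => m' mq.
have /= -> := linextZX (p@_m * q@_m') (m + m')%MM.
by rewrite (hM (Pp _ mp) (Pq _ mq)) rmorphM mulrACA.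
Qed.
End MonomialExtension.

Lemma ideal_quotient_exists (R : comNzRingType) (I : R -> Prop) :
  I 0 -> ~ I 1 -> (forall a x y, I x -> I y -> I (a * x + y)) ->
  exists (Q : comNzRingType) (pi : {rmorphism R -> Q}), forall x, pi x = 0 <-> I x.
Proof.
move=> I0 I1 IM; pose J : {pred R} := fun x => `[< I x >].
have J_closed : idealr_closed J.
  split; first exact/asboolP.
    by apply/asboolP.
  by move=> a x y /asboolP Ix /asboolP Iy; apply/asboolP; exact: IM.
pose J_mixin := isIdealr.Build R J J_closed.
pose JI : idealr R := HB.pack J J_mixin.
exists {ideal_quot JI}, (\pi_({ideal_quot JI}))%qT => x.
rewrite -(rmorph0 (\pi_({ideal_quot JI}))%qT); split=> [/eqP|Ix].
  by rewrite -Quotient.idealrBE subr0 => /asboolP.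
by apply/eqP; rewrite -Quotient.idealrBE subr0; apply/asboolP.
Qed.

Lemma mpoly_ring_ind (R : comNzRingType) n (P : {mpoly R[n]} -> Prop) :
  (forall c, P c%:MP) -> (forall i, P 'X_i) ->
  (forall p q, P p -> P q -> P (p + q)) -> (forall p q, P p -> P q -> P (p * q)) ->
  forall p, P p.
Proof.
move=> PC PX PD PM p; rewrite [p]mpolyE; elim/big_ind: _ => [|p1 p2|m _].
- by rewrite -mpolyC0.
- exact: PD.
rewrite -mul_mpolyC; apply: (PM) => //; rewrite mpolyXE_id.
elim/big_ind: _ => [|p1 p2|i _]; first by rewrite -mpolyC1.
  exact: (PM).
by elim: (m i) => [|k IH]; [rewrite expr0 -mpolyC1 | rewrite exprS; exact: PM].
Qed.

(* If the monomials m with P m form a monoid which is mapped, by h, to the    *)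
(* quotient by the relations, compatibly with the parametrisation ev of the   *)
(* generators, then the linear extension of h is a left inverse of ev.        *)
Lemma ker_of_monomial_section (C : fieldType) (r n : nat)
    (ev : {rmorphism {mpoly C[r]} -> {mpoly C[n]}}) (rels : seq {mpoly C[r]})
    (P : pred 'X_{1..n}) :
  (forall c, ev c%:MP = c%:MP) -> (forall g, g \in rels -> ev g = 0) ->
  P 0%MM -> (forall m m', P m -> P m' -> P (m + m')%MM) ->
  (forall i, {subset msupp (ev 'X_i) <= P}) ->
  (forall (Q : comNzRingType) (pi : {rmorphism {mpoly C[r]} -> Q}),
     (forall g, g \in rels -> pi g = 0) ->
     exists h : 'X_{1..n} -> Q, [/\ h 0%MM = 1,
       forall m m', P m -> P m' -> h (m + m')%MM = h m * h m' &
       forall i, linext (pi \o @mpolyC r C) h (ev 'X_i) = pi 'X_i]) ->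
  forall p, ev p = 0 <-> ideal_gen (fun=> True) (fun g => g \in rels) p.
Proof.
move=> evC ev_rels P0 PM evP H p; set I := ideal_gen _ _.
have I_ev x : I x -> ev x = 0.
  move=> [k [a [g [_ gr ->]]]]; rewrite rmorph_sum big1 // => i _.
  by rewrite rmorphM /= (ev_rels _ (gr i)) mulr0.
split=> [p0|]; last exact: I_ev.
have [|||Q [pi piP]] := @ideal_quotient_exists {mpoly C[r]} I.
- exact: ideal_gen0.
- by move=> /I_ev/eqP; rewrite rmorph1 oner_eq0.
- move=> a x y Ix Iy; apply: ideal_genD => //; exact: ideal_genM Ix.
have [|h [h0 hM hX]] := H Q pi.
  move=> g gr; apply/piP; exists 1%N, (fun=> 1), (fun=> g).
  by split=> //; rewrite big_ord1 mul1r.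
apply/piP; suff [_ <-] : {subset msupp (ev p) <= P} /\
    linext (pi \o @mpolyC r C) h (ev p) = pi p by rewrite p0 raddf0.
elim/mpoly_ring_ind: p {p0} => [c|i|a b [aP aE] [bP bE]|a b [aP aE] [bP bE]].
- have cE : c%:MP = c *: 'X_[0%MM] :> {mpoly C[n]} by rewrite -mul_mpolyC mpolyX0 mulr1.
  rewrite evC cE; split=> [m|]; last by rewrite linextZX h0 mulr1.
  by move/msuppZ_le; rewrite msuppX inE => /eqP->.
- by split; [exact: evP | exact: hX].
- rewrite !rmorphD /= raddfD /= aE bE; split=> // m /msuppD_le.
  by rewrite mem_cat => /orP[/aP|/bP].
rewrite !rmorphM /= (linextM _ hM aP bP) aE bE; split=> // m /msuppM_le.
by move=> /allpairsP[[m1 m2] [/aP P1 /bP P2 ->]]; exact: PM.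
Qed.


(** * Words and monomials *)

Section MonomialWords.
Variable n : nat.
Implicit Types m : 'X_{1..n}.

Definition mword m : seq 'I_n := flatten [seq nseq (m i) i | i <- enum 'I_n].

Lemma count_mword m i : count_mem i (mword m) = m i.
Proof.
rewrite /mword count_flatten -map_comp (eq_map (g := fun k => (k == i) * m k)%N) => [|k].
  rewrite sumnE big_map big_enum /= (bigD1 i) //= eqxx mul1n big1 ?addn0 // => k.
  by move=> /negPf->.
by rewrite /= count_nseq.
Qed.

Lemma perm_mwordD m m' : perm_eq (mword (m + m')%MM) (mword m ++ mword m').
Proof. by apply/allP => i _ /=; rewrite count_cat !count_mword mnmDE. Qed.

Lemma perm_mwordU i : perm_eq (mword U_(i)%MM) [:: i].
Proof. by apply/allP => k _ /=; rewrite count_mword mnm1E addn0. Qed.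

Lemma mword0 : mword 0%MM = [::].
Proof.
apply/perm_nilP/allP => i _ /=.
by rewrite count_mword mnm0E.
Qed.

Lemma size_mword m : size (mword m) = mdeg m.
Proof.
rewrite /mword size_flatten /shape -map_comp (eq_map (g := fun k => m k)).
  by rewrite sumnE big_map big_enum /= mdegE.
by move=> k; rewrite /= size_nseq.
Qed.

Definition word_mnm (s : seq 'I_n) : 'X_{1..n} := (\sum_(i <- s) U_(i))%MM.

Lemma mword_mnmK m : word_mnm (mword m) = m.
Proof.
apply/mnmP => i; rewrite mnm_sumE -[RHS]count_mword -sum1_count [RHS]big_mkcond /=.
by apply: eq_bigr => k _; rewrite mnm1E; case: eqP.
Qed.

Lemma perm_mwordDU i k : perm_eq (mword (U_(i) + U_(k))%MM) [:: i; k].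
Proof.
apply: perm_trans (perm_mwordD _ _) _.
exact: (perm_cat (perm_mwordU i) (perm_mwordU k)).
Qed.

Lemma word_mnm_cons (R : nzRingType) i (s : seq 'I_n) :
  'X_[word_mnm (i :: s)] = 'X_i * 'X_[word_mnm s] :> {mpoly R[n]}.
Proof. by rewrite /word_mnm big_cons mpolyXD. Qed.
End MonomialWords.

(** * Products over words cut into pairs and triples *)

Section PairWords.
Variables (Q : comNzRingType) (I : eqType) (y : I -> I -> Q).
Hypothesis yC : forall a b, y a b = y b a.
Hypothesis yX : forall a b c d, y a b * y c d = y a c * y b d.

(** A last unpaired letter is dropped, so the value is meaningful for even length only. *)
Fixpoint pairword (s : seq I) : Q :=
  if s is a :: b :: s' then y a b * pairword s' else 1.

Lemma pairword_swap s1 a b s2 : ~~ odd (size (s1 ++ a :: b :: s2)) ->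
  pairword (s1 ++ a :: b :: s2) = pairword (s1 ++ b :: a :: s2).
Proof.
have [k] := ubnP (size s1); elim: k s1 s2 => // k IH [|c [|d s1]] s2 /= sk.
- by rewrite yC.
- case: s2 => [//|d s2] _ /=; first by rewrite !mulrA yX.
- by rewrite negbK => evn; rewrite IH //; exact: ltnW sk.
Qed.

Lemma pairword_perm s t : ~~ odd (size s) -> perm_eq s t -> pairword s = pairword t.
Proof. exact: (swap_perm_eq (ok := fun k => ~~ odd k) pairword_swap). Qed.

Lemma pairword_cat s t : ~~ odd (size s) -> pairword (s ++ t) = pairword s * pairword t.
Proof.
have [k] := ubnP (size s); elim: k s => // k IH [|a [|b s]] //= sk.
  by rewrite mul1r.
by rewrite negbK => evn; rewrite IH ?mulrA //; exact: ltnW sk.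
Qed.
End PairWords.

Section BalancedWords.
Variables (Q : comNzRingType) (I : eqType).

Fixpoint tripleword (p : I -> I -> I -> Q) (s : seq I) : Q :=
  if s is a :: b :: c :: s' then p a b c * tripleword p s' else 1.

(** Letters of the two words are paired off while both last, and the surplus is cut into triples;
    nothing is lost exactly when the lengths agree modulo 3. *)
Fixpoint balword (y : I -> I -> Q) (p q : I -> I -> I -> Q) (us vs : seq I) : Q :=
  match us, vs with
  | a :: us', b :: vs' => y a b * balword y p q us' vs'
  | [::], _ => tripleword q vs
  | _, [::] => tripleword p us
  end.

Lemma balwordC y p q us vs :
  balword y p q us vs = balword (fun a b => y b a) q p vs us.
Proof.
by elim: us vs => [|a us IH] [|b vs] //=; rewrite IH.
Qed.

Section Swap.
Variables (y : I -> I -> Q) (p q : I -> I -> I -> Q).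
Hypothesis pC12 : forall a b c, p a b c = p b a c.
Hypothesis pC23 : forall a b c, p a b c = p a c b.
Hypothesis pX : forall a b c d e f, p a b c * p d e f = p d b c * p a e f.
Hypothesis yX : forall a b c d, y a b * y c d = y c b * y a d.
Hypothesis ypX : forall a b c d e, y a b * p c d e = y c b * p a d e.

Lemma tripleword_swap s1 a b s2 : (size (s1 ++ a :: b :: s2) %% 3 = 0)%N ->
  tripleword p (s1 ++ a :: b :: s2) = tripleword p (s1 ++ b :: a :: s2).
Proof.
have [k] := ubnP (size s1); elim: k s1 s2 => // k IH [|c [|d [|e s1]]] s2 sk.
- by case: s2 => [|d s2] //= _; rewrite pC12.
- by case: s2 => [|d s2] //= _; rewrite pC23.
- case: s2 => [|e [|f s2]] //= _; rewrite !mulrA; congr (_ * _).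
  rewrite [p c d a]pC23 [p c a d]pC12 [LHS]pX.
  by rewrite [p b c d]pC12 [p c b d]pC23.
- rewrite /= -[X in (X %% 3)%N]addn3 modnDr => sz; rewrite IH //.
  exact: ltnW (ltnW sk).
Qed.

Lemma balword_swap vs s1 a b s2 : (size (s1 ++ a :: b :: s2) = size vs %[mod 3])%N ->
  balword y p q (s1 ++ a :: b :: s2) vs = balword y p q (s1 ++ b :: a :: s2) vs.
Proof.
elim: s1 vs => [|c s1 IH] [|v vs].
- by move=> sz; exact: (tripleword_swap (s1 := [::])).
- case: vs => [|w vs] /=; last by rewrite !mulrA yX.
  by case: s2 => [|c [|d s2]] //= _; rewrite !mulrA ypX.
- by move=> sz; exact: (tripleword_swap (s1 := c :: s1)).
- move=> /= /eqP; rewrite -(addn1 (size vs)) -addn1 eqn_modDr => /eqP sz.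
  by rewrite IH.
Qed.
End Swap.

(* The relations satisfied by y a b = u_a v_b, p a b c = u_a u_b u_c and       *)
(* q a b c = v_a v_b v_c.                                                     *)
Record balanced (y : I -> I -> Q) (p q : I -> I -> I -> Q) : Prop := Balanced {
  bal_pC12 : forall a b c, p a b c = p b a c;
  bal_pC23 : forall a b c, p a b c = p a c b;
  bal_qC12 : forall a b c, q a b c = q b a c;
  bal_qC23 : forall a b c, q a b c = q a c b;
  bal_pX : forall a b c d e f, p a b c * p d e f = p d b c * p a e f;
  bal_qX : forall a b c d e f, q a b c * q d e f = q d b c * q a e f;
  bal_yX : forall a b c d, y a b * y c d = y c b * y a d;
  bal_ypX : forall a b c d e, y a b * p c d e = y c b * p a d e;
  bal_yqX : forall a b c d e, y a b * q c d e = y a c * q b d e;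
  bal_pqE : forall a b c u v w, p a b c * q u v w = y a u * y b v * y c w }.

Lemma balancedC y p q : balanced y p q -> balanced (fun a b => y b a) q p.
Proof.
case=> pC12 pC23 qC12 qC23 pX qX yX ypX yqX pqE; split=> // a b c d.
- by rewrite mulrC yX mulrC.
- by move=> e f; rewrite mulrC pqE.
Qed.

Lemma balword_perm y p q us us' vs vs' : balanced y p q ->
  (size us = size vs %[mod 3])%N -> perm_eq us us' -> perm_eq vs vs' ->
  balword y p q us vs = balword y p q us' vs'.
Proof.
have key y1 p1 q1 vs1 us1 us2 : balanced y1 p1 q1 -> (size us1 = size vs1 %[mod 3])%N ->
    perm_eq us1 us2 -> balword y1 p1 q1 us1 vs1 = balword y1 p1 q1 us2 vs1.
  case=> pC12 pC23 qC12 qC23 pX qX yX ypX yqX pqE sz uu.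
  apply: (@swap_perm_eq _ _ (fun k => k == size vs1 %[mod 3])
    (fun us => balword y1 p1 q1 us vs1)) uu => [s1 a b s2 /eqP|]; last exact/eqP.
  exact: balword_swap.
move=> bal sz uu vv; rewrite (key _ _ _ _ _ _ bal sz uu) balwordC [RHS]balwordC.
by apply: key => //; [exact: balancedC | rewrite -(perm_size uu) sz].
Qed.

Lemma balword_p y p q a b c us vs : balanced y p q -> (size us = size vs %[mod 3])%N ->
  balword y p q (a :: b :: c :: us) vs = p a b c * balword y p q us vs.
Proof.
move=> bal; elim: vs us => [|v vs IH] [|d us] //=.
  (* With no further u, the congruence forces three letters v, w, z, and [bal_pqE] trades the three
     pairs for a triple of each kind. *)
  case: vs {IH} => [|w [|z vs]] //= _.
  by rewrite !mulrA (bal_pqE bal); case: vs.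
move=> sz; have {}sz : (size us = size vs %[mod 3])%N by lia.
transitivity (balword y p q (d :: a :: b :: c :: us) (v :: vs)).
  apply: (@balword_perm _ _ _ (a :: b :: c :: d :: us) _ (v :: vs)) => //=; first lia.
  by rewrite (perm_catCA [:: a; b; c] [:: d] us).
by rewrite -[LHS]/(y d v * balword y p q (a :: b :: c :: us) vs) IH // mulrCA.
Qed.

Lemma balword_q y p q a b c us vs : balanced y p q -> (size us = size vs %[mod 3])%N ->
  balword y p q us (a :: b :: c :: vs) = q a b c * balword y p q us vs.
Proof.
by move=> /balancedC bal sz; rewrite balwordC balword_p // -balwordC.
Qed.

Lemma balword_cat y p q us us' vs vs' : balanced y p q ->
  (size us = size vs %[mod 3])%N -> (size us' = size vs' %[mod 3])%N ->
  balword y p q (us ++ us') (vs ++ vs') = balword y p q us vs * balword y p q us' vs'.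
Proof.
move=> bal + sz'; have [k] := ubnP (size us + size vs)%N.
elim: k us vs => // k IH [|a us] [|b vs] sk.
- by rewrite mul1r.
- case: vs sk => [|c [|d vs]] //= sk sz.
  have E : balword y p q us' (vs ++ vs') =
      balword y p q [::] vs * balword y p q us' vs' by apply: (IH [::] vs) => /=; lia.
  rewrite balword_q ?size_cat //; last by lia.
  by rewrite E mulrA.
- case: us sk => [|c [|d us]] //= sk sz.
  have E : balword y p q (us ++ us') vs' =
      balword y p q us [::] * balword y p q us' vs' by apply: (IH us [::]) => /=; lia.
  rewrite -[LHS]/(balword y p q [:: a, c, d & us ++ us'] vs').
  rewrite balword_p ?size_cat //; last by lia.
  by rewrite E mulrA; case: us {sk sz E}.
by move=> sz; rewrite /= IH ?mulrA //; move: sk sz => /=; lia.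
Qed.
End BalancedWords.


(** * Integer matrices *)

Section IntegerMatrices.
Variables (R : comNzRingType) (n : nat).
Implicit Types A B : seq (seq int).

(** Integer rows let identities between the given matrices be settled by computation. *)
Definition rows_mul A B : seq (seq int) :=
  mkseq (fun i => mkseq (fun k =>
    foldr (fun l z => nth 0 (nth [::] A i) l * nth 0 (nth [::] B l) k + z) 0
      (iota 0 n)) n) n.

Definition rows_id : seq (seq int) :=
  mkseq (fun i => mkseq (fun k => (i == k)%:Z) n) n.

Lemma mx_of_mul A B : mx_of R n n A *m mx_of R n n B = mx_of R n n (rows_mul A B).
Proof.
apply/matrixP => i k; rewrite !mxE !nth_mkseq //.
under eq_bigr do rewrite !mxE -intrM.
rewrite -rmorph_sum /=; congr (_%:~R).
rewrite -(big_mkord xpredT (fun l => nth 0 (nth [::] A i) l * nth 0 (nth [::] B l) k)).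
by rewrite /index_iota subn0; elim: (iota 0 n) => [|l s IH]; rewrite ?big_nil ?big_cons ?IH.
Qed.

Lemma mx_of_id : mx_of R n n rows_id = 1%:M.
Proof.
by apply/matrixP => i k; rewrite !mxE !nth_mkseq // val_eqE.
Qed.
End IntegerMatrices.

Lemma mxact_mx_of (C : fieldType) n (rows : seq (seq int)) (i : 'I_n) :
  mxact (mx_of C n n rows) 'X_i =
  \sum_(k < n) (nth 0 (nth [::] rows i) k)%:~R *: 'X_k.
Proof. by rewrite mxactX; apply: eq_bigr => k _; rewrite mxE. Qed.

Lemma iter_mxact (C : fieldType) n (g : 'M[C]_n) m f :
  iter m (mxact g) f = mxact (iter m (mulmx g) 1%:M) f.
Proof.
elim: m f => [|m IH] f; first by rewrite mxact1.
rewrite iterS IH mxactM; congr (mxact _ f).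
elim: m {IH} => [|m IH]; first by rewrite /= mul1mx mulmx1.
by rewrite iterS -mulmxA IH.
Qed.

(** * Coprimality of polynomials in disjoint sets of variables *)

Section DisjointVariables.
Variables (C : fieldType) (n : nat).
Local Notation S := {mpoly C[n]}.
Implicit Types (P : pred 'I_n) (f g d : S).

(* The variables outside P are multiplied by a new variable, so that          *)
(* [scale_out P f = f%:P] says that f only involves the variables in P.       *)
Definition scale_out P : S -> {poly S} :=
  mmap (polyC \o @mpolyC n C)
    (fun i => if P i then ('X_i)%:P else ('X_i)%:P * 'X).

Lemma scale_outD P : {morph scale_out P : p q / p + q}.
Proof. exact: mmapD. Qed.

Lemma scale_outM P : {morph scale_out P : p q / p * q}.
Proof. by move=> p q; rewrite /scale_out rmorphM. Qed.

Lemma scale_outC P c : scale_out P c%:MP = c%:MP%:P.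
Proof. by rewrite /scale_out mmapC. Qed.

Lemma scale_outX P i : scale_out P 'X_i = if P i then ('X_i)%:P else ('X_i)%:P * 'X.
Proof. by rewrite /scale_out mmapX mmap1U. Qed.

Lemma scale_out1 P f : (scale_out P f).[1] = f.
Proof.
elim/mpoly_ring_ind: f => [c|i|p q pE qE|p q pE qE].
- by rewrite scale_outC hornerC.
- by rewrite scale_outX; case: ifP => _; rewrite ?hornerMX hornerC ?mulr1.
- by rewrite scale_outD hornerD; congr (_ + _).
- by rewrite scale_outM hornerM; congr (_ * _).
Qed.

Lemma scale_out_eval0 P f :
  (scale_out P f).[0] = f \mPo [tuple if P i then 'X_i else 0 | i < n].
Proof.
elim/mpoly_ring_ind: f => [c|i|p q pE qE|p q pE qE].
- by rewrite scale_outC hornerC comp_mpolyC.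
- rewrite scale_outX comp_mpolyXU -tnth_nth tnth_mktuple.
  by case: ifP => _; rewrite ?hornerMX hornerC ?mulr0.
- by rewrite scale_outD hornerD comp_mpolyD; congr (_ + _).
- by rewrite scale_outM hornerM rmorphM; congr (_ * _).
Qed.

(** Degrees in the new variable add up, so the image of d is constant in it. Its value at 1 is d,
    and its value at 0 is d with the variables outside P set to 0. *)
Lemma scale_out_divides P f d : scale_out P f = f%:P -> f != 0 -> divides d f ->
  d = d \mPo [tuple if P i then 'X_i else 0 | i < n].
Proof.
move=> fP f0 [e fE]; have E : scale_out P d * scale_out P e = f%:P.
  by rewrite -scale_outM -fE.
have [d0 e0] : scale_out P d != 0 /\ scale_out P e != 0.
  by apply/andP; rewrite -negb_or -mulf_eq0 E polyC_eq0.
have : (size (scale_out P d) <= 1)%N.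
  have sz (a b : {poly S}) : a != 0 -> b != 0 -> size (a * b) = 1%N -> (size a <= 1)%N.
    move=> a0 b0; rewrite size_mul //.
    move: a0 b0; rewrite -(size_poly_gt0 a) -(size_poly_gt0 b).
    by case: (size a) => [|[|k]]; case: (size b) => // l; rewrite !addSn addnS.
  by apply: sz d0 e0 _; rewrite E size_polyC f0.
by move=> /size1_polyC dE; rewrite -scale_out_eval0 -[LHS](scale_out1 P) dE !hornerC.
Qed.

(** A common divisor is unchanged when the variables of either set are replaced by 0, so it is a
    constant. *)
Lemma disjoint_coprime P f g : f != 0 -> g != 0 ->
  scale_out P f = f%:P -> scale_out (predC P) g = g%:P ->
  forall d, divides d f -> divides d g -> d \is a GRing.unit.
Proof.
move=> f0 g0 fP gP d df dg; have [e fE] := df.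
have d0 : d != 0 by apply: contraNneq f0 => d0; rewrite fE d0 mul0r.
pose c := d.@[fun=> 0]; have dE : d = c%:MP.
  have := scale_out_divides gP g0 dg; rewrite {2}(scale_out_divides fP f0 df) => dE.
  rewrite {1}dE /c; pose t k : {rmorphism S -> S} := comp_mpoly
    [tuple if (if k then P i else predC P i) then 'X_i else (0 : S) | i < n].
  apply: (@mpoly_morph_ext C S n (t false \o t true) (@mpolyC n C \o meval (fun=> 0))) => [e'|i] /=.
    by rewrite !comp_mpolyC mevalC.
  rewrite comp_mpolyXU -tnth_nth tnth_mktuple mevalXU mpolyC0.
  case: ifP => Pi; last by rewrite comp_mpoly0.
  by rewrite comp_mpolyXU -tnth_nth tnth_mktuple /= Pi.
by rewrite dE; apply: mpolyC_unit; apply: contraNneq d0 => c0; rewrite dE c0 mpolyC0.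
Qed.
End DisjointVariables.

(** * Polynomials in four variables *)

Section FourVariables.
Variable C : fieldType.
Local Notation S := {mpoly C[4]}.

Definition var4 k : S := 'X_(inord k).

Lemma sum_ord4 (V : nmodType) (F : 'I_4 -> V) :
  \sum_(i < 4) F i = F (inord 0) + F (inord 1) + F (inord 2) + F (inord 3).
Proof.
rewrite !big_ord_recr big_ord0 /= add0r.
by congr (F _ + F _ + F _ + F _); apply: val_inj; rewrite /= inordK.
Qed.

Lemma ord4_ind (P : 'I_4 -> Prop) : P (inord 0) -> P (inord 1) -> P (inord 2) ->
  P (inord 3) -> forall i, P i.
Proof.
by move=> P0 P1 P2 P3 [[|[|[|[|//]]]] Hk]; set i := Ordinal Hk;
  [have -> : i = inord 0 | have -> : i = inord 1 | have -> : i = inord 2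
  |have -> : i = inord 3] => //; apply: val_inj; rewrite /= inordK.
Qed.

Lemma mxact_var4 rows k : (k < 4)%N -> mxact (mx_of C 4 4 rows) (var4 k) =
  let row := nth [::] rows k in
  (nth 0 row 0)%:~R *: var4 0 + (nth 0 row 1)%:~R *: var4 1 +
  (nth 0 row 2)%:~R *: var4 2 + (nth 0 row 3)%:~R *: var4 3.
Proof. by move=> k4; rewrite mxact_mx_of sum_ord4 !inordK. Qed.

Lemma var4X (i : 'I_4) : 'X_i = var4 i.
Proof. by rewrite /var4 inord_val. Qed.

Lemma TvarE r (i : 'I_r.+1) : 'X_i = Tvar C r i.+1.
Proof. by rewrite /Tvar /= inord_val. Qed.

(* The parametrisation T_j |-> tau_j, for T numbered from 1 as in [Tvar].     *)
Definition param r (tau : seq S) (p : {mpoly C[r]}) : S :=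
  p \mPo [tuple nth 0 tau i | i < r].

Lemma param_is_zmod_morphism r tau : zmod_morphism (@param r tau).
Proof. by move=> p q; rewrite /param rmorphB. Qed.

Lemma param_is_monoid_morphism r tau : monoid_morphism (@param r tau).
Proof. by split=> [|p q]; rewrite /param ?rmorph1 // rmorphM. Qed.

HB.instance Definition _ r tau := GRing.isZmodMorphism.Build {mpoly C[r]} S
  (@param r tau) (@param_is_zmod_morphism r tau).
HB.instance Definition _ r tau := GRing.isMonoidMorphism.Build {mpoly C[r]} S
  (@param r tau) (@param_is_monoid_morphism r tau).

Lemma paramC r tau c : @param r tau c%:MP = c%:MP.
Proof. exact: comp_mpolyC. Qed.

Lemma paramX r tau i : @param r tau 'X_i = nth 0 tau i.
Proof. by rewrite /param comp_mpolyXU -tnth_nth tnth_mktuple. Qed.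

Lemma param_Tvar r tau j : (j.-1 < r.+1)%N -> param tau (Tvar C r j) = nth 0 tau j.-1.
Proof. by move=> jr; rewrite paramX inordK. Qed.
End FourVariables.


(** * The quotient by the dihedral group of order eight *)

(** Stated over any ring, in order to be evaluated at the variables, at their classes in a quotient
    and at the semi-invariants. *)
Definition D8_rel (R : comNzRingType) (T : nat -> R) : seq R := [::
  T 5 * T 8 + T 4 * T 9 - 2 * T 6 * T 10;
  T 3 * T 8 + T 1 * T 9 - T 2 * T 10;
  T 7 ^+ 2 - T 8 * T 9 + T 10 ^+ 2;
  T 6 * T 7 + 2 * T 1 * T 9 - T 2 * T 10;
  T 5 * T 7 + T 2 * T 9 - 2 * T 3 * T 10;
  T 4 * T 7 - T 2 * T 8 + 2 * T 1 * T 10;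
  2 * T 3 * T 7 - T 6 * T 9 + T 5 * T 10;
  T 2 * T 7 - T 4 * T 9 + T 6 * T 10;
  2 * T 1 * T 7 + T 6 * T 8 - T 4 * T 10;
  T 4 * T 5 - T 6 ^+ 2 + T 8 * T 9 - T 10 ^+ 2;
  T 2 * T 5 - 2 * T 3 * T 6 + T 7 * T 9;
  2 * T 1 * T 5 - T 2 * T 6 + T 7 * T 10;
  T 3 * T 4 - T 1 * T 5 - T 7 * T 10;
  T 2 * T 4 - 2 * T 1 * T 6 - T 7 * T 8;
  4 * T 3 ^+ 2 + T 5 ^+ 2 - T 9 ^+ 2;
  2 * T 2 * T 3 + T 5 * T 6 - T 9 * T 10;
  4 * T 1 * T 3 + T 6 ^+ 2 - T 10 ^+ 2;
  T 2 ^+ 2 + T 6 ^+ 2 - T 8 * T 9;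
  2 * T 1 * T 2 + T 4 * T 6 - T 8 * T 10;
  4 * T 1 ^+ 2 + T 4 ^+ 2 - T 8 ^+ 2].

Lemma D8_relationsE (C : fieldType) : D8_relations C = D8_rel (@Tvar C 9).
Proof. by []. Qed.

Lemma D8_rel_map (R R' : comNzRingType) (u : {rmorphism R -> R'}) (T : nat -> R) :
  map u (D8_rel T) = D8_rel (u \o T).
Proof.
by rewrite /D8_rel /=; do !(congr (_ :: _); first by rewrite /=; ring).
Qed.

(* The relations between the products y_ab = x_a x_b, sorted so that each     *)
(* right hand side is y_ab y_cd with a <= b <= c <= d.                        *)
Section Veronese.
Variables (Q : comNzRingType) (y00 y01 y02 y03 y11 y12 y13 y22 y23 y33 : Q).
Hypothesis e1 : y01 * y01 = y00 * y11.
Hypothesis e2 : y01 * y02 = y00 * y12.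
Hypothesis e3 : y01 * y03 = y00 * y13.
Hypothesis e4 : y02 * y02 = y00 * y22.
Hypothesis e5 : y02 * y03 = y00 * y23.
Hypothesis e6 : y02 * y11 = y01 * y12.
Hypothesis e7 : y02 * y12 = y01 * y22.
Hypothesis e8 : y02 * y13 = y01 * y23.
Hypothesis e9 : y03 * y03 = y00 * y33.
Hypothesis e10 : y03 * y11 = y01 * y13.
Hypothesis e11 : y03 * y12 = y01 * y23.
Hypothesis e12 : y03 * y13 = y01 * y33.
Hypothesis e13 : y03 * y22 = y02 * y23.
Hypothesis e14 : y03 * y23 = y02 * y33.
Hypothesis e15 : y12 * y12 = y11 * y22.
Hypothesis e16 : y12 * y13 = y11 * y23.
Hypothesis e17 : y13 * y13 = y11 * y33.
Hypothesis e18 : y13 * y22 = y12 * y23.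
Hypothesis e19 : y13 * y23 = y12 * y33.
Hypothesis e20 : y23 * y23 = y22 * y33.

Definition veronese (a b : 'I_4) : Q := nth 0 (nth [::] [::
  [:: y00; y01; y02; y03]; [:: y01; y11; y12; y13];
  [:: y02; y12; y22; y23]; [:: y03; y13; y23; y33]] a) b.

Lemma veroneseC a b : veronese a b = veronese b a.
Proof.
rewrite /veronese; move: a b.
by elim/ord4_ind; elim/ord4_ind; rewrite !inordK.
Qed.

Lemma veroneseX a b c d :
  veronese a b * veronese c d = veronese a c * veronese b d.
Proof.
(* These rules bring each product of two entries to sorted form, in either order of the factors;
   both sides have the same sorted form. *)
pose sym := (e1, e2, e3, e4, e5, e6, e7, e8, e9, e10, e11, e12, e13, e14, e15, e16, e17, e18,
  e19, e20, etrans (mulrC y01 y01) e1, etrans (mulrC y02 y01) e2, etrans (mulrC y03 y01) e3,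
  etrans (mulrC y02 y02) e4, etrans (mulrC y03 y02) e5, etrans (mulrC y11 y02) e6, etrans (mulrC
  y12 y02) e7, etrans (mulrC y13 y02) e8, etrans (mulrC y03 y03) e9, etrans (mulrC y11 y03) e10,
  etrans (mulrC y12 y03) e11, etrans (mulrC y13 y03) e12, etrans (mulrC y22 y03) e13, etrans
  (mulrC y23 y03) e14, etrans (mulrC y12 y12) e15, etrans (mulrC y13 y12) e16, etrans (mulrC y13
  y13) e17, etrans (mulrC y22 y13) e18, etrans (mulrC y23 y13) e19, etrans (mulrC y23 y23) e20,
  mulrC y01 y00, mulrC y02 y00, mulrC y03 y00, mulrC y11 y00, mulrC y12 y00, mulrC y13 y00,
  mulrC y22 y00, mulrC y23 y00, mulrC y33 y00, mulrC y11 y01, mulrC y12 y01, mulrC y13 y01,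
  mulrC y22 y01, mulrC y23 y01, mulrC y33 y01, mulrC y22 y02, mulrC y23 y02, mulrC y33 y02,
  mulrC y33 y03, mulrC y12 y11, mulrC y13 y11, mulrC y22 y11, mulrC y23 y11, mulrC y33 y11,
  mulrC y22 y12, mulrC y23 y12, mulrC y33 y12, mulrC y33 y13, mulrC y23 y22, mulrC y33 y22,
  mulrC y33 y23).
rewrite /veronese; move: a b c d.
elim/ord4_ind; elim/ord4_ind; elim/ord4_ind; elim/ord4_ind; rewrite !inordK //=.
all: by rewrite ?sym.
Qed.
End Veronese.

Section D8Quotient.
Variables (Q : comNzRingType) (t : nat -> Q) (h : Q).
Hypothesis t_rel : all (fun g => g == 0) (D8_rel t).
Hypothesis h2 : 2 * h = 1.

Let r_ k : nth 0 (D8_rel t) k = 0.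
Proof.
have [ks|ks] := ltnP k (size (D8_rel t)); last by rewrite nth_default.
by apply/eqP; move/(all_nthP 0): t_rel => /(_ k ks).
Qed.

Local Notation R k := (nth 0 (D8_rel t) k).
(** The ten quadratic monomials, solved from the generators listed in [D8_tau] with h = 1/2. *)
Local Notation y00 := (h * (t 8 + t 4)).
Local Notation y01 := (h * (2 * t 1)).
Local Notation y02 := (h * (t 10 + t 6)).
Local Notation y03 := (h * (t 2 + t 7)).
Local Notation y11 := (h * (t 8 - t 4)).
Local Notation y12 := (h * (t 2 - t 7)).
Local Notation y13 := (h * (t 10 - t 6)).
Local Notation y22 := (h * (t 9 + t 5)).
Local Notation y23 := (h * (2 * t 3)).
Local Notation y33 := (h * (t 9 - t 5)).

Definition D8_y := veronese y00 y01 y02 y03 y11 y12 y13 y22 y23 y33.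

(** The argument is a certificate: the identity as a combination of the relations, up to the factor
    [h * h]. *)
Ltac from_relations c := apply/eqP; rewrite -subr_eq0; apply/eqP; transitivity (h * h * c);
  [by rewrite /=; ring | by rewrite !r_ ?(mulr0, oppr0, addr0)].

Let c1 : y01 * y01 = y00 * y11. Proof. from_relations (R 19). Qed.
Let c2 : y01 * y02 = y00 * y12. Proof. from_relations (R 5 - R 13). Qed.
Let c3 : y01 * y03 = y00 * y13. Proof. from_relations (R 8 + R 18). Qed.
Let c4 : y02 * y02 = y00 * y22. Proof. from_relations (- R 0 - R 9). Qed.
Let c5 : y02 * y03 = y00 * y23. Proof. from_relations ((- 2) * R 1 + R 3 - R 11 - 2 * R 12). Qed.
Let c6 : y02 * y11 = y01 * y12. Proof. from_relations (R 8 - R 18). Qed.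
Let c7 : y02 * y12 = y01 * y22. Proof. from_relations (- R 3 - R 11). Qed.
Let c8 : y02 * y13 = y01 * y23. Proof. from_relations (- R 16). Qed.
Let c9 : y03 * y03 = y00 * y33. Proof. from_relations (R 0 + R 2 + 2 * R 7 + R 9 + R 17). Qed.
Let c10 : y03 * y11 = y01 * y13. Proof. from_relations (- R 5 - R 13). Qed.
Let c11 : y03 * y12 = y01 * y23. Proof. from_relations (- R 2 - R 16 + R 17). Qed.
Let c12 : y03 * y13 = y01 * y33. Proof. from_relations (- R 3 + R 11). Qed.
Let c13 : y03 * y22 = y02 * y23. Proof. from_relations (R 4 + R 10). Qed.
Let c14 : y03 * y23 = y02 * y33. Proof. from_relations (R 6 + R 15). Qed.
Let c15 : y12 * y12 = y11 * y22. Proof. from_relations (- R 0 + R 2 - 2 * R 7 + R 9 + R 17). Qed.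
Let c16 : y12 * y13 = y11 * y23. Proof. from_relations ((- 2) * R 1 + R 3 + R 11 + 2 * R 12). Qed.
Let c17 : y13 * y13 = y11 * y33. Proof. from_relations (R 0 - R 9). Qed.
Let c18 : y13 * y22 = y12 * y23. Proof. from_relations (R 6 - R 15). Qed.
Let c19 : y13 * y23 = y12 * y33. Proof. from_relations (- R 4 + R 10). Qed.
Let c20 : y23 * y23 = y22 * y33. Proof. from_relations (R 14). Qed.

Lemma D8_yC a b : D8_y a b = D8_y b a.
Proof. exact: veroneseC. Qed.

Lemma D8_yX a b c d : D8_y a b * D8_y c d = D8_y a c * D8_y b d.
Proof. by rewrite /D8_y; apply: veroneseX. Qed.
End D8Quotient.


(** * Weights modulo an integer *)

Section WeightModulo.
Variables (R : comNzRingType) (n k : nat) (f : 'X_{1..n} -> nat).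
Hypothesis f0 : f 0%MM = 0%N.
Hypothesis fD : forall m m', f (m + m')%MM = (f m + f m')%N.
Implicit Types p q : {mpoly R[n]}.

Definition wt_mod c p := forall m, m \in msupp p -> f m = c %[mod k].

Lemma wt_modD c p q : wt_mod c p -> wt_mod c q -> wt_mod c (p + q).
Proof. by move=> cp cq m /msuppD_le; rewrite mem_cat => /orP[/cp|/cq]. Qed.

Lemma wt_modN c p : wt_mod c p -> wt_mod c (- p).
Proof. by move=> cp m; rewrite (perm_mem (msuppN p)) => /cp. Qed.

Lemma wt_modM c d e p q : e = (c + d)%N %[mod k] -> wt_mod c p -> wt_mod d q ->
  wt_mod e (p * q).
Proof.
move=> E cp dq m /msuppM_le/allpairsP[[m1 m2] [/cp E1 /dq E2 ->]] /=.
by rewrite fD E -modnDm E1 E2 modnDm.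
Qed.

Lemma wt_modX i c : f U_(i)%MM = c -> wt_mod c ('X_i : {mpoly R[n]}).
Proof. by move=> <- m; rewrite msuppX inE => /eqP->. Qed.

Lemma wt_modC a : wt_mod 0 a%:MP.
Proof. by move=> m; rewrite msuppC; case: eqP => //= _; rewrite inE => /eqP->; rewrite f0. Qed.
End WeightModulo.

Section DiagonalAction.
Variables (C : fieldType) (n : nat) (g : {rmorphism {mpoly C[n]} -> {mpoly C[n]}}).
Variables (z : C) (e : 'I_n -> nat).
Hypothesis gC : forall c, g c%:MP = c%:MP.
Hypothesis gX : forall i, g 'X_i = (z ^+ e i)%:MP * 'X_i.

(** Monomials are eigenvectors, and comparing coefficients at m leaves only the eigenvalue 1. *)
Lemma diagonal_fixed p m : g p = p -> m \in msupp p ->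
  z ^+ (\sum_(i < n) e i * m i) = 1.
Proof.
move=> gp mp; have gm k : g 'X_[k] = (z ^+ (\sum_(i < n) e i * k i))%:MP * 'X_[k].
  rewrite mpolyXE_id rmorph_prod expr_sum rmorph_prod -big_split.
  by apply: eq_bigr => i _; rewrite rmorphXn /= gX exprMn -rmorphXn exprM.
have key q : (g q)@_m = z ^+ (\sum_(i < n) e i * m i) * q@_m.
  elim/mpolyind: q => [|c k q _ _ IH]; first by rewrite rmorph0 mcoeff0 mulr0.
  rewrite rmorphD !mcoeffD IH mulrDr; congr (_ + _).
  rewrite -mul_mpolyC rmorphM /= gC gm mulrA -mpolyCM !mcoeffCM mcoeffX.
  by case: (k =P m) => [->|_]; rewrite ?mulr0 // !mulr1 mulrC.
have := key p; rewrite gp => E; apply: (@mulIf _ p@_m).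
  by rewrite -mcoeff_msupp.
by rewrite -E mul1r.
Qed.
End DiagonalAction.

Lemma odd_Z2D : {morph (fun u : 'Z_2 => odd u) : u v / u + v >-> u (+) v}.
Proof. by move=> u v; rewrite /= odd_mod // oddD. Qed.

Lemma odd_Z2_inj (u v : 'Z_2) : odd u = odd v -> u = v.
Proof. by case: u v => [[|[|]] // ?] [[|[|]] // ?] //= _; apply: val_inj. Qed.

Lemma Z2_addww (u : 'Z_2) : u + u = 0.
Proof. by apply: odd_Z2_inj; rewrite odd_Z2D addbb. Qed.

Lemma nat_Z2_odd (b : bool) : odd (b%:R : 'Z_2) = b.
Proof. by case: b. Qed.

Definition Z2xZ2 : finZmodType := HB.pack_for finZmodType ('Z_2 * 'Z_2)%type.

(** * Even polynomials, parametrised by quadratic semi-invariants *)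

Section D8Parametrisation.
Variable C : numClosedFieldType.
Local Notation S := {mpoly C[4]}.
Local Notation x := (@var4 C).

(** A basis of the quadratic forms consisting of semi-invariants, with characters given by
    [D8_degrees]. The commutator subgroup consists of 1 and -1, so quadratic forms generate its
    invariants. *)
Definition D8_tau : seq S := [::
  x 0 * x 1; x 0 * x 3 + x 1 * x 2; x 2 * x 3; x 0 * x 0 - x 1 * x 1;
  x 2 * x 2 - x 3 * x 3; x 0 * x 2 - x 1 * x 3; x 0 * x 3 - x 1 * x 2;
  x 0 * x 0 + x 1 * x 1; x 2 * x 2 + x 3 * x 3; x 0 * x 2 + x 1 * x 3].

Local Notation ev := (@param C 10 D8_tau).

Lemma D8_tau_rel : all (fun g => g == 0) (D8_rel (ev \o @Tvar C 9)).
Proof.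
rewrite /D8_rel /= !param_Tvar //=.
by do !(apply/andP; split=> //; first by apply/eqP; ring).
Qed.

Lemma D8_ev_rel g : g \in D8_relations C -> ev g = 0.
Proof.
rewrite D8_relationsE => /(map_f ev); rewrite D8_rel_map.
by move/(allP D8_tau_rel)/eqP.
Qed.
End D8Parametrisation.


Section D8Presentation.
Variable C : numClosedFieldType.
Local Notation S := {mpoly C[4]}.
Local Notation x := (@var4 C).
Local Notation ev := (@param C 10 (D8_tau C)).

Lemma D8_tau_even k : wt_mod 2 (@mdeg 4) 0 (nth 0 (D8_tau C) k).
Proof.
have xE i c : c = 1%N -> wt_mod 2 (@mdeg 4) c (x i).
  by move=> ->; apply: wt_modX; rewrite mdeg1.
have xx i l : wt_mod 2 (@mdeg 4) 0 (x i * x l).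
  by apply: (@wt_modM _ _ _ _ (@mdegD 4) 1 1) => //; exact: xE.
have xxB i l i' l' : wt_mod 2 (@mdeg 4) 0 (x i * x l - x i' * x l').
  by apply: wt_modD => //; exact: wt_modN.
have xxD i l i' l' : wt_mod 2 (@mdeg 4) 0 (x i * x l + x i' * x l').
  exact: wt_modD.
by do 10?[case: k => [|k] //=]; rewrite nth_nil => m; rewrite msupp0.
Qed.

Lemma D8_ev_ker p :
  ev p = 0 <-> ideal_gen (fun=> True) (fun g => g \in D8_relations C) p.
Proof.
apply: (ker_of_monomial_section (P := fun m => ~~ odd (mdeg m))) => {p}.
- exact: paramC.
- exact: D8_ev_rel.
- by rewrite mdeg0.
- by move=> m m' /negPf m2 /negPf m'2; rewrite mdegD oddD m2 m'2.
- by move=> i m; rewrite /= paramX => /D8_tau_even; rewrite modn2 unfold_in; case: odd.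
move=> Q pi piP; pose t := pi \o @Tvar C 9; pose h := pi (2^-1)%:MP.
have t_rel : all (fun g => g == 0) (D8_rel t).
  rewrite -D8_rel_map -D8_relationsE; apply/allP => _ /mapP[g gr ->].
  by rewrite piP.
have h2 : 2 * h = 1.
  by rewrite /h -[2](rmorph_nat pi) -rmorphM -mpolyC_nat -mpolyCM divff ?mpolyC1 ?rmorph1 ?pnatr_eq0.
pose y := D8_y t h; have yC := D8_yC t h; have yX := D8_yX h t_rel.
exists (fun m => pairword y (mword m)); split=> [|m m' m2 m'2|i].
- by rewrite mword0.
- rewrite (pairword_perm yC yX _ (perm_mwordD m m')) ?size_mword ?mdegD ?oddD.
    by rewrite pairword_cat // size_mword.
  by rewrite (negPf m2) (negPf m'2).
set l := linext _ _; have lx i' k' : l (x i' * x k') = y (inord i') (inord k').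
  rewrite /l -mpolyXD linextX (pairword_perm yC yX _ (perm_mwordDU _ _)).
    by rewrite /= mulr1.
  by rewrite size_mword mdegD !mdeg1.
have lD p q : l (p + q) = l p + l q by exact: raddfD.
have lB p q : l (p - q) = l p - l q by exact: raddfB.
rewrite /= paramX TvarE -[RHS]/(t i.+1); have := ltn_ord i.
case: {i} (val i) => [|[|[|[|[|[|[|[|[|[|//]]]]]]]]]] _ /=;
  by rewrite ?lB ?lD !lx /y /D8_y /veronese !inordK //= -[RHS]mul1r -[X in _ = X * _]h2; ring.
Qed.

Lemma D8_even_onto f : wt_mod 2 (@mdeg 4) 0 f -> exists p, ev p = f.
Proof.
have pairs a b : exists p, ev p = 'X_a * 'X_b.
  exists (D8_y (Tvar C 9) (2^-1)%:MP a b); rewrite !var4X.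
  have h2 : 2 * ev (2^-1)%:MP = 1.
    by rewrite paramC -mpolyC_nat -mpolyCM divff ?mpolyC1 ?pnatr_eq0.
  move: a b; rewrite /D8_y /veronese.
  elim/ord4_ind; elim/ord4_ind; rewrite !inordK //= rmorphM;
    rewrite ?(rmorphD, rmorphN, rmorphM) /= !param_Tvar //= -[RHS]mul1r -[X in _ = X * _]h2; ring.
have words s : ~~ odd (size s) -> exists p, ev p = 'X_[word_mnm s].
  have [k] := ubnP (size s); elim: k s => // k IH [|a [|b s]] //= sk.
    by exists 1; rewrite rmorph1 /word_mnm big_nil mpolyX0.
  rewrite negbK => /(IH s (ltnW sk))[p pE]; have [q qE] := pairs a b.
  by exists (q * p); rewrite rmorphM /= qE pE !word_mnm_cons mulrA.
move=> fE; rewrite [f]mpolyE big_seq; elim/big_ind: _ => [|f1 f2 [p1 <-] [p2 <-]|m mf].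
- by exists 0; rewrite rmorph0.
- by exists (p1 + p2); rewrite rmorphD.
have [|p pE] := words (mword m).
  by rewrite size_mword; move: (fE m mf); rewrite modn2; case: odd.
by exists ((f@_m)%:MP * p); rewrite rmorphM /= paramC pE mword_mnmK mul_mpolyC.
Qed.
End D8Presentation.


Lemma meval_neq0 (R : comNzRingType) n (p : {mpoly R[n]}) v : p.@[v] != 0 -> p != 0.
Proof. by apply: contraNneq => ->; rewrite meval0. Qed.

(** * The characters of the dihedral group of order eight *)

Section D8Cox.
Variable C : numClosedFieldType.
Local Notation S := {mpoly C[4]}.
Local Notation x := (@var4 C).
Local Notation ev := (@param C 10 (D8_tau C)).

Let D8_r_rows : seq (seq int) := [:: [:: 0; -1; 0;  0];
  [:: 1;  0; 0;  0]; [:: 0;  0; 0; -1]; [:: 0;  0; 1;  0]].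
Let D8_s_rows : seq (seq int) := [:: [:: 1;  0; 0;  0];
  [::  0; -1; 0;  0]; [::  0;  0; 1;  0]; [::  0;  0; 0; -1]].
Let r := mx_of C 4 4 D8_r_rows.
Let s := mx_of C 4 4 D8_s_rows.

Let mxactE := (mulr0z, mulr1z, mulrN1z, scale0r, scale1r, scaleN1r, add0r, addr0).

Let r0 : mxact r (x 0) = - x 1. Proof. by rewrite mxact_var4 //= !mxactE. Qed.
Let r1 : mxact r (x 1) = x 0. Proof. by rewrite mxact_var4 //= !mxactE. Qed.
Let r2 : mxact r (x 2) = - x 3. Proof. by rewrite mxact_var4 //= !mxactE. Qed.
Let r3 : mxact r (x 3) = x 2. Proof. by rewrite mxact_var4 //= !mxactE. Qed.
Let s0 : mxact s (x 0) = x 0. Proof. by rewrite mxact_var4 //= !mxactE. Qed.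
Let s1 : mxact s (x 1) = - x 1. Proof. by rewrite mxact_var4 //= !mxactE. Qed.
Let s2 : mxact s (x 2) = x 2. Proof. by rewrite mxact_var4 //= !mxactE. Qed.
Let s3 : mxact s (x 3) = - x 3. Proof. by rewrite mxact_var4 //= !mxactE. Qed.
Let actE := (r0, r1, r2, r3, s0, s1, s2, s3).

Let chi1 (w : Z2xZ2) := odd w.1.
Let chi2 (w : Z2xZ2) := odd w.2.

Let ss1 : s *m s = 1%:M.
Proof. by rewrite /s mx_of_mul -mx_of_id. Qed.

Let rsrs1 : r *m s *m (r *m s) = 1%:M.
Proof. by rewrite /r /s !mx_of_mul -mx_of_id. Qed.

Let r41 f : iter 4 (mxact r) f = f.
Proof.
rewrite iter_mxact -[RHS]mxact1; congr (mxact _ f).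
by rewrite /= mulmx1 /r !mx_of_mul -mx_of_id.
Qed.

Let W2 (w : Z2xZ2) : w + w = 0.
Proof. by case: w => u v; congr (_, _); exact: Z2_addww. Qed.

Let chi1D : {morph chi1 : u v / u + v >-> u (+) v}.
Proof. by move=> u v; exact: odd_Z2D. Qed.

Let chi2D : {morph chi2 : u v / u + v >-> u (+) v}.
Proof. by move=> u v; exact: odd_Z2D. Qed.

Let chi_inj u v : chi1 u = chi1 v -> chi2 u = chi2 v -> u = v.
Proof.
case: u v => [u1 u2] [v1 v2] /odd_Z2_inj /= -> /odd_Z2_inj /= ->.
by [].
Qed.

Let chi_onto (b1 b2 : bool) : ~~ (b1 && odd 4) -> exists w, chi1 w = b1 /\ chi2 w = b2.
Proof.
by move=> _; exists ((b1%:R : 'Z_2), (b2%:R : 'Z_2)); rewrite /chi1 /chi2 !nat_Z2_odd.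
Qed.

Let in01 : pred 'I_4 := fun i => (i < 2)%N.

Let semi := (semi_inv r s chi1 chi2).

Let out1 k : (k < 2)%N -> scale_out in01 (x k) = (x k)%:P.
Proof. by move=> k2; rewrite scale_outX /in01 inordK ?k2 //; exact: leq_trans k2 _. Qed.

Let out2 k : (1 < k < 4)%N -> scale_out (predC in01) (x k) = (x k)%:P.
Proof. by case/andP=> k1 k4; rewrite scale_outX /= /in01 inordK // ltnNge k1. Qed.

Let coprime_pair w : exists b b', [/\ semi w b, semi w b' &
  forall d, divides d b -> divides d b' -> d \is a GRing.unit].
Proof.
(* Each nontrivial character has a semi-invariant in the first two variables and a copy of it in the
   last two, hence coprime. Evaluation at the point (2, 3, 4, 5) shows that they are nonzero. *)
pose v (i : 'I_4) : C := (i.+2)%:R.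
have vE k : (k < 4)%N -> (x k).@[v] = k.+2%:R by move=> k4; rewrite mevalXU /v inordK.
have semiE b c1 c2 : chi1 w = c1 -> chi2 w = c2 -> mxact r b = (-1) ^+ c1 * b ->
    mxact s b = (-1) ^+ c2 * b -> semi w b by move=> <- <-.
case E1: (chi1 w); case E2: (chi2 w).
- exists (x 0 * x 1), (x 2 * x 3); split.
  + by apply: (semiE _ _ _ E1 E2); rewrite rmorphM /= !actE; ring.
  + by apply: (semiE _ _ _ E1 E2); rewrite rmorphM /= !actE; ring.
  apply: (disjoint_coprime (P := in01)).
  + by apply: (@meval_neq0 _ _ _ v); rewrite mevalM !vE // -natrM pnatr_eq0.
  + by apply: (@meval_neq0 _ _ _ v); rewrite mevalM !vE // -natrM pnatr_eq0.
  + by rewrite scale_outM !out1 // polyCM.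
  + by rewrite scale_outM !out2 // polyCM.
- exists (x 0 * x 0 - x 1 * x 1), (x 2 * x 2 - x 3 * x 3); split.
  + by apply: (semiE _ _ _ E1 E2); rewrite rmorphB !rmorphM /= !actE; ring.
  + by apply: (semiE _ _ _ E1 E2); rewrite rmorphB !rmorphM /= !actE; ring.
  apply: (disjoint_coprime (P := in01)).
  + apply: (@meval_neq0 _ _ _ v); rewrite mevalB !mevalM !vE //.
    by rewrite (_ : _ - _ = - 5%:R) ?oppr_eq0 ?pnatr_eq0 //; ring.
  + apply: (@meval_neq0 _ _ _ v); rewrite mevalB !mevalM !vE //.
    by rewrite (_ : _ - _ = - 9%:R) ?oppr_eq0 ?pnatr_eq0 //; ring.
  + by rewrite -mulN1r !(scale_outD, scale_outM) -mpolyC1 -mpolyCN !scale_outC !out1 // -!polyCM -polyCD.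
  + by rewrite -mulN1r !(scale_outD, scale_outM) -mpolyC1 -mpolyCN !scale_outC !out2 // -!polyCM -polyCD.
- exists (x 0 * x 1 * (x 0 * x 0 - x 1 * x 1)), (x 2 * x 3 * (x 2 * x 2 - x 3 * x 3)); split.
  + by apply: (semiE _ _ _ E1 E2); rewrite !rmorphM rmorphB !rmorphM /= !actE; ring.
  + by apply: (semiE _ _ _ E1 E2); rewrite !rmorphM rmorphB !rmorphM /= !actE; ring.
  apply: (disjoint_coprime (P := in01)).
  + apply: (@meval_neq0 _ _ _ v); rewrite !mevalM mevalB !mevalM !vE //.
    by rewrite (_ : _ * _ = - 30%:R) ?oppr_eq0 ?pnatr_eq0 //; ring.
  + apply: (@meval_neq0 _ _ _ v); rewrite !mevalM mevalB !mevalM !vE //.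
    by rewrite (_ : _ * _ = - 180%:R) ?oppr_eq0 ?pnatr_eq0 //; ring.
  + by rewrite -mulN1r !(scale_outD, scale_outM) -mpolyC1 -mpolyCN !scale_outC !out1 // -!polyCM -polyCD -polyCM.
  + by rewrite -mulN1r !(scale_outD, scale_outM) -mpolyC1 -mpolyCN !scale_outC !out2 // -!polyCM -polyCD -polyCM.
- exists 1, 1; split; first by apply: (semiE _ _ _ E1 E2); rewrite rmorph1 mulr1.
    by apply: (semiE _ _ _ E1 E2); rewrite rmorph1 mulr1.
  by move=> d /divides_unit H _; apply: H; exact: unitr1.
Qed.

Let D8_tau_semi i : semi ((D8_degrees 0 i, D8_degrees 1 i) : Z2xZ2) (ev 'X_i).
Proof.
rewrite paramX /semi /semi_inv /chi1 /chi2 /= /D8_degrees !mxE /=.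
case: i => [[|[|[|[|[|[|[|[|[|[|//]]]]]]]]]] Hi]; split;
  rewrite /= ?(rmorphB, rmorphD, rmorphM) /= ?rmorphM /= !actE; ring.
Qed.

Lemma D8_cox_presentation :
  cox_presentation (inv_const (gengroup (D8_gens C)))
    (fun j => (D8_degrees 0 j, D8_degrees 1 j) : 'Z_2 * 'Z_2) (D8_relations C).
Proof.
pose G := semi_inv_grading ss1 rsrs1 r41 W2 chi1D chi2D chi_inj chi_onto coprime_pair.
apply: (@cox_presentation_of_grading _ _ Z2xZ2 G C _ 10 _ _ ev) => //.
- by move=> c; rewrite /= paramC.
- exact: D8_ev_ker.
move=> w b [rb sb]; apply: D8_even_onto => m mb.
(* The square of r is -1 and generates the commutator subgroup; it fixes b, so only monomials of
   even degree occur. *)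
pose g := r *m r; have gX i : mxact g 'X_i = ((-1) ^+ 1)%:MP * 'X_i.
  rewrite -mxactM expr1 mpolyCN mpolyC1 mulN1r; move: i.
  by elim/ord4_ind; rewrite -?/(x 0) -?/(x 1) -?/(x 2) -?/(x 3) !actE ?rmorphN /= ?actE.
have gb : mxact g b = b.
  by rewrite -mxactM rb rmorphM rmorphXn rmorphN1 /= rb signrMK.
have := diagonal_fixed (g := mxact g) (e := fun=> 1%N) (mxactC g) gX gb mb.
under eq_bigr do rewrite mul1n; rewrite -mdegE -signr_odd modn2.
by case: odd => //= /eqP; rewrite expr1 eq_sym -subr_eq0 opprK -mulr2n pnatr_eq0.
Qed.
End D8Cox.


(** * The quotient by the symmetric group of degree three *)

Definition S3_rel (R : comNzRingType) (T : nat -> R) : seq R := [::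
  3 * T 9 * T 10 - T 7 * T 11 + T 6 * T 12;
  3 * T 5 * T 10 - 2 * T 4 * T 11 + T 3 * T 12;
  3 * T 6 * T 8 + T 9 * T 11 - T 7 * T 12;
  3 * T 4 * T 8 - T 2 * T 11 - 2 * T 5 * T 12;
  3 * T 3 * T 8 - 3 * T 2 * T 10 - T 5 * T 11 - T 4 * T 12;
  T 5 * T 7 - 2 * T 4 * T 9 + T 1 * T 12;
  T 4 * T 7 - 2 * T 3 * T 9 + T 1 * T 11;
  T 2 * T 7 - 3 * T 1 * T 8 + 2 * T 5 * T 9;
  T 5 * T 6 - T 3 * T 9 + T 1 * T 11;
  2 * T 4 * T 6 - T 3 * T 7 + 3 * T 1 * T 10;
  T 2 * T 6 + T 4 * T 9 - T 1 * T 12;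
  T 1 * T 5 + 6 * T 9 * T 11 - 3 * T 7 * T 12;
  T 4 ^+ 2 - T 3 * T 5 - 3 * T 11 ^+ 2 + 9 * T 10 * T 12;
  T 2 * T 4 + T 5 ^+ 2 + 9 * T 8 * T 11 - 3 * T 12 ^+ 2;
  T 1 * T 4 + 3 * T 7 * T 11 - 6 * T 6 * T 12;
  T 2 * T 3 + T 4 * T 5 + 27 * T 8 * T 10 - 3 * T 11 * T 12;
  T 1 * T 3 + 9 * T 7 * T 10 - 6 * T 6 * T 11;
  T 1 * T 2 + 9 * T 7 * T 8 - 6 * T 9 * T 12;
  T 1 ^+ 2 + 3 * T 7 ^+ 2 - 12 * T 6 * T 9;
  4 * T 9 ^+ 3 - T 2 ^+ 2 - 27 * T 8 ^+ 2;
  2 * T 7 * T 9 ^+ 2 + T 2 * T 5 - 9 * T 8 * T 12;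
  4 * T 6 * T 9 ^+ 2 - T 5 ^+ 2 - 3 * T 12 ^+ 2;
  2 * T 1 * T 9 ^+ 2 - 9 * T 5 * T 8 - 3 * T 2 * T 12;
  T 7 ^+ 2 * T 9 - 4 * T 6 * T 9 ^+ 2 - 9 * T 8 * T 11 + 3 * T 12 ^+ 2;
  2 * T 6 * T 7 * T 9 - T 4 * T 5 - 3 * T 11 * T 12;
  T 1 * T 7 * T 9 - 3 * T 2 * T 11 - 3 * T 5 * T 12;
  4 * T 6 ^+ 2 * T 9 - T 3 * T 5 - 6 * T 11 ^+ 2 + 9 * T 10 * T 12;
  2 * T 1 * T 6 * T 9 + 3 * T 5 * T 11 - 3 * T 4 * T 12;
  T 7 ^+ 3 - 4 * T 6 * T 7 * T 9 - 27 * T 8 * T 10 + 3 * T 11 * T 12;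
  T 6 * T 7 ^+ 2 - 4 * T 6 ^+ 2 * T 9 + 3 * T 11 ^+ 2 - 9 * T 10 * T 12;
  T 1 * T 7 ^+ 2 - 4 * T 1 * T 6 * T 9 - 9 * T 3 * T 8 - 3 * T 5 * T 11 + 6 * T 4 * T 12;
  2 * T 6 ^+ 2 * T 7 - T 3 * T 4 - 9 * T 10 * T 11;
  T 1 * T 6 * T 7 + 3 * T 4 * T 11 - 3 * T 3 * T 12;
  4 * T 6 ^+ 3 - T 3 ^+ 2 - 27 * T 10 ^+ 2;
  2 * T 1 * T 6 ^+ 2 + 9 * T 4 * T 10 - 3 * T 3 * T 11].

Lemma S3_relationsE (C : fieldType) : S3_relations C = S3_rel (@Tvar C 11).
Proof. by []. Qed.

Lemma S3_rel_map (R R' : comNzRingType) (u : {rmorphism R -> R'}) (T : nat -> R) :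
  map u (S3_rel T) = S3_rel (u \o T).
Proof.
by rewrite /S3_rel /=; do !(congr (_ :: _); first by rewrite /=; ring).
Qed.

(* Here y_ab = u_a v_b, and p_k and q_k are the cubic monomials in u_1, u_2   *)
(* and in v_1, v_2 in which the variable with index 2 has degree k.           *)
Section S3Words.
Variables (Q : comNzRingType) (y11 y22 y12 y21 p0 p1 p2 p3 q0 q1 q2 q3 : Q).

Hypothesis e1 : y12 * y21 = y11 * y22.
Hypothesis e2 : y21 * p0 = y11 * p1.
Hypothesis e3 : y22 * p0 = y12 * p1.
Hypothesis e4 : y12 * q0 = y11 * q1.
Hypothesis e5 : y22 * q0 = y21 * q1.
Hypothesis e6 : y21 * p1 = y11 * p2.
Hypothesis e7 : y22 * p1 = y12 * p2.
Hypothesis e8 : y12 * q1 = y11 * q2.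
Hypothesis e9 : y22 * q1 = y21 * q2.
Hypothesis e10 : y21 * p2 = y11 * p3.
Hypothesis e11 : y22 * p2 = y12 * p3.
Hypothesis e12 : y12 * q2 = y11 * q3.
Hypothesis e13 : y22 * q2 = y21 * q3.
Hypothesis e14 : p1 * p1 = p0 * p2.
Hypothesis e15 : p1 * p2 = p0 * p3.
Hypothesis e16 : p2 * p2 = p1 * p3.
Hypothesis e17 : q1 * q1 = q0 * q2.
Hypothesis e18 : q1 * q2 = q0 * q3.
Hypothesis e19 : q2 * q2 = q1 * q3.
Hypothesis e20 : p0 * q0 = y11 * y11 * y11.
Hypothesis e21 : p0 * q1 = y11 * y11 * y12.
Hypothesis e22 : p0 * q2 = y11 * y12 * y12.
Hypothesis e23 : p0 * q3 = y12 * y12 * y12.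
Hypothesis e24 : p1 * q0 = y11 * y11 * y21.
Hypothesis e25 : p1 * q1 = y11 * y11 * y22.
Hypothesis e26 : p1 * q2 = y11 * y12 * y22.
Hypothesis e27 : p1 * q3 = y12 * y12 * y22.
Hypothesis e28 : p2 * q0 = y11 * y21 * y21.
Hypothesis e29 : p2 * q1 = y11 * y21 * y22.
Hypothesis e30 : p2 * q2 = y11 * y22 * y22.
Hypothesis e31 : p2 * q3 = y12 * y22 * y22.
Hypothesis e32 : p3 * q0 = y21 * y21 * y21.
Hypothesis e33 : p3 * q1 = y21 * y21 * y22.
Hypothesis e34 : p3 * q2 = y21 * y22 * y22.
Hypothesis e35 : p3 * q3 = y22 * y22 * y22.

Definition S3_y (a b : bool) : Q :=
  if a then (if b then y22 else y21) else (if b then y12 else y11).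
Definition S3_p (a b c : bool) : Q := nth 0 [:: p0; p1; p2; p3] (a + b + c).
Definition S3_q (a b c : bool) : Q := nth 0 [:: q0; q1; q2; q3] (a + b + c).

Lemma S3_balanced : balanced S3_y S3_p S3_q.
Proof.
pose sym := (e1, e2, e3, e4, e5, e6, e7, e8, e9, e10, e11, e12, e13, e14, e15, e16, e17, e18,
  e19, etrans (mulrC y21 y12) e1, etrans (mulrC p2 p1) e15, etrans (mulrC q2 q1) e18, mulrC p1
  p0, mulrC p2 p0, mulrC p3 p0, mulrC p3 p1, mulrC p3 p2, mulrC q1 q0, mulrC q2 q0, mulrC q3 q0,
  mulrC q3 q1, mulrC q3 q2, mulrC y12 y11, mulrC y21 y11, mulrC y22 y11, mulrC y22 y12, mulrC
  y22 y21).
split; do !case; rewrite /S3_y /S3_p /S3_q //=.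
all: try by rewrite ?sym.
all: rewrite ?(e20, e21, e22, e23, e24, e25, e26, e27, e28, e29, e30, e31, e32, e33, e34, e35).
all: ring: e1.
Qed.
End S3Words.

Section S3Quotient.
Variables (Q : comNzRingType) (t : nat -> Q) (w h : Q).
Hypothesis t_rel : all (fun g => g == 0) (S3_rel t).
Hypothesis w2 : w * w = - 3.
Hypothesis h54 : 54 * h = 1.

Let r_ k : nth 0 (S3_rel t) k = 0.
Proof.
have [ks|ks] := ltnP k (size (S3_rel t)); last by rewrite nth_default.
by apply/eqP; move/(all_nthP 0): t_rel => /(_ k ks).
Qed.

Local Notation R k := (nth 0 (S3_rel t) k).
(** The products u_a v_b and the cubic monomials in the u and in the v, solved from the generators
    listed in [S3_tau], where w is a square root of -3 and h = 1/54. *)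
Local Notation y11 := (h * (6 * t 9)).
Local Notation y22 := (h * (6 * t 6)).
Local Notation y12 := (h * (3 * t 7 - w * t 1)).
Local Notation y21 := (h * (3 * t 7 + w * t 1)).
Local Notation p0 := (h * (t 2 + 3 * w * t 8)).
Local Notation p1 := (h * (w * t 12 - t 5)).
Local Notation p2 := (h * (w * t 11 - t 4)).
Local Notation p3 := (h * (3 * w * t 10 - t 3)).
Local Notation q0 := (h * (t 2 - 3 * w * t 8)).
Local Notation q1 := (h * (- (w * t 12) - t 5)).
Local Notation q2 := (h * (- (w * t 11) - t 4)).
Local Notation q3 := (h * (- (3 * w * t 10) - t 3)).

Ltac from_relations c := apply/eqP; rewrite -subr_eq0; apply/eqP; transitivity c;
  [by rewrite /=; ring: w2 | by rewrite !r_ ?h54 ?subrr ?(mulr0, mul0r, oppr0, addr0)].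

Let c1 : y12 * y21 = y11 * y22.
Proof. from_relations (h * h * (3 * R 18)). Qed.
Let c2 : y21 * p0 = y11 * p1.
Proof. from_relations (h * h * (3 * R 7 + w * R 17)). Qed.
Let c3 : y22 * p0 = y12 * p1.
Proof. from_relations (h * h * (6 * w * R 2 + 3 * R 5 + 6 * R 10 - w * R 11)). Qed.
Let c4 : y12 * q0 = y11 * q1.
Proof. from_relations (h * h * (3 * R 7 - w * R 17)). Qed.
Let c5 : y22 * q0 = y21 * q1.
Proof. from_relations (h * h * ((- 6) * w * R 2 + 3 * R 5 + 6 * R 10 + w * R 11)). Qed.
Let c6 : y21 * p1 = y11 * p2.
Proof. from_relations (h * h * ((- 3) * R 5 - w * R 11)). Qed.
Let c7 : y22 * p1 = y12 * p2.
Proof. from_relations (h * h * (3 * R 6 - 6 * R 8 - w * R 14)). Qed.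
Let c8 : y12 * q1 = y11 * q2.
Proof. from_relations (h * h * ((- 3) * R 5 + w * R 11)). Qed.
Let c9 : y22 * q1 = y21 * q2.
Proof. from_relations (h * h * (3 * R 6 - 6 * R 8 + w * R 14)). Qed.
Let c10 : y21 * p2 = y11 * p3.
Proof. from_relations (h * h * ((- 6) * w * R 0 - 3 * R 6 - w * R 14)). Qed.
Let c11 : y22 * p2 = y12 * p3.
Proof. from_relations (h * h * ((- 3) * R 9 - w * R 16)). Qed.
Let c12 : y12 * q2 = y11 * q3.
Proof. from_relations (h * h * (6 * w * R 0 - 3 * R 6 + w * R 14)). Qed.
Let c13 : y22 * q2 = y21 * q3.
Proof. from_relations (h * h * ((- 3) * R 9 + w * R 16)). Qed.
Let c14 : p1 * p1 = p0 * p2.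
Proof. from_relations (h * h * (w * R 3 + R 13)). Qed.
Let c15 : p1 * p2 = p0 * p3.
Proof. from_relations (h * h * (w * R 4 + R 15)). Qed.
Let c16 : p2 * p2 = p1 * p3.
Proof. from_relations (h * h * (w * R 1 + R 12)). Qed.
Let c17 : q1 * q1 = q0 * q2.
Proof. from_relations (h * h * ((- w) * R 3 + R 13)). Qed.
Let c18 : q1 * q2 = q0 * q3.
Proof. from_relations (h * h * ((- w) * R 4 + R 15)). Qed.
Let c19 : q2 * q2 = q1 * q3.
Proof. from_relations (h * h * ((- w) * R 1 + R 12)). Qed.
(** From here on the left side carries two factors h and the right side three; the added multiple of
    [1 - 54 * h], which is 0, balances the powers. *)
Let c20 : p0 * q0 = y11 * y11 * y11.
Proof. from_relations (h * h * h * ((- 54) * R 19) + (1 - 54 * h) * (p0 * q0)). Qed.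
Let c21 : p0 * q1 = y11 * y11 * y12.
Proof. from_relations (h * h * h * ((- 54) * R 20 + 18 * w * R 22) + (1 - 54 * h) * (p0 * q1)). Qed.
Let c22 : p0 * q2 = y11 * y12 * y12.
Proof.
from_relations (h * h * h * ((- 54) * w * R 3 - 54 * R 13 - 54 * R 21 - 108 * R 23 + 36 * w * R
  25 + 18 * t 9 * R 18) + (1 - 54 * h) * (p0 * q2)).
Qed.
Let c23 : p0 * q3 = y12 * y12 * y12.
Proof.
from_relations (h * h * h * (54 * w * R 4 - 54 * R 15 - 54 * R 24 + 54 * w * R 27 - 108 * R 28 +
  36 * w * R 30 - 3 * w * t 1 * R 18 + 27 * t 7 * R 18) + (1 - 54 * h) * (p0 * q3)).
Qed.
Let c24 : p1 * q0 = y11 * y11 * y21.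
Proof. from_relations (h * h * h * ((- 54) * R 20 - 18 * w * R 22) + (1 - 54 * h) * (p1 * q0)). Qed.
Let c25 : p1 * q1 = y11 * y11 * y22.
Proof. from_relations (h * h * h * ((- 54) * R 21) + (1 - 54 * h) * (p1 * q1)). Qed.
Let c26 : p1 * q2 = y11 * y12 * y22.
Proof. from_relations (h * h * h * ((- 54) * R 24 + 18 * w * R 27) + (1 - 54 * h) * (p1 * q2)). Qed.
Let c27 : p1 * q3 = y12 * y12 * y22.
Proof.
from_relations (h * h * h * (54 * w * R 1 - 54 * R 26 - 108 * R 29 + 36 * w * R 32 + 18 * t 6 *
  R 18) + (1 - 54 * h) * (p1 * q3)).
Qed.
Let c28 : p2 * q0 = y11 * y21 * y21.
Proof.
from_relations (h * h * h * (54 * w * R 3 - 54 * R 13 - 54 * R 21 - 108 * R 23 - 36 * w * R 25 +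
  18 * t 9 * R 18) + (1 - 54 * h) * (p2 * q0)).
Qed.
Let c29 : p2 * q1 = y11 * y21 * y22.
Proof. from_relations (h * h * h * ((- 54) * R 24 - 18 * w * R 27) + (1 - 54 * h) * (p2 * q1)). Qed.
Let c30 : p2 * q2 = y11 * y22 * y22.
Proof. from_relations (h * h * h * (54 * R 12 - 54 * R 26) + (1 - 54 * h) * (p2 * q2)). Qed.
Let c31 : p2 * q3 = y12 * y22 * y22.
Proof. from_relations (h * h * h * ((- 54) * R 31 + 18 * w * R 34) + (1 - 54 * h) * (p2 * q3)). Qed.
Let c32 : p3 * q0 = y21 * y21 * y21.
Proof.
from_relations (h * h * h * ((- 54) * w * R 4 - 54 * R 15 - 54 * R 24 - 54 * w * R 27 - 108 * R
  28 - 36 * w * R 30 + 3 * w * t 1 * R 18 + 27 * t 7 * R 18) + (1 - 54 * h) * (p3 * q0)).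
Qed.
Let c33 : p3 * q1 = y21 * y21 * y22.
Proof.
from_relations (h * h * h * ((- 54) * w * R 1 - 54 * R 26 - 108 * R 29 - 36 * w * R 32 + 18 * t
  6 * R 18) + (1 - 54 * h) * (p3 * q1)).
Qed.
Let c34 : p3 * q2 = y21 * y22 * y22.
Proof. from_relations (h * h * h * ((- 54) * R 31 - 18 * w * R 34) + (1 - 54 * h) * (p3 * q2)). Qed.
Let c35 : p3 * q3 = y22 * y22 * y22.
Proof. from_relations (h * h * h * ((- 54) * R 33) + (1 - 54 * h) * (p3 * q3)). Qed.

Definition S3_ty := S3_y y11 y22 y12 y21.
Definition S3_tp := S3_p p0 p1 p2 p3.
Definition S3_tq := S3_q q0 q1 q2 q3.

Lemma S3_t_balanced : balanced S3_ty S3_tp S3_tq.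
Proof. by apply: S3_balanced. Qed.
End S3Quotient.


(** * Polynomials of weight zero modulo 3, and their parametrisation *)

Section S3Parametrisation.
Variables (C : numClosedFieldType) (w : C).
Hypothesis w2 : w * w = - 3.
Local Notation S := {mpoly C[4]}.
Local Notation x := (@var4 C).
Local Notation W := (w%:MP : S).

(* The variables stand for u_1, v_1, u_2, v_2 divided by 3, where             *)
(* u_1 = 3 (x_1 + z x_2), v_1 = 3 (x_1 + z^2 x_2) and u_2, v_2 are the same   *)
(* forms in x_3, x_4, for the cube root of unity z = (w - 1) / 2.             *)
Definition S3_tau : seq S := [::
  9 * W * (x 0 * x 3 - x 2 * x 1);
  27 * (x 0 * x 0 * x 0 + x 1 * x 1 * x 1);
  - (27 * (x 2 * x 2 * x 2 + x 3 * x 3 * x 3));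
  - (27 * (x 0 * x 2 * x 2 + x 1 * x 3 * x 3));
  - (27 * (x 0 * x 0 * x 2 + x 1 * x 1 * x 3));
  9 * (x 2 * x 3);
  9 * (x 0 * x 3 + x 2 * x 1);
  - (3 * W * (x 0 * x 0 * x 0 - x 1 * x 1 * x 1));
  9 * (x 0 * x 1);
  - (3 * W * (x 2 * x 2 * x 2 - x 3 * x 3 * x 3));
  - (9 * W * (x 0 * x 2 * x 2 - x 1 * x 3 * x 3));
  - (9 * W * (x 0 * x 0 * x 2 - x 1 * x 1 * x 3))].

Local Notation ev := (@param C 12 S3_tau).

Let W2 : W * W = - 3.
Proof. by rewrite -mpolyCM w2 mpolyCN mpolyC_nat. Qed.

Lemma S3_tau_rel : all (fun g => g == 0) (S3_rel (ev \o @Tvar C 11)).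
Proof.
rewrite /S3_rel /= !param_Tvar //=.
by do !(apply/andP; split=> //; first by apply/eqP; ring: W2).
Qed.

Lemma S3_ev_rel g : g \in S3_relations C -> ev g = 0.
Proof.
rewrite S3_relationsE => /(map_f ev); rewrite S3_rel_map.
by move/(allP S3_tau_rel)/eqP.
Qed.

(** The power of z by which the rotation multiplies the monomial: 1 for each u (even index), 2 for
    each v (odd index). *)
Definition S3_weight (m : 'X_{1..4}) : nat :=
  (m (inord 0) + 2 * m (inord 1) + m (inord 2) + 2 * m (inord 3))%N.

Let weight0 : S3_weight 0%MM = 0%N.
Proof. by rewrite /S3_weight !mnm0E. Qed.

Let weightD m m' : S3_weight (m + m')%MM = (S3_weight m + S3_weight m')%N.
Proof. by rewrite /S3_weight !mnmDE; lia. Qed.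

Local Notation wt := (wt_mod 3 S3_weight).

Let wt_var k : (k < 4)%N -> wt (odd k).+1 (x k).
Proof.
move=> k4; apply: wt_modX; rewrite /S3_weight !mnm1E -!val_eqE /= !inordK //.
by case: k k4 => [|[|[|[|]]]].
Qed.

Lemma S3_tau_weight k : wt 0 (nth 0 S3_tau k).
Proof.
have wM c d e (p q : S) : wt c p -> wt d q -> e = (c + d)%N %[mod 3] -> wt e (p * q).
  by move=> cp dq E; exact: (@wt_modM _ _ _ _ weightD _ _ _ _ _ E cp dq).
have x2 a b : (a < 4)%N -> (b < 4)%N -> odd a != odd b -> wt 0 (x a * x b).
  move=> a4 b4 ab; apply: wM (wt_var a4) (wt_var b4) _.
  by move: ab; case: odd; case: odd.
have x3 a b c : (a < 4)%N -> (b < 4)%N -> (c < 4)%N -> odd a = odd b -> odd a = odd c ->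
    wt 0 (x a * x b * x c).
  move=> a4 b4 c4 ab ac; apply: wM (wM _ _ _ _ _ (wt_var a4) (wt_var b4) erefl) (wt_var c4) _.
  by rewrite -ab -ac; case: odd.
have wc (c : S) (p : S) : wt 0 c -> wt 0 p -> wt 0 (c * p).
  by move=> c0 p0; exact: wM c0 p0 _.
have wn n : wt 0 (n%:R : S) by rewrite -mpolyC_nat; exact: wt_modC.
have wW : wt 0 W by exact: wt_modC.
have wD (p q : S) : wt 0 p -> wt 0 q -> wt 0 (p + q) by exact: wt_modD.
have wN (p : S) : wt 0 p -> wt 0 (- p) by exact: wt_modN.
have wB (p q : S) : wt 0 p -> wt 0 q -> wt 0 (p - q) by move=> p0 /wN; exact: wD.
have wnW n : wt 0 (n%:R * W) by apply: wc.
case: k => [|k] /=; first exact: wc _ _ (wnW 9) (wB _ _ (x2 0 3 isT isT isT) (x2 2 1 isT isT isT)).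
case: k => [|k] /=; first exact: wc _ _ (wn 27) (wD _ _ (x3 0 0 0 isT isT isT erefl erefl) (x3 1 1 1 isT isT isT erefl erefl)).
case: k => [|k] /=; first exact: wN _ (wc _ _ (wn 27) (wD _ _ (x3 2 2 2 isT isT isT erefl erefl) (x3 3 3 3 isT isT isT erefl erefl))).
case: k => [|k] /=; first exact: wN _ (wc _ _ (wn 27) (wD _ _ (x3 0 2 2 isT isT isT erefl erefl) (x3 1 3 3 isT isT isT erefl erefl))).
case: k => [|k] /=; first exact: wN _ (wc _ _ (wn 27) (wD _ _ (x3 0 0 2 isT isT isT erefl erefl) (x3 1 1 3 isT isT isT erefl erefl))).
case: k => [|k] /=; first exact: wc _ _ (wn 9) (x2 2 3 isT isT isT).
case: k => [|k] /=; first exact: wc _ _ (wn 9) (wD _ _ (x2 0 3 isT isT isT) (x2 2 1 isT isT isT)).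
case: k => [|k] /=; first exact: wN _ (wc _ _ (wnW 3) (wB _ _ (x3 0 0 0 isT isT isT erefl erefl) (x3 1 1 1 isT isT isT erefl erefl))).
case: k => [|k] /=; first exact: wc _ _ (wn 9) (x2 0 1 isT isT isT).
case: k => [|k] /=; first exact: wN _ (wc _ _ (wnW 3) (wB _ _ (x3 2 2 2 isT isT isT erefl erefl) (x3 3 3 3 isT isT isT erefl erefl))).
case: k => [|k] /=; first exact: wN _ (wc _ _ (wnW 9) (wB _ _ (x3 0 2 2 isT isT isT erefl erefl) (x3 1 3 3 isT isT isT erefl erefl))).
case: k => [|k] /=; first exact: wN _ (wc _ _ (wnW 9) (wB _ _ (x3 0 0 2 isT isT isT erefl erefl) (x3 1 1 3 isT isT isT erefl erefl))).
by rewrite nth_nil => m; rewrite msupp0.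
Qed.
End S3Parametrisation.


Section S3Presentation.
Variables (C : numClosedFieldType) (w : C).
Hypothesis w2 : w * w = - 3.
Local Notation S := {mpoly C[4]}.
Local Notation x := (@var4 C).
Local Notation ev := (@param C 12 (S3_tau w)).

Definition uword (m : 'X_{1..4}) : seq bool :=
  nseq (m (inord 0)) false ++ nseq (m (inord 2)) true.
Definition vword (m : 'X_{1..4}) : seq bool :=
  nseq (m (inord 1)) false ++ nseq (m (inord 3)) true.

Definition S3_weight0 (m : 'X_{1..4}) : bool :=
  size (uword m) == size (vword m) %[mod 3].

(** Since 2 is -1 modulo 3, the weight counts the letters u minus the letters v. *)
Lemma S3_weight0E m : S3_weight0 m = (S3_weight m == 0 %[mod 3]).
Proof. by rewrite /S3_weight0 /S3_weight !size_cat !size_nseq; lia. Qed.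

Lemma uwordD m m' : perm_eq (uword (m + m')%MM) (uword m ++ uword m').
Proof.
by apply/allP => b _ /=; rewrite !count_cat !count_nseq !mnmDE; lia.
Qed.

Lemma vwordD m m' : perm_eq (vword (m + m')%MM) (vword m ++ vword m').
Proof.
by apply/allP => b _ /=; rewrite !count_cat !count_nseq !mnmDE; lia.
Qed.

Lemma S3_ev_ker p :
  ev p = 0 <-> ideal_gen (fun=> True) (fun g => g \in S3_relations C) p.
Proof.
apply: (ker_of_monomial_section (P := S3_weight0)) => {p}.
- exact: paramC.
- exact: S3_ev_rel.
- by rewrite S3_weight0E /S3_weight !mnm0E.
- move=> m m'; rewrite !S3_weight0E /S3_weight !mnmDE => /eqP E /eqP E'; apply/eqP.
  by lia.
- move=> i m; rewrite /= paramX => /S3_tau_weight mE.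
  by rewrite -[_ \in _]/(S3_weight0 m) S3_weight0E mE.
move=> Q pi piP; pose t := pi \o @Tvar C 11.
pose w' := pi w%:MP; pose h := pi (54^-1)%:MP.
have t_rel : all (fun g => g == 0) (S3_rel t).
  rewrite -S3_rel_map -S3_relationsE; apply/allP => _ /mapP[g gr ->].
  by rewrite piP.
have w'2 : w' * w' = - 3 by rewrite /w' -rmorphM -mpolyCM w2 mpolyCN mpolyC_nat rmorphN rmorph_nat.
have h54 : 54 * h = 1.
  by rewrite /h -[54](rmorph_nat pi) -rmorphM -mpolyC_nat -mpolyCM divff ?mpolyC1 ?rmorph1 ?pnatr_eq0.
have bal := S3_t_balanced t_rel w'2 h54.
set y := S3_ty _ _ _ in bal; set tp := S3_tp _ _ _ in bal; set tq := S3_tq _ _ _ in bal.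
exists (fun m => balword y tp tq (uword m) (vword m)); split=> [|m m' m0 m'0|i].
- by rewrite /uword /vword !mnm0E.
- rewrite (balword_perm bal _ (uwordD m m') (vwordD m m')).
    by rewrite balword_cat //; exact/eqP.
  move: m0 m'0; rewrite !S3_weight0E /S3_weight => /eqP E /eqP E'.
  by rewrite /uword /vword !size_cat !size_nseq !mnmDE; lia.
set l := linext _ _.
have l2 i' k' : l (x i' * x k') =
    balword y tp tq (uword (U_(inord i') + U_(inord k'))%MM) (vword (U_(inord i') + U_(inord k'))%MM).
  by rewrite /l -mpolyXD linextX.
have l3 i' k' j' : l (x i' * x k' * x j') =
    balword y tp tq (uword (U_(inord i') + U_(inord k') + U_(inord j'))%MM)
      (vword (U_(inord i') + U_(inord k') + U_(inord j'))%MM).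
  by rewrite /l -!mpolyXD linextX.
have lD p q : l (p + q) = l p + l q by exact: raddfD.
have lN p : l (- p) = - l p by exact: raddfN.
have ln n p : l (n%:R * p) = n%:R * l p.
  by rewrite -mpolyC_nat mul_mpolyC /l linextZ /= mpolyC_nat rmorph_nat.
have lw p : l (w%:MP * p) = w' * l p by rewrite mul_mpolyC /l linextZ.
have y2 : [/\ l (x 0 * x 1) = y false false, l (x 2 * x 3) = y true true,
    l (x 0 * x 3) = y false true & l (x 2 * x 1) = y true false].
  by split; rewrite l2 /uword /vword !mnmDE !mnm1E -!val_eqE /= !inordK //= mulr1.
have p3 : [/\ l (x 0 * x 0 * x 0) = tp false false false, l (x 0 * x 0 * x 2) = tp false false true,
    l (x 0 * x 2 * x 2) = tp false true true & l (x 2 * x 2 * x 2) = tp true true true].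
  by split; rewrite l3 /uword /vword !mnmDE !mnm1E -!val_eqE /= !inordK //= mulr1.
have q3 : [/\ l (x 1 * x 1 * x 1) = tq false false false, l (x 1 * x 1 * x 3) = tq false false true,
    l (x 1 * x 3 * x 3) = tq false true true & l (x 3 * x 3 * x 3) = tq true true true].
  by split; rewrite l3 /uword /vword !mnmDE !mnm1E -!val_eqE /= !inordK //= mulr1.
have [[a1 a2 a3 a4] [b1 b2 b3 b4] [c1 c2 c3 c4]] := And3 y2 p3 q3.
rewrite /= paramX TvarE -[RHS]/(t i.+1); have := ltn_ord i.
case: {i} (val i) => [|[|[|[|[|[|[|[|[|[|[|[|//]]]]]]]]]]]] _ /=;
  rewrite -?mulrA ?lN ?ln ?lw ?mulrA ?lD ?lN ?(a1, a2, a3, a4, b1, b2, b3, b4, c1, c2, c3, c4);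
  rewrite /y /tp /tq /S3_ty /S3_tp /S3_tq /S3_y /S3_p /S3_q /=
    -[RHS]mul1r -[X in _ = X * _]h54; ring: w'2.
Qed.

Lemma S3_onto f : wt_mod 3 S3_weight 0 f -> exists p, ev p = f.
Proof.
pose u (b : bool) := x (if b then 2 else 0); pose v (b : bool) := x (if b then 3 else 1).
pose t := @Tvar C 11; pose h : {mpoly C[12]} := (54^-1)%:MP.
have h54 : 54 * ev h = 1.
  by rewrite paramC -mpolyC_nat -mpolyCM divff ?mpolyC1 ?pnatr_eq0.
have W2 : (w%:MP : S) * w%:MP = - 3 by rewrite -mpolyCM w2 mpolyCN mpolyC_nat.
have evW : ev w%:MP = w%:MP by exact: paramC.
have evT j : (j.-1 < 12)%N -> ev (t j) = nth 0 (S3_tau w) j.-1 by exact: param_Tvar.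
have evE := (rmorph_nat ev, rmorphM ev, rmorphD ev, rmorphN ev, evW, evT).
(* The formulas that solve for the products in a quotient, taken at the variables themselves, are
   preimages under [ev]. *)
have yE a b : exists p, ev p = u a * v b.
  exists (S3_ty t w%:MP h a b); case: a b => [] [];
    rewrite /S3_ty /S3_y /u /v /= !evE /= ?(evW, evT) //= -[RHS]mul1r -[X in _ = X * _]h54; ring: W2.
have pE a b c : exists p, ev p = u a * u b * u c.
  exists (S3_tp t w%:MP h a b c); case: a b c => [] [] [];
    rewrite /S3_tp /S3_p /u /v /= !evE /= ?(evW, evT) //= -[RHS]mul1r -[X in _ = X * _]h54; ring: W2.
have qE a b c : exists p, ev p = v a * v b * v c.
  exists (S3_tq t w%:MP h a b c); case: a b c => [] [] [];
    rewrite /S3_tq /S3_q /u /v /= !evE /= ?(evW, evT) //= -[RHS]mul1r -[X in _ = X * _]h54; ring: W2.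
have triples (F : bool -> S) (FE : forall a b c, exists p, ev p = F a * F b * F c) s :
    (size s %% 3 = 0)%N -> exists p, ev p = \prod_(b <- s) F b.
  have [k] := ubnP (size s); elim: k s => // k IH [|a [|b [|c s]]] //= sk.
    by exists 1; rewrite rmorph1 big_nil.
  rewrite -addn3 modnDr => /(IH s (ltnW (ltnW sk)))[p pp]; have [q qq] := FE a b c.
  by exists (q * p); rewrite (rmorphM ev) /= pp qq !big_cons !mulrA.
have words us vs : (size us = size vs %[mod 3])%N ->
    exists p, ev p = \prod_(b <- us) u b * \prod_(b <- vs) v b.
  elim: us vs => [|a us IH] vs.
    by move=> vs0; have [|p pp] := triples v qE vs; [rewrite -vs0|exists p; rewrite pp big_nil mul1r].
  case: vs => [|b vs].
    by move=> us0; have [p pp] := triples u pE (a :: us) us0; exists p; rewrite pp big_nil mulr1.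
  move=> /= /eqP; rewrite -(addn1 (size vs)) -addn1 eqn_modDr => /eqP/IH[p pp].
  have [q qq] := yE a b; exists (q * p).
  by rewrite (rmorphM ev) /= pp qq !big_cons mulrACA.
move=> fE; rewrite [f]mpolyE big_seq; elim/big_ind: _ => [|f1 f2 [p1 <-] [p2 <-]|m mf].
- by exists 0; rewrite rmorph0.
- by exists (p1 + p2); rewrite rmorphD.
have [|p pp] := words (uword m) (vword m).
  by apply/eqP; rewrite -/(S3_weight0 m) S3_weight0E fE.
exists ((f@_m)%:MP * p); rewrite (rmorphM ev) /= paramC mul_mpolyC pp; congr (_ *: _).
rewrite !big_cat !big_nseq !iter_mulr_1 /u /v /=.
transitivity (\prod_(i < 4) x i ^+ m (inord i)).
  by rewrite !big_ord_recr big_ord0 /= mul1r mulrACA -!mulrA; congr (_ * _); rewrite mulrCA.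
by rewrite mpolyXE_id; apply: eq_bigr => i _; rewrite var4X inord_val.
Qed.
End S3Presentation.


(** * Diagonal coordinates for the rotation of order three *)

Lemma cube_root_exists (C : numClosedFieldType) : exists z : C, z * z = - 1 - z.
Proof.
pose w : C := 'i * sqrtC 3; pose h : C := 2^-1; exists (h * (w - 1)).
have w2 : w * w = - 3 by rewrite /w mulrACA -expr2 sqrCi -expr2 sqrtCK mulN1r.
have h2 : 2 * h = 1 by rewrite divff // pnatr_eq0.
transitivity (- (2 * h) * (h + h * w)); first by ring: w2.
by rewrite h2 -{2}h2; ring.
Qed.

(* The coordinates u_1, v_1, u_2, v_2 divided by 3 (see [S3_tau]), on which   *)
(* the rotation is diagonal; in the inverse, v stands for 1 / (1 - z).        *)
Definition S3_theta (C : fieldType) (z : C) : seq {mpoly C[4]} :=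
  let x := @var4 C in let Z := z%:MP in
  [:: x 0 + Z * x 1; x 0 + Z * Z * x 1; x 2 + Z * x 3; x 2 + Z * Z * x 3].
Definition S3_theta' (C : fieldType) (z v : C) : seq {mpoly C[4]} :=
  let x := @var4 C in let Z := z%:MP in let V := v%:MP in
  [:: x 0 - V * (x 0 - x 1); (V - 1 - Z) * (x 0 - x 1);
      x 2 - V * (x 2 - x 3); (V - 1 - Z) * (x 2 - x 3)].

Lemma rmorph_var4 (C : fieldType) (tau : seq {mpoly C[4]}) :
  exists g : {rmorphism {mpoly C[4]} -> {mpoly C[4]}},
    (forall c, g c%:MP = c%:MP) /\ forall k, (k < 4)%N -> g (var4 C k) = nth 0 tau k.
Proof.
exists (@param C 4 tau); split=> [c|k k4]; first exact: paramC.
by rewrite -[LHS]/(param tau 'X_(inord k)) paramX inordK.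
Qed.

Section S3Cox.
Variables (C : numClosedFieldType) (z : C).
Hypothesis zz : z * z = - 1 - z.
Local Notation S := {mpoly C[4]}.
Local Notation x := (@var4 C).
Local Notation Z := (z%:MP : S).

Let w : C := 2 * z + 1.
Let w2 : w * w = - 3.
Proof. by rewrite /w; ring: zz. Qed.

Let ZZ : Z * Z = - 1 - Z.
Proof. by rewrite -mpolyCM zz mpolyCB mpolyCN mpolyC1. Qed.

Variable v : C.
Hypothesis zv : z * v = v - 1.
Local Notation V := (v%:MP : S).
Let ZV : Z * V = V - 1.
Proof. by rewrite -mpolyCM zv mpolyCB mpolyC1. Qed.

Variables th th' : {rmorphism S -> S}.
Hypothesis thC : forall c, th c%:MP = c%:MP.
Hypothesis th'C : forall c, th' c%:MP = c%:MP.
Hypothesis thX : forall k, (k < 4)%N -> th (x k) = nth 0 (S3_theta z) k.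
Hypothesis th'X : forall k, (k < 4)%N -> th' (x k) = nth 0 (S3_theta' z v) k.

Let thD p q : th (p + q) = th p + th q. Proof. exact: rmorphD. Qed.
Let thN p : th (- p) = - th p. Proof. exact: rmorphN. Qed.
Let thM p q : th (p * q) = th p * th q. Proof. exact: rmorphM. Qed.
Let th1 : th 1 = 1. Proof. exact: rmorph1. Qed.
Let thE := (thM, thD, thN, th1, thC).
Let th'D p q : th' (p + q) = th' p + th' q. Proof. exact: rmorphD. Qed.
Let th'M p q : th' (p * q) = th' p * th' q. Proof. exact: rmorphM. Qed.

Let thK : cancel th th'.
Proof.
have thKX k : (k < 4)%N -> th' (th (x k)) = x k.
  by case: k => [|[|[|[|//]]]] _; rewrite thX //= !(th'D, th'M) th'C !th'X //=; ring: ZV ZZ.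
apply: (mpoly_morph_ext (u := th' \o th) (v := idfun)) => [c|].
  exact: etrans (congr1 th' (thC c)) (th'C c).
by elim/ord4_ind; exact: thKX.
Qed.

Let th'K : cancel th' th.
Proof.
have th'KX k : (k < 4)%N -> th (th' (x k)) = x k.
  by case: k => [|[|[|[|//]]]] _; rewrite th'X //= !thE !thX //=; ring: ZV ZZ.
apply: (mpoly_morph_ext (u := th \o th') (v := idfun)) => [c|].
  exact: etrans (congr1 th (th'C c)) (thC c).
by elim/ord4_ind; exact: th'KX.
Qed.

Let S3_r_rows : seq (seq int) := [:: [:: 0; -1; 0;  0];
  [:: 1; -1; 0;  0]; [:: 0;  0; 0; -1]; [:: 0;  0; 1;  -1]].
Let S3_s_rows : seq (seq int) := [:: [:: -1;  1; 0;  0];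
  [::  0; 1; 0;  0]; [::  0;  0; -1; 1]; [::  0;  0; 0; 1]].
Let r := mx_of C 4 4 S3_r_rows.
Let s := mx_of C 4 4 S3_s_rows.

Let mxactE := (mulr0z, mulr1z, mulrN1z, scale0r, scale1r, scaleN1r, add0r, addr0).

Let r0 : mxact r (x 0) = - x 1. Proof. by rewrite mxact_var4 //= !mxactE. Qed.
Let r1 : mxact r (x 1) = x 0 - x 1. Proof. by rewrite mxact_var4 //= !mxactE. Qed.
Let r2 : mxact r (x 2) = - x 3. Proof. by rewrite mxact_var4 //= !mxactE. Qed.
Let r3 : mxact r (x 3) = x 2 - x 3. Proof. by rewrite mxact_var4 //= !mxactE. Qed.
Let s0 : mxact s (x 0) = x 1 - x 0. Proof. by rewrite mxact_var4 //= !mxactE addrC. Qed.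
Let s1 : mxact s (x 1) = x 1. Proof. by rewrite mxact_var4 //= !mxactE. Qed.
Let s2 : mxact s (x 2) = x 3 - x 2. Proof. by rewrite mxact_var4 //= !mxactE addrC. Qed.
Let s3 : mxact s (x 3) = x 3. Proof. by rewrite mxact_var4 //= !mxactE. Qed.
Let actE := (r0, r1, r2, r3, s0, s1, s2, s3).

Let chi1 (u : 'Z_2) := false.
Let chi2 (u : 'Z_2) := odd u.

Let ss1 : s *m s = 1%:M.
Proof. by rewrite /s mx_of_mul -mx_of_id. Qed.

Let rsrs1 : r *m s *m (r *m s) = 1%:M.
Proof. by rewrite /r /s !mx_of_mul -mx_of_id. Qed.

Let r31 f : iter 3 (mxact r) f = f.
Proof.
rewrite iter_mxact -[RHS]mxact1; congr (mxact _ f).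
by rewrite /= mulmx1 /r !mx_of_mul -mx_of_id.
Qed.

Let chi1D : {morph chi1 : a b / a + b >-> a (+) b}.
Proof. by []. Qed.

Let chi2D : {morph chi2 : a b / a + b >-> a (+) b}.
Proof. by move=> a b; exact: odd_Z2D. Qed.

Let chi_inj a b : chi1 a = chi1 b -> chi2 a = chi2 b -> a = b.
Proof. by move=> _; exact: odd_Z2_inj. Qed.

Let chi_onto (b1 b2 : bool) : ~~ (b1 && odd 3) -> exists u, chi1 u = b1 /\ chi2 u = b2.
Proof.
by case: b1 => // _; exists (b2%:R : 'Z_2); rewrite /chi2 nat_Z2_odd.
Qed.

Let S3_diag : exists2 g : {rmorphism S -> S}, (forall c, g c%:MP = c%:MP) /\
    (forall k, (k < 4)%N -> g (x k) = (if odd k then - 1 - Z else Z) * x k) &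
  forall p, mxact r (th p) = th (g p).
Proof.
have [g [gC gX]] := rmorph_var4 [:: Z * x 0; (- 1 - Z) * x 1; Z * x 2; (- 1 - Z) * x 3].
exists g => [|p]; first by split=> // k k4; rewrite gX //; case: k k4 => [|[|[|[|]]]].
apply: (mpoly_morph_ext (u := mxact r \o th) (v := th \o g)) => [c|] {p}.
  by rewrite -[LHS]/(mxact r (th _)) -[RHS]/(th (g _)) gC thC mxactC.
suff H k : (k < 4)%N -> mxact r (th (x k)) = th (g (x k)) by elim/ord4_ind; exact: H.
by case: k => [|[|[|[|//]]]] _; rewrite gX //= !thE !thX //= !(rmorphM, rmorphD) /= mxactC !actE;
  ring: ZZ.
Qed.

Let S3_swap : exists2 g : {rmorphism S -> S}, (forall c, g c%:MP = c%:MP) /\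
    (forall k, (k < 4)%N -> g (x k) = - x (if odd k then k.-1 else k.+1)) &
  forall p, mxact s (th p) = th (g p).
Proof.
have [g [gC gX]] := rmorph_var4 [:: - x 1; - x 0; - x 3; - x 2].
exists g => [|p]; first by split=> // k k4; rewrite gX //; case: k k4 => [|[|[|[|]]]].
apply: (mpoly_morph_ext (u := mxact s \o th) (v := th \o g)) => [c|] {p}.
  by rewrite -[LHS]/(mxact s (th _)) -[RHS]/(th (g _)) gC thC mxactC.
suff H k : (k < 4)%N -> mxact s (th (x k)) = th (g (x k)) by elim/ord4_ind; exact: H.
by case: k => [|[|[|[|//]]]] _; rewrite gX //= !thE !thX //= !(rmorphM, rmorphD) /= mxactC !actE;
  ring: ZZ.
Qed.

Let in01 : pred 'I_4 := fun i => (i < 2)%N.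
Let semi := (semi_inv r s chi1 chi2).
Let semiE (u : 'Z_2) (b : S) : mxact r b = b -> mxact s b = (-1) ^+ odd u * b -> semi u b.
Proof. by move=> rb sb; split=> //; rewrite mul1r. Qed.

Let out1 k : (k < 2)%N -> scale_out in01 (x k) = (x k)%:P.
Proof. by move=> k2; rewrite scale_outX /in01 inordK ?k2 //; exact: leq_trans k2 _. Qed.

Let out2 k : (1 < k < 4)%N -> scale_out (predC in01) (x k) = (x k)%:P.
Proof. by case/andP=> k1 k4; rewrite scale_outX /= /in01 inordK // ltnNge k1. Qed.

Let coprime_pair (u : 'Z_2) : exists b b', [/\ semi u b, semi u b' &
  forall d, divides d b -> divides d b' -> d \is a GRing.unit].
Proof.
pose e (i : 'I_4) : C := (~~ odd i)%:R.
have eE k : (k < 4)%N -> (x k).@[e] = (~~ odd k)%:R by move=> k4; rewrite mevalXU /e inordK.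
case E2: (odd u); last first.
  exists 1, 1; split; rewrite ?/semi.
  - by apply: semiE; rewrite rmorph1 ?E2 ?mulr1.
  - by apply: semiE; rewrite rmorph1 ?E2 ?mulr1.
  - by move=> d /divides_unit H _; apply: H; exact: unitr1.
(* This is u^3 + v^3: the rotation multiplies u and v by cube roots of unity, and s sends u to -v
   and v to -u, so the sum is fixed by r and changes sign under s. *)
pose f (i j : nat) := (x i + Z * x j) ^+ 3 + (x i + Z * Z * x j) ^+ 3.
have f2 i j : ~~ odd i -> odd j -> (i < 4)%N -> (j < 4)%N -> f i j != 0.
  move=> i0 j1 i4 j4; apply: (@meval_neq0 _ _ _ e).
  rewrite mevalD !rmorphXn /= !mevalD !mevalM !eE // i0 j1 !mulr0 !addr0 expr1n -mulr2n.
  by rewrite pnatr_eq0.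
exists (f 0 1), (f 2 3); split.
- by apply: semiE; rewrite /f ?E2 rmorphD !rmorphXn !rmorphD !rmorphM /= !mxactC !actE; ring: ZZ.
- by apply: semiE; rewrite /f ?E2 rmorphD !rmorphXn !rmorphD !rmorphM /= !mxactC !actE; ring: ZZ.
apply: (disjoint_coprime (P := in01)); rewrite ?f2 //.
- by rewrite /f !exprS !expr0 !mulr1 !(scale_outD, scale_outM) !scale_outC !out1 // -!polyCM -!polyCD -!polyCM -polyCD.
- by rewrite /f !exprS !expr0 !mulr1 !(scale_outD, scale_outM) !scale_outC !out2 // -!polyCM -!polyCD -!polyCM -polyCD.
Qed.

Let ev : {rmorphism {mpoly C[12]} -> S} := th \o @param C 12 (S3_tau w).

Let S3_tau_semi i : semi (S3_degrees 0 i) (ev 'X_i).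
Proof.
have -> : ev 'X_i = th (nth 0 (S3_tau w) i) by rewrite /= paramX.
apply: semiE.
  have [g [gC gX] ->] := S3_diag; congr (th _).
  have gn n : g n%:R = n%:R by exact: rmorph_nat.
  have gE := (gn, gC, rmorphN g, rmorphM g, rmorphB g, rmorphD g).
  by case: i => [[|[|[|[|[|[|[|[|[|[|[|[|//]]]]]]]]]]]] Hi] /=; rewrite !gE !gX //=; ring: ZZ.
have [g [gC gX] ->] := S3_swap; rewrite /S3_degrees !mxE /=.
have gn n : g n%:R = n%:R by exact: rmorph_nat.
have gE := (gn, gC, rmorphN g, rmorphM g, rmorphB g, rmorphD g).
case: i => [[|[|[|[|[|[|[|[|[|[|[|[|//]]]]]]]]]]]] Hi] /=; rewrite ?expr1 ?expr0 ?mulN1r ?mul1r -?thN;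
  congr (th _); rewrite !gE !gX //=; ring.
Qed.

Lemma S3_cox_presentation_theta :
  cox_presentation (inv_const (gengroup (S3_gens C)))
    (fun j => S3_degrees 0 j : 'Z_2) (S3_relations C).
Proof.
pose G := semi_inv_grading ss1 rsrs1 r31 Z2_addww chi1D chi2D chi_inj chi_onto coprime_pair.
apply: (@cox_presentation_of_grading _ _ 'Z_2 G C _ 12 _ _ ev) => //.
- by move=> c; rewrite /= paramC thC.
- move=> p; rewrite -(S3_ev_ker w2) /=; split=> [|->]; last exact: rmorph0.
  by rewrite -[RHS](rmorph0 th) => /(can_inj thK).
move=> u b [rb sb]; have [|p pE] := S3_onto w2 (f := th' b); last first.
  by exists p; rewrite /= pE th'K.
have [g [gC gX] gr] := S3_diag.
have gb : g (th' b) = th' b by apply: (can_inj thK); rewrite -gr th'K rb mul1r.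
pose e (i : 'I_4) := (odd i).+1; have geX i : g 'X_i = (z ^+ e i)%:MP * 'X_i.
  rewrite !var4X gX // /e; case: odd; first by rewrite expr2 mpolyCM ZZ.
  by rewrite expr1.
move=> m mb; have := diagonal_fixed (e := e) gC geX gb mb.
have -> : (\sum_(i < 4) e i * m i = S3_weight m)%N.
  by rewrite sum_ord4 /e /S3_weight !inordK //= !mul1n.
have z3 : z ^+ 3 = 1 by rewrite !exprS expr0 mulr1; ring: zz.
(* A weight of 1 or 2 modulo 3 would give z = 1 or z^2 = 1, and each contradicts the equation of z
   since 3 is not 0. *)
have n3 : 3 != 0 :> C by rewrite pnatr_eq0.
rewrite {1}(divn_eq (S3_weight m) 3) exprD mulnC exprM z3 expr1n mul1r mod0n.
have := @ltn_pmod (S3_weight m) 3 isT; case: (_ %% 3)%N => [|[|[|//]]] // _ zE.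
- rewrite expr1 in zE; case/eqP: n3; move: zz; rewrite zE => E.
  by transitivity (1 * 1 - (- 1 - 1) : C); [ring | rewrite E subrr].
- have zE' : z = - 2.
    transitivity (- 1 - (- 1 - z)); first by ring.
    by rewrite -zz -expr2 zE; ring.
  case/eqP: n3; move: zz; rewrite zE' => E.
  by transitivity ((- 2) * (- 2) - (- 1 - - 2) : C); [ring | rewrite E subrr].
Qed.
End S3Cox.

Lemma S3_cox_presentation (C : numClosedFieldType) :
  cox_presentation (inv_const (gengroup (S3_gens C)))
    (fun j => S3_degrees 0 j : 'Z_2) (S3_relations C).
Proof.
have [z zz] := cube_root_exists C.
have [th [thC thX]] := rmorph_var4 (S3_theta z).
have h3 : 3 * 3^-1 = 1 :> C by rewrite divff // pnatr_eq0.
(* The product (1 - z)(2 + z) is 3, so (2 + z) / 3 is the inverse of 1 - z. *)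
have zv : z * ((2 + z) / 3) = (2 + z) / 3 - 1.
  by transitivity ((2 + z) * 3^-1 - 3 * 3^-1); [ring: zz | rewrite h3].
have [th' [th'C th'X]] := rmorph_var4 (S3_theta' z ((2 + z) / 3)).
exact: (S3_cox_presentation_theta zz zv thC th'C thX th'X).
Qed.


(** * The two matrix groups *)

Section DihedralWords.
Variables (T : Type) (e : T) (op : T -> T -> T).
Hypotheses (opA : associative op) (op1l : left_id e op) (op1r : right_id e op).
Variables (x y : T) (q : nat).
Local Notation pow := (fun n => iter n (op x) e).
Hypotheses (xq : pow q = e) (yy : op y y = e) (yx : op y x = op (pow q.-1) y).

Definition dihedral_word i (b : bool) : T := op (iter i (op x) e) (if b then y else e).

Let powD m n : pow (m + n)%N = op (pow m) (pow n).
Proof. by elim: m => [|m IH] /=; rewrite ?op1l // IH opA. Qed.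

Let powM m n : pow m = e -> pow (n * m)%N = e.
Proof. by move=> xm; elim: n => // n IH; rewrite mulSn powD xm op1l. Qed.

Let y_pow n : op y (pow n) = op (pow (q.-1 * n)%N) y.
Proof.
elim: n => [|n IH] /=; first by rewrite muln0 op1l op1r.
by rewrite opA yx -opA IH mulnS powD !opA.
Qed.

Lemma dihedral_word_mod i b : dihedral_word (i %% q) b = dihedral_word i b.
Proof.
by congr (op _ _); rewrite [in RHS](divn_eq i q) powD powM ?op1l.
Qed.

Lemma dihedral_wordM i b j c : op (dihedral_word i b) (dihedral_word j c) =
  dihedral_word (i + (if b then q.-1 * j else j)) (b (+) c).
Proof.
rewrite /dihedral_word powD; case: b => /=; last by rewrite op1r opA.
rewrite -!opA; congr (op _ _); rewrite opA y_pow -opA; congr (op _ _).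
by case: c; rewrite ?op1r.
Qed.
End DihedralWords.

Section DihedralRepresentation.
Variables (gT : finGroupType) (x y : gT) (q : nat).
Hypotheses (ox : #[x]%g = q) (notXy : y \notin <[x]>%g) (y2 : (y ^+ 2 = 1)%g).
Hypotheses (xy : (x ^ y = x^-1)%g) (cardT : #|gT| = (2 * q)%N).
Variables (C : fieldType) (n : nat) (r s : 'M[C]_n).
Local Notation mpow := (fun k => iter k (mulmx r) 1%:M).
Hypotheses (rq : mpow q = 1%:M) (s2 : s *m s = 1%:M) (sr : s *m r = mpow q.-1 *m s).
Local Notation gword := (dihedral_word 1%g (@mulg gT) x y).
Local Notation mword := (dihedral_word 1%:M (@mulmx C n n n) r s).
Hypothesis mword_inj : forall i b, (i < q)%N -> mword i b = 1%:M -> i = 0%N /\ b = false.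

Let iterX (z : gT) k : iter k (mulg z) 1%g = (z ^+ k)%g.
Proof. by elim: k => //= k ->; rewrite expgS. Qed.

Let q0 : (0 < q)%N. Proof. by rewrite -ox order_gt0. Qed.

Let yy : (y * y = 1)%g. Proof. by rewrite -y2 expgS expg1. Qed.

Let yx : (y * x = iter q.-1 (mulg x) 1 * y)%g.
Proof.
rewrite iterX; apply: (mulIg y); rewrite -[RHS]mulgA yy mulg1.
have -> : (x ^+ q.-1 = x^-1)%g.
  by apply: (mulgI x); rewrite mulgV -expgS prednK // -ox expg_order.
by rewrite -xy conjgE -mulgA; congr (_ * _)%g; apply: (mulgI y); rewrite yy mulgV.
Qed.

Let xq : iter q (mulg x) 1%g = 1%g. Proof. by rewrite iterX -ox expg_order. Qed.

Let gwordM := dihedral_wordM (@mulgA gT) (@mul1g gT) (@mulg1 gT) yy yx.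
Let mwordM := dihedral_wordM (@mulmxA C n n n n) (@mul1mx C n n) (@mulmx1 C n n) s2 sr.
Let gword_mod := dihedral_word_mod (@mulgA gT) (@mul1g gT) y xq.
Let mword_mod := dihedral_word_mod (@mulmxA C n n n n) (@mul1mx C n n) s rq.

Let enc (u : 'I_q * bool) : gT := gword u.1 u.2.

Let enc_inj : injective enc.
Proof.
move=> [i b] [j c]; rewrite /enc /dihedral_word /= !iterX => E.
have bc : b = c.
  case: b c E => [] [] // E; case/negP: notXy.
  - have -> : y = (x ^- i * x ^+ j)%g by rewrite -[RHS]mulg1 -mulgA -E mulKg.
    by rewrite groupM ?groupV ?mem_cycle.
  - have -> : y = (x ^- j * x ^+ i)%g by rewrite -[RHS]mulg1 -mulgA E mulKg.
    by rewrite groupM ?groupV ?mem_cycle.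
move: E; rewrite bc => /mulIg/eqP; rewrite eq_expg_mod_order ox !modn_small //.
by move=> /eqP ij; congr (_, _); exact: val_inj.
Qed.

Let enc_onto g : exists u, enc u == g.
Proof.
have [|f fK encK] := inj_card_bij enc_inj.
  by rewrite cardT card_prod card_ord card_bool mulnC.
by exists (f g); apply/eqP; exact: encK.
Qed.

Let dec g : {u | enc u = g}.
Proof. by exists (xchoose (enc_onto g)); exact: (eqP (xchooseP (enc_onto g))). Qed.

Let rho g := mword (sval (dec g)).1 (sval (dec g)).2.

Let rho_word i b : rho (gword i b) = mword i b.
Proof.
rewrite /rho; case: dec => [[j c]] /= E; rewrite -[RHS]mword_mod.
have : enc (j, c) = enc (Ordinal (ltn_pmod i q0), b) by rewrite E /enc /= gword_mod.
by move/enc_inj=> [-> ->].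
Qed.

Let gwordP g : exists i b, g = gword i b.
Proof. by have [[i b] <-] := dec g; exists i, b. Qed.

Let rhoM g h : rho (g * h)%g = rho g *m rho h.
Proof.
have [[i [b ->]] [j [c ->]]] := (gwordP g, gwordP h).
by rewrite gwordM !rho_word mwordM.
Qed.

Let rho1 : rho 1%g = 1%:M.
Proof. by rewrite -[1%g in LHS](mulg1 1%g) -/(gword 0 false) rho_word /dihedral_word mulmx1. Qed.

(** Normal forms x^i y^b multiply by the same rule in the abstract group and among the matrices, so
    reading the normal form of an element as a matrix word is a homomorphism. Injectivity needs only
    the 2q normal forms. *)
Lemma dihedral_mx_group_iso : mx_group_iso gT (gengroup [:: r; s]).
Proof.
have rhoV g : rho g^-1%g *m rho g = 1%:M by rewrite -rhoM mulVg rho1.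
exists rho; split=> // [g h E|g].
  have : rho (g * h^-1)%g = 1%:M by rewrite rhoM E -rhoM mulgV rho1.
  have [[i b] E2] := dec (g * h^-1)%g; rewrite -E2 /enc rho_word => /mword_inj[] //= i0 b0.
  by move: E2; rewrite /enc /= i0 b0 /dihedral_word /= mulg1 => /esym/eqP; rewrite -eq_mulgV1 => /eqP.
split=> [|[z <-]].
  elim=> [{}g|| {}g h _ [a <-] _ [b <-]|{}g _ [a <-]].
  - rewrite !inE => /orP[] /eqP ->.
      by exists (gword 1 false); rewrite rho_word /dihedral_word /= !mulmx1.
    by exists (gword 0 true); rewrite rho_word /dihedral_word /= mul1mx.
  - by exists 1%g.
  - by exists (a * b)%g.
  - exists a^-1%g; have [_ aU] := mulmx1_unit (rhoV a).
    by apply: (can_inj (mulmxK aU)); rewrite rhoV mulVmx.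
have rG : gengroup [:: r; s] r by apply: gengroup_gen; rewrite mem_head.
have sG : gengroup [:: r; s] s by apply: gengroup_gen; rewrite !inE eqxx orbT.
rewrite /rho /dihedral_word; apply: gengroupM; last by case: ifP => _ //; exact: gengroup1.
by elim: (nat_of_ord _) => [|k IH] /=; [exact: gengroup1 | exact: gengroupM].
Qed.
End DihedralRepresentation.


(** In characteristic 0 distinct integer matrices stay distinct, so a computation can refute an
    equality. *)
Lemma mx_of_entries (C : numFieldType) m n A B : mx_of C m n A = mx_of C m n B ->
  all (fun i => all (fun j => nth 0 (nth [::] A i) j == nth 0 (nth [::] B i) j) (iota 0 n)) (iota 0 m).
Proof.
move=> AB; apply/allP => i; rewrite mem_iota => /= im; apply/allP => j; rewrite mem_iota => /= jn.
by move/matrixP/(_ (Ordinal im) (Ordinal jn)): AB; rewrite !mxE => /intr_inj ->.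
Qed.

Lemma S3_mx_group_iso (C : numFieldType) :
  mx_group_iso {perm 'I_3} (gengroup (S3_gens C)).
Proof.
pose a := @Ordinal 3 0 isT; pose b := @Ordinal 3 1 isT; pose c := @Ordinal 3 2 isT.
pose y : {perm 'I_3} := tperm a b; pose t : {perm 'I_3} := tperm b c; pose x := (y * t)%g.
have y2 : (y ^+ 2 = 1)%g by rewrite expgS expg1 tperm2.
have x3 : #[x]%g = 3.
  have xxx : (x ^+ 3 = 1)%g.
    apply/permP => i; rewrite !expgS expg0 mulg1 !permM perm1.
    by case: i => [[|[|[|//]]] Hi]; rewrite !permE /=; apply: val_inj.
  apply: nt_prime_order xxx _ => //.
  by apply/eqP => E; move/permP/(_ a): E; rewrite permM !permE.
apply: (dihedral_mx_group_iso x3 _ y2).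
- apply/negP => /order_dvdG; rewrite -orderE x3 (@nt_prime_order _ 2) //.
  by apply/eqP => /permP/(_ a); rewrite !permE.
- by rewrite conjgE /x invMg !tpermV mulgA !mulgA tperm2 mul1g.
- by rewrite card_Sn.
- by rewrite /= mulmx1 !mx_of_mul -mx_of_id.
- by rewrite mx_of_mul -mx_of_id.
- by rewrite /= mulmx1 !mx_of_mul.
move=> i b'; rewrite /dihedral_word; case: i => [|[|[|//]]] _; case: b' => //=;
  rewrite ?mulmx1 ?mul1mx ?mx_of_mul -mx_of_id => /mx_of_entries; vm_compute; discriminate.
Qed.

Lemma D8_mx_group_iso (C : numFieldType) : mx_group_iso 'D_8 (gengroup (D8_gens C)).
Proof.
have [|[x y]] := @generators_2dihedral 'D_8 [set: 'D_8]%G 3 isT.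
  exact: isog_refl.
move=> [oG Gx ox]; rewrite inE => /andP[nXy _] [oy xy].
apply: (dihedral_mx_group_iso ox nXy _ xy).
- by have := expg_order y; rewrite oy.
- by rewrite -cardsT oG.
- by rewrite /= mulmx1 !mx_of_mul -mx_of_id.
- by rewrite mx_of_mul -mx_of_id.
- by rewrite /= mulmx1 !mx_of_mul.
move=> i b'; rewrite /dihedral_word; case: i => [|[|[|[|//]]]] _; case: b' => //=;
  rewrite ?mulmx1 ?mul1mx ?mx_of_mul -mx_of_id => /mx_of_entries; vm_compute; discriminate.
Qed.

(** * Absence of pseudo-reflections *)

Section DoubledRepresentation.
Variable C : fieldType.

(** Each of the two groups acts by two copies of one plane representation. *)
Definition doubled (g : 'M[C]_(2 + 2)) : Prop :=
  g = block_mx (ulsubmx g) 0 0 (ulsubmx g).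

Lemma doubledP (h : 'M[C]_2) : doubled (block_mx h 0 0 h).
Proof. by rewrite /doubled block_mxKul. Qed.

Lemma gengroup_doubled gens : (forall g, g \in gens -> doubled g) ->
  forall g : 'M[C]_(2 + 2), gengroup gens g -> doubled g.
Proof.
move=> gensD g; elim=> [{}g /gensD //||{}g h _ -> _ ->|{}g _ gD].
- by rewrite -[X in doubled X]/(1%:M : 'M[C]_(2 + 2)) scalar_mx_block; exact: doubledP.
- by rewrite mulmx_block !(mulmx0, mul0mx, addr0, add0r); exact: doubledP.
(* On a singular matrix [invmx] returns the matrix itself. *)
have [gU|gU] := boolP (g \in unitmx); last by rewrite invmx_out.
by rewrite gD in gU *; rewrite invmx_block_diag //; exact: doubledP.
Qed.

(* The fixed space of a doubled matrix has even dimension.                    *)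
Lemma doubled_small gens : (forall g, g \in gens -> doubled g) ->
  small_group (gengroup gens).
Proof.
move=> gensD g /(gengroup_doubled gensD) gD [_].
rewrite /eigenspace mxrank_ker -[X in X - _](_ : (block_mx (ulsubmx g) 0 0 (ulsubmx g))^T = _); last first.
  by rewrite -gD.
rewrite tr_block_mx !trmx0 (scalar_mx_block 2 2 (1 : C)) opp_block_mx add_block_mx !oppr0 !addr0.
by rewrite rank_diag_block_mx; lia.
Qed.
End DoubledRepresentation.

Lemma S3_small (C : fieldType) : small_group (gengroup (S3_gens C)).
Proof.
apply: doubled_small => g; rewrite !inE => /orP[] /eqP ->;
  rewrite /doubled -[LHS](@submxK _ 2 2 2 2); congr block_mx;
  by apply/matrixP => -[[|[|//]] ?] [[|[|//]] ?]; rewrite !mxE.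
Qed.

Lemma D8_small (C : fieldType) : small_group (gengroup (D8_gens C)).
Proof.
apply: doubled_small => g; rewrite !inE => /orP[] /eqP ->;
  rewrite /doubled -[LHS](@submxK _ 2 2 2 2); congr block_mx;
  by apply/matrixP => -[[|[|//]] ?] [[|[|//]] ?]; rewrite !mxE.
Qed.

Theorem proposition5p1 (R : realType) :
  (let G := gengroup (S3_gens R[i]) in
   [/\ mx_group_iso {perm 'I_3} G, small_group G &
       cox_presentation (inv_const G) (fun j => S3_degrees 0 j : 'Z_2)
         (S3_relations R[i])]) /\
  (let G := gengroup (D8_gens R[i]) in
   [/\ mx_group_iso ('D_8)%type G, small_group G &
       cox_presentation (inv_const G)
         (fun j => (D8_degrees 0 j, D8_degrees 1 j) : 'Z_2 * 'Z_2)
         (D8_relations R[i])]).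
Proof.
split.
  split; [exact: S3_mx_group_iso | exact: S3_small | exact: S3_cox_presentation].
split; [exact: D8_mx_group_iso | exact: D8_small | exact: D8_cox_presentation].
Qed.
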